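(* A spacelike surface $M$ in $\mathbb{S}^{m}_s(1)$ has non-harmonic 1-type pseudo-spherical Gauss map if and only if it is an open part of the Clifford torus lying fully in a totally geodesic 3-sphere $\mathbb{S}^3(1)\subset\mathbb{S}^{m}_s(1)$.
   Context: $\mathbb{E}^{m}_s$ denotes $\mathbb{R}^m$ with the metric $ds^2=\sum_{i=1}^{m-s}dx_i^2-\sum_{j=m-s+1}^{m}dx_j^2$ and associated inner product $\langle\cdot,\cdot\rangle$. The pseudo-sphere of dimension $m$ and index $s$ is $\mathbb{S}^m_s(1)=\{x\in\mathbb{E}^{m+1}_s \mid \langle x,x\rangle=1\}$ with the induced metric; $\mathbb{S}^3(1)=\mathbb{S}^3_0(1)$. A surface in $\mathbb{S}^m_s(1)$ is an isometrically immersed 2-dimensional oriented (pseudo-)Riemannian manifold $\mathbf{x}:M\to\mathbb{S}^m_s(1)$, locally identified with its image; it is spacelike if its induced metric is Riemannian. A totally geodesic 3-sphere $\mathbb{S}^3(1)\subset\mathbb{S}^m_s(1)$ is the intersection of $\mathbb{S}^m_s(1)$ with a 4-dimensional positive definite linear subspace of $\mathbb{E}^{m+1}_s$. Pseudo-spherical Gauss map: $\bigwedge^{3}\mathbb{E}^{m+1}_s$ carries the pseudo-Euclidean inner product determined by $\langle\langle f_{i_1}\wedge f_{i_2}\wedge f_{i_3},\, g_{j_1}\wedge g_{j_2}\wedge g_{j_3}\rangle\rangle=\det(\langle f_{i_\ell},g_{j_k}\rangle)$ and is thereby identified with a pseudo-Euclidean space $\mathbb{E}^N_q$, $N=\binom{m+1}{3}$.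 The pseudo-spherical Gauss map of $M$ is $\nu:M\to\bigwedge^3\mathbb{E}^{m+1}_s=\mathbb{E}^N_q$, $\nu(p)=\mathbf{x}(p)\wedge e_1\wedge e_2$, where $\{e_1,e_2\}$ is any positively oriented orthonormal basis of $T_pM$. (It takes values in the Grassmannian $G(3,m+1)$ of oriented non-degenerate 3-dimensional linear subspaces of $\mathbb{E}^{m+1}_s$.) Let $\Delta$ be the Laplacian of $M$ acting componentwise (with sign convention $\Delta=-\operatorname{tr}\nabla^2$). The map $\nu$ is of 1-type if $\Delta\nu=\lambda\nu$ for some constant $\lambda\in\mathbb{R}$, and harmonic if $\Delta\nu=0$; non-harmonic 1-type means $\Delta\nu=\lambda\nu$ with $\lambda\neq 0$. The Clifford torus is, up to isometries of $\mathbb{S}^3(1)$, the surface $\{(x_1,x_2,x_3,x_4)\mid x_1^2+x_2^2=x_3^2+x_4^2=\tfrac12\}$ in $\mathbb{S}^3(1)\subset\mathbb{E}^4$.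
   Formalization: The surface M is assumed connected (and nonempty): a disjoint union of open pieces of two different Clifford tori also satisfies Δν = 2ν but lies in no single Clifford torus. *)

(* Defs.v *)
From HB Require Import structures.
From mathcomp Require Import all_boot all_order all_algebra.
From mathcomp Require Import all_classical all_reals all_analysis.

Set Implicit Arguments.
Unset Strict Implicit.
Unset Printing Implicit Defensive.

Import Order.TTheory GRing.Theory Num.Theory.
Import numFieldNormedType.Exports.

Local Open Scope classical_set_scope.
Local Open Scope ring_scope.

(* [U] is always an open set below, so values of [f] outside [U] are
   irrelevant; derivatives are Frechet derivatives. *)
Fixpoint Ck (R : realType) (V W : normedModType R) (k : nat) (U : set V)
    (f : V -> W) : Prop :=
  if k is k'.+1 then
    (forall a, U a -> differentiable f a) /\ (forall v, Ck k' U ('D_v f))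
  else forall a, U a -> {for a, continuous f}.

Definition smooth (R : realType) (V W : normedModType R) (U : set V)
  (f : V -> W) : Prop := forall k, Ck k U f.

Definition partial (R : realType) (W : normedModType R) (i : 'I_2)
  (f : 'rV[R]_2 -> W) : 'rV[R]_2 -> W := 'D_(delta_mx 0 i) f.

(* [chart_inv] is only meaningful on the open set [chart_fun @` chart_dom]. *)
Record chart (R : realType) (M : topologicalType) := Chart {
  chart_dom : set M;
  chart_fun : M -> 'rV[R]_2;
  chart_inv : 'rV[R]_2 -> M;
  chart_dom_open : open chart_dom;
  chart_img_open : open (chart_fun @` chart_dom);
  chart_funK : forall p, chart_dom p -> chart_inv (chart_fun p) = p;
  chart_fun_cont : {within chart_dom, continuous chart_fun};
  chart_inv_cont : {within chart_fun @` chart_dom, continuous chart_inv}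
}.

Definition oriented_compatible (R : realType) (M : topologicalType)
    (c d : chart R M) : Prop :=
  let U := chart_fun c @` (chart_dom c `&` chart_dom d) in
  let t := chart_fun d \o chart_inv c in
  smooth U t /\ forall q, U q -> 0 < \det ('J t q).

(* The orientation is the one for which the charts of the atlas are positive.
   Manifolds are connected and nonempty. *)
Record oriented_surface (R : realType) := OrientedSurface {
  surface_carrier :> topologicalType;
  atlas : set (chart R surface_carrier);
  atlas_cover : forall p, exists2 c, atlas c & chart_dom c p;
  atlas_compat : forall c d, atlas c -> atlas d -> oriented_compatible c d;
  surface_hausdorff : hausdorff_space surface_carrier;
  surface_second_countable : @second_countable surface_carrier;
  surface_connected : connected [set: surface_carrier];
  surface_nonempty : [set: surface_carrier] !=set0
}.

(* The inner product of E^n_s: the last s coordinates are the negative ones. *)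
Definition inner (R : realType) (n s : nat) (u v : 'rV[R]_n) : R :=
  \sum_(i < n) (-1) ^+ (n - s <= i)%N * u 0 i * v 0 i.

(* S^m_s(1), a subset of E^(m+1)_s *)
Definition pseudo_sphere (R : realType) (m s : nat) : set 'rV[R]_m.+1 :=
  [set y | inner s y y = 1].

Section Surface.
Context (R : realType) (m s : nat) (M : oriented_surface R)
  (x : M -> 'rV[R]_m.+1).
Implicit Types (c : chart R M) (p : M) (q : 'rV[R]_2).

(* 2 x (m+1) matrix with rows the coordinate tangent vectors in E^(m+1)_s *)
Definition tangent_mx c q : 'M[R]_(2, m.+1) := 'J (x \o chart_inv c) q.

Definition immersion : Prop := forall c, atlas c ->
  smooth (chart_fun c @` chart_dom c) (x \o chart_inv c) /\
  forall p, chart_dom c p -> row_free (tangent_mx c (chart_fun c p)).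

Definition metric c q : 'M[R]_2 :=
  \matrix_(i, j) inner s (row i (tangent_mx c q)) (row j (tangent_mx c q)).

Definition riemannian : Prop := forall c p, atlas c -> chart_dom c p ->
  forall a : 'rV[R]_2, a != 0 ->
    0 < (a *m metric c (chart_fun c p) *m a^T) 0 0.

Definition spacelike_surface : Prop :=
  [/\ immersion, (forall p, pseudo_sphere s (x p)) & riemannian].

(* Christoffel symbols Gamma^k_ij of the Levi-Civita connection *)
Definition christoffel c (k i j : 'I_2) q : R :=
  2^-1 * \sum_(l < 2) invmx (metric c q) k l *
    (partial i (fun r => metric c r j l) q
     + partial j (fun r => metric c r i l) q
     - partial l (fun r => metric c r i j) q).

(* (nabla^2 f)(d_i, d_j) in the chart c *)
Definition hessian c (f : M -> R) q : 'M[R]_2 :=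
  \matrix_(i, j) (partial i (partial j (f \o chart_inv c)) q
    - \sum_(k < 2) christoffel c k i j q * partial k (f \o chart_inv c) q).

Definition laplacian c (f : M -> R) p : R :=
  - \tr (invmx (metric c (chart_fun c p)) *m hessian c f (chart_fun c p)).

Definition oriented_orthonormal_basis p (e1 e2 : 'rV[R]_m.+1) : Prop :=
  [/\ inner s e1 e1 = 1, inner s e2 e2 = 1, inner s e1 e2 = 0 &
   exists c, [/\ atlas c, chart_dom c p &
   exists A : 'M[R]_2, 0 < \det A /\
     col_mx e1 e2 = A *m tangent_mx c (chart_fun c p)]].

End Surface.

(* Coordinates of the third exterior power of R^n with respect to the basis
   f_i ^ f_j ^ f_k, i < j < k, where (f_i) is the canonical basis of E^n_s.
   This basis is orthonormal for the induced pseudo-Euclidean inner product,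
   so that these are the coordinates of E^N_q, N = 'C(n, 3). *)
Definition triple (n : nat) : finType :=
  {t : 3.-tuple 'I_n | sorted ltn (map val t)}.

Definition ext3 (R : realType) (n : nat) := {ffun triple n -> R}.

Definition wedge3 (R : realType) (n : nat) (u v w : 'rV[R]_n) : ext3 R n :=
  [ffun t => \det (\matrix_(a < 3, b < 3)
                     tnth [tuple u; v; w] a 0 (tnth (val t) b))].

(* The value does not depend on the chosen basis. *)
Definition gauss_map (R : realType) (m s : nat) (M : oriented_surface R)
    (x : M -> 'rV[R]_m.+1) (p : M) : ext3 R m.+1 :=
  xget 0 [set w | exists e1 e2,
    oriented_orthonormal_basis s x p e1 e2 /\ w = wedge3 (x p) e1 e2].

(* Delta F = lambda F for the Laplacian of the metric induced by x, acting on
   the coordinates of F; being intrinsic, it is evaluated in every chart. *)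
Definition laplace_eigen (R : realType) (m s : nat) (M : oriented_surface R)
    (x : M -> 'rV[R]_m.+1) (F : M -> ext3 R m.+1) (lambda : R) : Prop :=
  forall c p t, atlas c -> chart_dom c p ->
    laplacian s x c (fun p' => F p' t) p = lambda * F p t.

Definition nonharmonic_1type (R : realType) (m s : nat)
    (M : oriented_surface R) (x : M -> 'rV[R]_m.+1)
    (F : M -> ext3 R m.+1) : Prop :=
  exists2 lambda : R, lambda != 0 & laplace_eigen s x F lambda.

(* The totally geodesic 3-spheres are the sets geodesic_sphere V for V
   satisfying this predicate. *)
Definition pos_def_4space (R : realType) (m s : nat)
    (V : {vspace 'rV[R]_m.+1}) : Prop :=
  \dim V = 4%N /\ forall v, v \in V -> v != 0 -> 0 < inner s v v.

Definition geodesic_sphere (R : realType) (m s : nat)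
    (V : {vspace 'rV[R]_m.+1}) : set 'rV[R]_m.+1 :=
  [set y | y \in V] `&` pseudo_sphere s.

Definition standard_clifford_torus (R : realType) : set 'rV[R]_4 :=
  [set u | u 0 (inord 0) ^+ 2 + u 0 (inord 1) ^+ 2 = 2^-1 /\
           u 0 (inord 2) ^+ 2 + u 0 (inord 3) ^+ 2 = 2^-1].

(* The isometries from S^3(1) to the 3-sphere of V are the restrictions of the
   linear isometries from E^4 to V. *)
Definition clifford_torus_in (R : realType) (m s : nat)
    (V : {vspace 'rV[R]_m.+1}) (T : set 'rV[R]_m.+1) : Prop :=
  exists L : 'Hom('rV[R]_4, 'rV[R]_m.+1),
    [/\ limg L = V, (forall u v, inner s (L u) (L v) = inner 0 u v) &
        T = L @` @standard_clifford_torus R].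

Definition open_part (T : Type) (X : topologicalType) (x : T -> X)
    (A : set X) : Prop :=
  exists2 O : set X, open O & range x = A `&` O.

Definition lies_fully (R : realType) (m s : nat) (T : Type)
    (x : T -> 'rV[R]_m.+1) (V : {vspace 'rV[R]_m.+1}) : Prop :=
  range x `<=` geodesic_sphere s V /\
  forall W : {vspace 'rV[R]_m.+1}, (forall p, x p \in W) -> (V <= W)%VS.

(* Main.v *)
Require Import Defs.
From HB Require Import structures.
From mathcomp Require Import all_boot all_order all_algebra.
From mathcomp Require Import all_classical all_reals all_analysis.
From mathcomp Require Import ring lra.

Set Implicit Arguments.
Unset Strict Implicit.
Unset Printing Implicit Defensive.

Import Order.TTheory GRing.Theory Num.Theory.
Import numFieldNormedType.Exports.

Local Open Scope classical_set_scope.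
Local Open Scope ring_scope.

(** A non-harmonic 1-type Gauss map makes the Laplacian of nu = X ^ e1 ^ e2 a
    multiple l of nu. For an orthonormal moving frame e1, e2 of the surface with
    second fundamental form h in the pseudo-sphere, that Laplacian splits into
    trivectors of distinct types ([laplacian_gauss]), so that the equation says
    three things: the mean curvature vector vanishes, the normal vectors h11
    and h12 are proportional, and |h|^2 = l. Since l is constant and nonzero,
    differentiating the last two and using the Codazzi equation shows that h is
    parallel; then the curvature kills the nonzero tensor h, the surface is flat,
    and the Gauss equation forces |h|^2 = 2 ([sff_half_norm1]).

    For such a surface the projection on the space spanned by X, e1, e2 and the
    unit normal xi in the direction of h is constant, as is, up to sign, the
    involution of that space that exchanges X and xi and acts on the tangent
    plane as minus the shape operator. In an eigenbasis L of the involution, with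
    eigenvalues 1, 1, -1, -1, the equations <X, X> = 1 and <X, xi> = 0 become
    y0^2 + y1^2 = y2^2 + y3^2 = 1/2: the surface lies, near each point, in a
    Clifford torus ([patch_one_type]). The sign of xi is avoided by using the
    tensor square of the involution, and eigenvalue problems by halving an angle
    ([adapted_basis]).

    A piece of a torus determines both forms, hence the torus
    ([patch_torus_unique]); by connectedness a single torus contains the surface
    ([global_torus]). The surface is open in it: a point z of the torus close to
    x(p) is reached by maximizing <x, z> on a small closed disc around p
    ([torus_patch_open]). It spans the 4-space, because a fixed vector orthogonal
    to X is orthogonal to its derivatives, and these give e1, e2 and xi.

    Conversely, on a surface in a Clifford torus xi is the image of X under the
    involution of trace zero defining the torus. The trace gives minimality, the
    involution being isometric gives |h|^2 = 2, and so the Laplacian of nu is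
    2 nu ([clifford_torus_laplacian]).

    The differential geometry is done in a commutative ring A of functions with
    derivations; the ring of the smooth functions on a plane region, where the
    coordinate derivatives commute by the theorem of Schwarz, is substituted
    for A once a chart is fixed. *)

(** * Vectors over a differential ring *)

Record derivation (A : comNzRingType) (E : A -> A) : Prop := Derivation {
  derD : forall f g, E (f + g) = E f + E g;
  derM : forall f g, E (f * g) = E f * g + f * E g
}.

Section Derivation.
Context (A : comNzRingType) (E : A -> A) (dE : derivation E).

Lemma der0 : E 0 = 0.
Proof. by apply: (addIr (E 0)); rewrite -(derD dE) !add0r. Qed.

Lemma derN f : E (- f) = - E f.
Proof. by apply: (addIr (E f)); rewrite -(derD dE) !addNr der0. Qed.

Lemma derB f g : E (f - g) = E f - E g.
Proof. by rewrite (derD dE) derN. Qed.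

Lemma der1 : E 1 = 0.
Proof.
by apply: (addIr (E 1)); rewrite add0r -{3}(mulr1 1) (derM dE) mulr1 mul1r.
Qed.

Lemma derMn f k : E (f *+ k) = E f *+ k.
Proof.
by elim: k => [|k IH]; rewrite ?mulr0n ?der0 // !mulrS (derD dE) IH.
Qed.

Lemma der_nat k : E k%:R = 0.
Proof. by rewrite derMn der1 mul0rn. Qed.

Lemma der_sign k : E ((-1) ^+ k) = 0.
Proof.
elim: k => [|k IH]; first by rewrite der1.
by rewrite exprS (derM dE) IH derN der1 oppr0 mul0r mulr0 addr0.
Qed.

Lemma der_sum I (s : seq I) (P : pred I) F :
  E (\sum_(i <- s | P i) F i) = \sum_(i <- s | P i) E (F i).
Proof.
by elim/big_rec2 : _ => [|i y1 y2 _ <-]; rewrite ?der0 // (derD dE).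
Qed.

Lemma der_rowD n (u v : 'rV[A]_n) :
  map_mx E (u + v) = map_mx E u + map_mx E v.
Proof. by apply/rowP => i; rewrite !mxE (derD dE). Qed.

Lemma der_rowN n (u : 'rV[A]_n) : map_mx E (- u) = - map_mx E u.
Proof. by apply/rowP => i; rewrite !mxE derN. Qed.

Lemma der_rowB n (u v : 'rV[A]_n) :
  map_mx E (u - v) = map_mx E u - map_mx E v.
Proof. by rewrite der_rowD der_rowN. Qed.

Lemma der_rowZ n f (u : 'rV[A]_n) :
  map_mx E (f *: u) = E f *: u + f *: map_mx E u.
Proof. by apply/rowP => i; rewrite !mxE (derM dE). Qed.

Lemma der_row0 n : map_mx E (0 : 'rV[A]_n) = 0.
Proof. by apply/rowP => i; rewrite !mxE der0. Qed.

End Derivation.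

(** The pseudo-Euclidean inner product over an arbitrary ring of functions, so
    that products of moving vectors are themselves elements of the ring. *)
Definition dot (A : comNzRingType) (n s : nat) (u v : 'rV[A]_n) : A :=
  \sum_(i < n) (-1) ^+ (n - s <= i)%N * u 0 i * v 0 i.

Section Dot.
Context (A : comNzRingType) (n s : nat).
Implicit Types (u v w : 'rV[A]_n).
Notation "''[' u , v ]" := (dot s u v) (format "''[' u ,  v ]").

Lemma dotC u v : '[u, v] = '[v, u].
Proof. by apply: eq_bigr => i _; rewrite mulrAC. Qed.

Lemma dotDl u v w : '[u + v, w] = '[u, w] + '[v, w].
Proof.
by rewrite /dot -big_split; apply: eq_bigr => i _; rewrite mxE mulrDr mulrDl.
Qed.

Lemma dotZl a u w : '[a *: u, w] = a * '[u, w].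
Proof.
by rewrite /dot big_distrr; apply: eq_bigr => i _; rewrite mxE /=; ring.
Qed.

Lemma dotNl u w : '[- u, w] = - '[u, w].
Proof. by rewrite -scaleN1r dotZl mulN1r. Qed.

Lemma dotBl u v w : '[u - v, w] = '[u, w] - '[v, w].
Proof. by rewrite dotDl dotNl. Qed.

Lemma dot0l w : '[0, w] = 0.
Proof. by rewrite -(scale0r 0) dotZl mul0r. Qed.

Lemma dotDr u v w : '[w, u + v] = '[w, u] + '[w, v].
Proof. by rewrite dotC dotDl !(dotC w). Qed.

Lemma dotZr a u w : '[w, a *: u] = a * '[w, u].
Proof. by rewrite dotC dotZl (dotC w). Qed.

Lemma dotNr u w : '[w, - u] = - '[w, u].
Proof. by rewrite dotC dotNl (dotC w). Qed.

Lemma dotBr u v w : '[w, u - v] = '[w, u] - '[w, v].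
Proof. by rewrite dotDr dotNr. Qed.

Lemma dot0r w : '[w, 0] = 0.
Proof. by rewrite dotC dot0l. Qed.

Definition dotE := (dotDl, dotDr, dotBl, dotBr, dotNl, dotNr, dotZl, dotZr,
  dot0l, dot0r).

Lemma dot_delta u i : '[u, delta_mx 0 i] = (-1) ^+ (n - s <= i)%N * u 0 i.
Proof.
rewrite /dot (bigD1 i) //= big1 ?addr0 ?mxE ?eqxx ?mulr1 // => j /negPf ji.
by rewrite mxE eqxx ji mulr0.
Qed.

Lemma dot_nondeg u : (forall v, '[u, v] = 0) -> u = 0.
Proof.
move=> u0; apply/rowP => i; have := u0 (delta_mx 0 i).
move=> /(congr1 (fun z => (-1) ^+ (n - s <= i)%N * z)).
by rewrite dot_delta mulrA -signr_addb addbb mul1r mulr0 mxE.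
Qed.

Lemma der_dot (E : A -> A) u v : derivation E ->
  E '[u, v] = '[map_mx E u, v] + '[u, map_mx E v].
Proof.
move=> dE; rewrite /dot (der_sum dE) -big_split; apply: eq_bigr => i _ /=.
by rewrite !mxE !(derM dE) (der_sign dE) mul0r add0r.
Qed.

End Dot.

(** * Trivectors *)

(** The determinant of the rows u, v, w on the columns i, j, k. *)
Definition minor3 (A : comNzRingType) (n : nat) (i j k : 'I_n)
    (u v w : 'rV[A]_n) : A :=
  u 0 i * (v 0 j * w 0 k - v 0 k * w 0 j)
  - u 0 j * (v 0 i * w 0 k - v 0 k * w 0 i)
  + u 0 k * (v 0 i * w 0 j - v 0 j * w 0 i).

Section Minor3.
Context (A : comNzRingType) (n : nat) (i j k : 'I_n).
Implicit Types (u v w : 'rV[A]_n).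
Notation W := (minor3 i j k).

Lemma minor3D1 u u' v w : W (u + u') v w = W u v w + W u' v w.
Proof. by rewrite /minor3 !mxE; ring. Qed.
Lemma minor3D2 u v v' w : W u (v + v') w = W u v w + W u v' w.
Proof. by rewrite /minor3 !mxE; ring. Qed.
Lemma minor3D3 u v w w' : W u v (w + w') = W u v w + W u v w'.
Proof. by rewrite /minor3 !mxE; ring. Qed.
Lemma minor3Z1 a u v w : W (a *: u) v w = a * W u v w.
Proof. by rewrite /minor3 !mxE; ring. Qed.
Lemma minor3Z2 a u v w : W u (a *: v) w = a * W u v w.
Proof. by rewrite /minor3 !mxE; ring. Qed.
Lemma minor3Z3 a u v w : W u v (a *: w) = a * W u v w.
Proof. by rewrite /minor3 !mxE; ring. Qed.
Lemma minor3N1 u v w : W (- u) v w = - W u v w.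
Proof. by rewrite /minor3 !mxE; ring. Qed.
Lemma minor3N2 u v w : W u (- v) w = - W u v w.
Proof. by rewrite /minor3 !mxE; ring. Qed.
Lemma minor3N3 u v w : W u v (- w) = - W u v w.
Proof. by rewrite /minor3 !mxE; ring. Qed.
Lemma minor3_12 u v : W u u v = 0.
Proof. by rewrite /minor3; ring. Qed.
Lemma minor3_23 u v : W u v v = 0.
Proof. by rewrite /minor3; ring. Qed.
Lemma minor3_13 u v : W u v u = 0.
Proof. by rewrite /minor3; ring. Qed.

Definition minor3E := (minor3D1, minor3D2, minor3D3, minor3N1, minor3N2,
  minor3N3, minor3Z1, minor3Z2, minor3Z3, minor3_12, minor3_23, minor3_13).

Lemma der_minor3 (E : A -> A) u v w : derivation E ->
  E (W u v w) = W (map_mx E u) v w + W u (map_mx E v) w + W u v (map_mx E w).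
Proof.
move=> dE; rewrite /minor3 !mxE; rewrite !(derD dE, derN dE, derM dE); ring.
Qed.

Lemma minor3_swap23 u v w : W u w v = - W u v w.
Proof. by rewrite /minor3; ring. Qed.

End Minor3.

(** ** Contraction of trivectors *)

Section Contraction.
Context (A : comNzRingType) (n s : nat) (a b c : 'rV[A]_n).
Notation "''[' u , v ]" := (dot s u v) (format "''[' u ,  v ]").
Implicit Types (F G : 'I_n -> 'I_n -> 'I_n -> A) (u v w : 'rV[A]_n).

Let sg (x : 'rV[A]_n) (i : 'I_n) : A := (-1) ^+ (n - s <= i)%N * x 0 i.

(** For alternating F this is the pairing of a ^ b ^ c with the trivector of
    coordinates F: the six orders of three indices make up a determinant. *)
Definition contract3 F : A :=
  \sum_i sg a i * (\sum_j sg b j * (\sum_k sg c k * F i j k)).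

Lemma contract3D F G :
  contract3 (fun i j k => F i j k + G i j k) = contract3 F + contract3 G.
Proof.
rewrite /contract3 -big_split; apply: eq_bigr => i _ /=; rewrite -mulrDr.
congr (_ * _); rewrite -big_split; apply: eq_bigr => j _ /=; rewrite -mulrDr.
congr (_ * _); rewrite -big_split; apply: eq_bigr => k _ /=.
by rewrite -mulrDr.
Qed.

Lemma contract3Z z F :
  contract3 (fun i j k => z * F i j k) = z * contract3 F.
Proof.
rewrite /contract3 big_distrr; apply: eq_bigr => i _ /=; rewrite mulrCA.
congr (_ * _); rewrite big_distrr; apply: eq_bigr => j _ /=; rewrite mulrCA.
congr (_ * _); rewrite big_distrr; apply: eq_bigr => k _ /=.
by rewrite mulrCA.
Qed.

Lemma eq_contract3 F G : (forall i j k, F i j k = G i j k) ->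
  contract3 F = contract3 G.
Proof.
move=> FG; apply: eq_bigr => i _; congr (_ * _); apply: eq_bigr => j _.
by congr (_ * _); apply: eq_bigr => k _; rewrite FG.
Qed.

Lemma contract3_0 F : (forall i j k, F i j k = 0) -> contract3 F = 0.
Proof.
move=> F0; rewrite -(mul0r (contract3 F)) -contract3Z.
by apply: eq_contract3 => i j k; rewrite mul0r.
Qed.

Lemma contract3_mul u v w :
  contract3 (fun i j k => u 0 i * v 0 j * w 0 k) = '[a, u] * '[b, v] * '[c, w].
Proof.
rewrite /contract3 -mulrA {1}/dot big_distrl; apply: eq_bigr => i _ /=.
rewrite -!mulrA; congr (_ * (_ * _)).
rewrite {1}/dot big_distrl big_distrr; apply: eq_bigr => j _ /=.
rewrite {1}/dot !big_distrr; apply: eq_bigr => k _ /=.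
by rewrite /sg; ring.
Qed.

(** The Gram determinant of u, v, w against a, b, c. *)
Definition gram3 u v w : A :=
  '[u, a] * ('[v, b] * '[w, c] - '[v, c] * '[w, b])
  - '[u, b] * ('[v, a] * '[w, c] - '[v, c] * '[w, a])
  + '[u, c] * ('[v, a] * '[w, b] - '[v, b] * '[w, a]).

Lemma contract3_minor u v w :
  contract3 (fun i j k => minor3 i j k u v w) = gram3 u v w.
Proof.
rewrite (@eq_contract3 _ (fun i j k => u 0 i * v 0 j * w 0 k
  + (-1 * (u 0 i * w 0 j * v 0 k) + (-1 * (v 0 i * u 0 j * w 0 k)
  + (w 0 i * u 0 j * v 0 k + (v 0 i * w 0 j * u 0 k
  + -1 * (w 0 i * v 0 j * u 0 k))))))); last first.
  by move=> i j k; rewrite /minor3; ring.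
rewrite 5!contract3D !contract3Z !contract3_mul /gram3.
rewrite !(dotC _ a) !(dotC _ b) !(dotC _ c); ring.
Qed.

End Contraction.

(** * Orthonormal bases of a free submodule *)

Section Orthonormal.
Context (A : comNzRingType) (n s N : nat) (b L : 'I_N -> 'rV[A]_n).
Notation "''[' u , v ]" := (dot s u v) (format "''[' u ,  v ]").
Hypothesis orthob : forall i j, '[b i, b j] = (i == j)%:R.
Hypothesis spanb : forall a, b a = \sum_i '[b a, L i] *: L i.

Lemma dot_suml I (r : seq I) (P : pred I) (F : I -> 'rV[A]_n) v :
  '[\sum_(i <- r | P i) F i, v] = \sum_(i <- r | P i) '[F i, v].
Proof.
by elim/big_rec2: _ => [|i y1 y2 _ <-]; rewrite ?dot0l // dotDl.
Qed.

(** For a square matrix O, O O^T = 1 implies O^T O = 1. *)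
Lemma orthonormal_columns i j :
  \sum_a '[b a, L i] * '[b a, L j] = (i == j)%:R.
Proof.
pose O := \matrix_(a, i) '[b a, L i].
have OO : O *m O^T = 1%:M.
  apply/matrixP => a c; rewrite !mxE -orthob {1}(spanb a) dot_suml.
  by apply: eq_bigr => k _; rewrite !mxE dotZl (dotC _ (L k)).
have /matrixP/(_ i j) := mulmx1C OO; rewrite !mxE => <-.
by apply: eq_bigr => a _; rewrite !mxE.
Qed.

Lemma orthonormal_inverse i : L i = \sum_a '[L i, b a] *: b a.
Proof.
transitivity (\sum_j (i == j)%:R *: L j).
  by rewrite (bigD1 i) //= eqxx scale1r big1 ?addr0 // => j /negPf;
    rewrite eq_sym => ->; rewrite scale0r.
under [RHS]eq_bigr => a _ do rewrite {2}(spanb a) scaler_sumr.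
rewrite exchange_big; apply: eq_bigr => j _ /=.
rewrite -orthonormal_columns scaler_suml; apply: eq_bigr => a _.
by rewrite scalerA (dotC _ (L i)).
Qed.

Lemma orthonormal_expansion z : z = \sum_i '[z, L i] *: L i ->
  z = \sum_a '[z, b a] *: b a.
Proof.
move=> zE; rewrite {1}zE.
transitivity (\sum_i \sum_a ('[z, L i] * '[L i, b a]) *: b a).
  apply: eq_bigr => i _; rewrite {2}(orthonormal_inverse i) scaler_sumr.
  by apply: eq_bigr => a _; rewrite scalerA.
rewrite exchange_big; apply: eq_bigr => a _ /=; rewrite -scaler_suml.
by congr (_ *: _); rewrite {2}zE dot_suml; apply: eq_bigr => i _; rewrite dotZl.
Qed.

Lemma orthonormal_form (e : 'I_N -> A) i j :
  \sum_k e k * (L k 0 i * L k 0 j)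
  = \sum_a \sum_c (\sum_k e k * '[b a, L k] * '[b c, L k])
      * (b a 0 i * b c 0 j).
Proof.
under [RHS]eq_bigr => a _ do under eq_bigr => c _ do rewrite big_distrl.
under [RHS]eq_bigr => a _ do rewrite exchange_big.
rewrite [RHS]exchange_big; apply: eq_bigr => k _ /=.
have E h : L k 0 h = \sum_a '[L k, b a] * b a 0 h.
  by rewrite {1}orthonormal_inverse summxE; apply: eq_bigr => a _; rewrite mxE.
rewrite (E i) (E j) big_distrl big_distrr; apply: eq_bigr => a _ /=.
rewrite [LHS]mulrA [LHS]big_distrr; apply: eq_bigr => c _ /=.
by rewrite !(dotC _ (L k)); ring.
Qed.

End Orthonormal.

(** * Surfaces in the pseudo-sphere in terms of a moving frame *)

(** The frame is given by its derivations E1 and E2 as well as by the vectors e1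
    and e2. As 2 may be a zero divisor in a ring, halving is a hypothesis; u and v
    are the coefficients of the bracket of the frame. *)
Record moving_frame (A : comNzRingType) (n s : nat) (E1 E2 : A -> A) (u v : A)
    (X e1 e2 : 'rV[A]_n) : Prop := MovingFrame {
  half_inj : forall f : A, f + f = 0 -> f = 0;
  dE1 : derivation E1;
  dE2 : derivation E2;
  bracketE : forall f, E1 (E2 f) - E2 (E1 f) = u * E1 f + v * E2 f;
  frame1 : map_mx E1 X = e1;
  frame2 : map_mx E2 X = e2;
  sphereX : dot s X X = 1;
  frame11 : dot s e1 e1 = 1;
  frame22 : dot s e2 e2 = 1;
  frame12 : dot s e1 e2 = 0
}.

Section MovingFrame.
Context (A : comNzRingType) (n s : nat) (E1 E2 : A -> A) (u v : A).
Context (X e1 e2 : 'rV[A]_n) (fr : moving_frame s E1 E2 u v X e1 e2).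
Notation "''[' u , v ]" := (dot s u v) (format "''[' u ,  v ]").
Local Notation D1 := (@map_mx A A E1 1 n).
Local Notation D2 := (@map_mx A A E2 1 n).
Let dE1 := dE1 fr.
Let dE2 := dE2 fr.

(** The components of the connection form of the frame. *)
Definition conn1 : A := '[D1 e1, e2].
Definition conn2 : A := '[D2 e1, e2].
Notation w1 := conn1.
Notation w2 := conn2.

(** The second fundamental form in the pseudo-sphere: the term X compensates for
    the normal component of the second derivatives along the position vector. The
    constants are locked to keep [ring] from unfolding them. *)
Definition sff11 : 'rV[A]_n := locked (D1 e1 - w1 *: e2 + X).
Definition sff12 : 'rV[A]_n := locked (D1 e2 + w1 *: e1).
Definition sff22 : 'rV[A]_n := locked (D2 e2 + w2 *: e1 + X).
Notation h11 := sff11.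
Notation h12 := sff12.
Notation h22 := sff22.

Lemma half_sym (f g : A) : f + g = 0 -> g = f -> f = 0.
Proof. by move=> H gf; apply: (half_inj fr); rewrite -{2}gf. Qed.

Lemma dot_Xe1 : '[X, e1] = 0.
Proof.
apply: (half_sym _ (dotC _ _ _)).
by rewrite -(frame1 fr) addrC -(der_dot s X X dE1) (sphereX fr) (der1 dE1).
Qed.

Lemma dot_Xe2 : '[X, e2] = 0.
Proof.
apply: (half_sym _ (dotC _ _ _)).
by rewrite -(frame2 fr) addrC -(der_dot s X X dE2) (sphereX fr) (der1 dE2).
Qed.

Lemma dot_e1X : '[e1, X] = 0. Proof. by rewrite dotC dot_Xe1. Qed.
Lemma dot_e2X : '[e2, X] = 0. Proof. by rewrite dotC dot_Xe2. Qed.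
Lemma frame21 : '[e2, e1] = 0. Proof. by rewrite dotC (frame12 fr). Qed.

Definition frameE := (frame11 fr, frame22 fr, frame12 fr, frame21, sphereX fr,
  dot_Xe1, dot_Xe2, dot_e1X, dot_e2X).

Lemma dot_D1e1_e1 : '[D1 e1, e1] = 0.
Proof.
apply: (half_sym _ (dotC _ _ _)).
by rewrite -(der_dot s e1 e1 dE1) (frame11 fr) (der1 dE1).
Qed.
Lemma dot_D2e1_e1 : '[D2 e1, e1] = 0.
Proof.
apply: (half_sym _ (dotC _ _ _)).
by rewrite -(der_dot s e1 e1 dE2) (frame11 fr) (der1 dE2).
Qed.
Lemma dot_D1e2_e2 : '[D1 e2, e2] = 0.
Proof.
apply: (half_sym _ (dotC _ _ _)).
by rewrite -(der_dot s e2 e2 dE1) (frame22 fr) (der1 dE1).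
Qed.
Lemma dot_D2e2_e2 : '[D2 e2, e2] = 0.
Proof.
apply: (half_sym _ (dotC _ _ _)).
by rewrite -(der_dot s e2 e2 dE2) (frame22 fr) (der1 dE2).
Qed.
Lemma dot_D1e2_e1 : '[D1 e2, e1] = - w1.
Proof.
apply/eqP; rewrite -addr_eq0 dotC addrC /w1 -(der_dot s e1 e2 dE1).
by rewrite (frame12 fr) (der0 dE1).
Qed.
Lemma dot_D2e2_e1 : '[D2 e2, e1] = - w2.
Proof.
apply/eqP; rewrite -addr_eq0 dotC addrC /w2 -(der_dot s e1 e2 dE2).
by rewrite (frame12 fr) (der0 dE2).
Qed.
Lemma dot_D1e1_X : '[D1 e1, X] = -1.
Proof.
apply/eqP; rewrite -addr_eq0 -(frame11 fr) -{3}(frame1 fr).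
by rewrite -(der_dot s e1 X dE1) dotC dot_Xe1 (der0 dE1).
Qed.
Lemma dot_D2e2_X : '[D2 e2, X] = -1.
Proof.
apply/eqP; rewrite -addr_eq0 -(frame22 fr) -{3}(frame2 fr).
by rewrite -(der_dot s e2 X dE2) dotC dot_Xe2 (der0 dE2).
Qed.
Lemma dot_D1e2_X : '[D1 e2, X] = 0.
Proof.
apply: (addIr '[e2, e1]); rewrite -{1}(frame1 fr) -(der_dot s e2 X dE1).
by rewrite !frameE (der0 dE1) addr0.
Qed.
Lemma bracket_row (z : 'rV[A]_n) : D1 (D2 z) - D2 (D1 z) = u *: D1 z + v *: D2 z.
Proof. by apply/rowP => i; rewrite !mxE (bracketE fr). Qed.

(** Taken along X the bracket expresses that the connection is torsion free; this
    determines u and v. *)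
Lemma bracket1 : u = - w1.
Proof.
have := congr1 (fun z => '[z, e1]) (bracket_row X).
rewrite (frame1 fr) (frame2 fr) !dotE !frameE dot_D1e2_e1 dot_D2e1_e1.
by rewrite subr0 mulr1 mulr0 addr0.
Qed.

Lemma bracket2 : v = - w2.
Proof.
have := congr1 (fun z => '[z, e2]) (bracket_row X).
rewrite (frame1 fr) (frame2 fr) !dotE !frameE dot_D1e2_e2.
by rewrite sub0r mulr1 mulr0 add0r.
Qed.

Lemma D1e1 : D1 e1 = w1 *: e2 + h11 - X.
Proof. by apply/rowP => i; rewrite /h11 -lock !mxE; ring. Qed.
Lemma D1e2 : D1 e2 = h12 - w1 *: e1.
Proof. by apply/rowP => i; rewrite /h12 -lock !mxE; ring. Qed.
Lemma D2e2 : D2 e2 = h22 - w2 *: e1 - X.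
Proof. by apply/rowP => i; rewrite /h22 -lock !mxE; ring. Qed.
Lemma D2e1 : D2 e1 = w2 *: e2 + h12.
Proof.
have := bracket_row X; rewrite bracket1 bracket2 (frame1 fr) (frame2 fr).
move=> /rowP H; apply/rowP => i; move: (H i); rewrite /h12 -lock !mxE => Hi.
apply: (addIr (E1 (e2 0 i) - E2 (e1 0 i))); rewrite {2}Hi; ring.
Qed.

Lemma dot_h11X : '[h11, X] = 0.
Proof. by rewrite /h11 -lock !dotE dot_D1e1_X !frameE; ring. Qed.
Lemma dot_h12X : '[h12, X] = 0.
Proof. by rewrite /h12 -lock !dotE dot_D1e2_X !frameE; ring. Qed.
Lemma dot_h22X : '[h22, X] = 0.
Proof. by rewrite /h22 -lock !dotE dot_D2e2_X !frameE; ring. Qed.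
Lemma dot_h11e1 : '[h11, e1] = 0.
Proof. by rewrite /h11 -lock !dotE dot_D1e1_e1 !frameE; ring. Qed.
Lemma dot_h12e1 : '[h12, e1] = 0.
Proof. by rewrite /h12 -lock !dotE dot_D1e2_e1 !frameE; ring. Qed.
Lemma dot_h22e1 : '[h22, e1] = 0.
Proof. by rewrite /h22 -lock !dotE dot_D2e2_e1 !frameE; ring. Qed.
Lemma dot_h11e2 : '[h11, e2] = 0.
Proof. by rewrite /h11 -lock !dotE !frameE /w1; ring. Qed.
Lemma dot_h12e2 : '[h12, e2] = 0.
Proof. by rewrite /h12 -lock !dotE dot_D1e2_e2 !frameE; ring. Qed.
Lemma dot_h22e2 : '[h22, e2] = 0.
Proof. by rewrite /h22 -lock !dotE dot_D2e2_e2 !frameE; ring. Qed.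

Definition normal (z : 'rV[A]_n) : Prop :=
  [/\ '[z, X] = 0, '[z, e1] = 0 & '[z, e2] = 0].

Lemma normal_h11 : normal h11.
Proof. split; [exact: dot_h11X|exact: dot_h11e1|exact: dot_h11e2]. Qed.
Lemma normal_h12 : normal h12.
Proof. split; [exact: dot_h12X|exact: dot_h12e1|exact: dot_h12e2]. Qed.
Lemma normal_h22 : normal h22.
Proof. split; [exact: dot_h22X|exact: dot_h22e1|exact: dot_h22e2]. Qed.

Lemma normalD y z : normal y -> normal z -> normal (y + z).
Proof. by move=> [a b c] [a' b' c']; split; rewrite dotDl ?a ?b ?c ?a' ?b' ?c' addr0. Qed.
Lemma normalZ a z : normal z -> normal (a *: z).
Proof. by move=> [b c d]; split; rewrite dotZl ?b ?c ?d mulr0. Qed.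
Lemma normalN z : normal z -> normal (- z).
Proof. by move=> nz; rewrite -scaleN1r; apply: normalZ. Qed.
(** The normal connection. *)
Definition nabla1 z : 'rV[A]_n := locked (D1 z + '[z, h11] *: e1 + '[z, h12] *: e2).
Definition nabla2 z : 'rV[A]_n := locked (D2 z + '[z, h12] *: e1 + '[z, h22] *: e2).

Lemma nabla1E z : nabla1 z = D1 z + '[z, h11] *: e1 + '[z, h12] *: e2.
Proof. by rewrite /nabla1 -lock. Qed.
Lemma nabla2E z : nabla2 z = D2 z + '[z, h12] *: e1 + '[z, h22] *: e2.
Proof. by rewrite /nabla2 -lock. Qed.

Lemma D1_nabla z : D1 z = nabla1 z - '[z, h11] *: e1 - '[z, h12] *: e2.
Proof. by apply/rowP => i; rewrite /nabla1 -lock !mxE; ring. Qed.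

Lemma D2_nabla z : D2 z = nabla2 z - '[z, h12] *: e1 - '[z, h22] *: e2.
Proof. by apply/rowP => i; rewrite /nabla2 -lock !mxE; ring. Qed.

Lemma nabla1_normal z : normal z -> normal (nabla1 z).
Proof.
move=> [zX z1 z2]; split; rewrite nabla1E !dotE !frameE.
- have := der_dot s z X dE1; rewrite zX (der0 dE1) (frame1 fr) z1 addr0 => <-.
  by ring.
- have := der_dot s z e1 dE1; rewrite z1 (der0 dE1) D1e1 !dotE z2 zX.
  by rewrite mulr0 add0r subr0 mulr1 mulr0 addr0 => <-.
- have := der_dot s z e2 dE1; rewrite z2 (der0 dE1) D1e2 !dotE z1.
  by rewrite mulr0 subr0 mulr1 mulr0 addr0 => <-.
Qed.

Lemma nabla2_normal z : normal z -> normal (nabla2 z).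
Proof.
move=> [zX z1 z2]; split; rewrite nabla2E !dotE !frameE.
- have := der_dot s z X dE2; rewrite zX (der0 dE2) (frame2 fr) z2 addr0 => <-.
  by ring.
- have := der_dot s z e1 dE2; rewrite z1 (der0 dE2) D2e1 !dotE z2.
  by rewrite mulr0 add0r mulr1 mulr0 addr0 => <-.
- have := der_dot s z e2 dE2; rewrite z2 (der0 dE2) D2e2 !dotE z1 zX.
  by rewrite mulr0 !subr0 mulr1 mulr0 addr0 => <-.
Qed.

Lemma normal_tangent0 z a b c : normal z -> z = a *: e1 + b *: e2 + c *: X ->
  z = 0.
Proof.
move=> [zX z1 z2] zE; move: zX z1 z2.
rewrite {1 2 3}zE !dotE !frameE !(mulr0, mulr1, add0r, addr0) => c0 a0 b0.
by rewrite zE a0 b0 c0 !scale0r !addr0.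
Qed.

(** The Codazzi equations are the normal components, the Gauss equation the
    tangential one, of the bracket identity for e1 and e2. *)
Lemma codazzi1 : nabla2 h11 = nabla1 h12 + w2 *: h12 *+ 2 + w1 *: (h11 - h22).
Proof.
apply/eqP; rewrite -subr_eq0; apply/eqP.
have nz := normalD (nabla2_normal normal_h11) (normalN (normalD (normalD
  (nabla1_normal normal_h12) (normalD (normalZ w2 normal_h12)
  (normalZ w2 normal_h12))) (normalZ w1
  (normalD normal_h11 (normalN normal_h22))))).
(* The coefficients are the tangential part of the bracket of e1. *)
apply: (normal_tangent0 (a := - '[h12, h11] - w1 * w2 + '[h11, h12]
    + w1 * w2)
  (b := E1 w2 - '[h12, h12] - E2 w1 + '[h11, h22] + 1 + w1 ^+ 2 + w2 ^+ 2)
  (c := 0)).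
  by rewrite mulr2n.
have /rowP H := bracket_row e1; apply/rowP => i; move/eqP: (H i).
rewrite bracket1 bracket2.
rewrite D2e1 D1e1 der_rowD ?der_rowB ?der_rowD ?der_rowZ //.
rewrite D1e2 D2e2 (D1_nabla h12) (D2_nabla h11) (frame2 fr) -subr_eq0.
rewrite !mxE => /eqP Hi; apply: subr0_eq; rewrite -[RHS]oppr0 -[in RHS]Hi.
ring.
Qed.

Lemma codazzi2 : nabla1 h22 = nabla2 h12 - w1 *: h12 *+ 2 + w2 *: (h11 - h22).
Proof.
apply/eqP; rewrite -subr_eq0; apply/eqP.
have nz := normalD (nabla1_normal normal_h22) (normalN (normalD (normalD
  (nabla2_normal normal_h12) (normalN (normalD (normalZ w1 normal_h12)
  (normalZ w1 normal_h12)))) (normalZ w2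
  (normalD normal_h11 (normalN normal_h22))))).
apply: (normal_tangent0
  (a := E1 w2 - E2 w1 + '[h22, h11] + 1 - '[h12, h12] + w1 ^+ 2 + w2 ^+ 2)
  (b := '[h22, h12] - '[h12, h22])
  (c := 0)).
  by rewrite mulr2n.
have /rowP H := bracket_row e2; apply/rowP => i; move/eqP: (H i).
rewrite bracket1 bracket2.
rewrite D2e2 D1e2 ?der_rowB ?der_rowD ?der_rowZ //.
rewrite D1e1 D2e1 (D1_nabla h22) (D2_nabla h12) (frame1 fr) -subr_eq0.
rewrite !mxE => /eqP Hi; apply: subr0_eq; rewrite -[RHS]Hi.
ring.
Qed.

Lemma gauss_equation :
  E1 w2 - E2 w1 + w1 ^+ 2 + w2 ^+ 2 = '[h12, h12] - '[h11, h22] - 1.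
Proof.
have := congr1 (fun z => '[z, e2]) (bracket_row e1).
rewrite bracket1 bracket2.
rewrite D2e1 D1e1 der_rowD ?der_rowB ?der_rowD ?der_rowZ //.
rewrite D1e2 D2e2 (D1_nabla h12) (D2_nabla h11) (frame2 fr).
have [_ _ a] := nabla1_normal normal_h12.
have [_ _ b] := nabla2_normal normal_h11.
rewrite !dotE !frameE a b dot_h12e2 dot_h22e2 dot_h11e2.
move=> /eqP; rewrite -subr_eq0 => /eqP Hi.
by apply: subr0_eq; rewrite -[RHS]Hi; ring.
Qed.

(** ** The Laplacian of the Gauss map *)

(** The trace of the Hessian in the frame, whose sign is opposite to that of a
    nonnegative Laplacian. *)
Definition frame_laplacian (f : A) : A :=
  E1 (E1 f) + E2 (E2 f) - w1 * E2 f + w2 * E1 f.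

Definition mean := h11 + h22.
Definition sff_norm : A := '[h11, h11] + '[h12, h12] *+ 2 + '[h22, h22].

(** The two components of the divergence of the second fundamental form. *)
Definition div_sff1 := nabla1 h11 + nabla2 h12
  - w1 *: h12 *+ 2 + w2 *: (h11 - h22).
Definition div_sff2 := nabla1 h12 + nabla2 h22
  + w2 *: h12 *+ 2 + w1 *: (h11 - h22).

Section Laplacian.
Variables i j k : 'I_n.
Notation W := (minor3 i j k).

Lemma E1_gauss : E1 (W X e1 e2) = W X h11 e2 + W X e1 h12.
Proof.
rewrite (der_minor3 _ _ _ _ _ _ dE1) (frame1 fr) D1e1 D1e2 !minor3E; ring.
Qed.

Lemma E2_gauss : E2 (W X e1 e2) = W X h12 e2 + W X e1 h22.
Proof.
rewrite (der_minor3 _ _ _ _ _ _ dE2) (frame2 fr) D2e1 D2e2 !minor3E; ring.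
Qed.

(** The connection terms rotate e1 and e2 in the tangent plane and so do not move
    the trivector. The terms on the right are of distinct types: one normal factor
    replacing X, one replacing e1 or e2, two replacing both, and none. *)
Lemma laplacian_gauss : frame_laplacian (W X e1 e2) =
  - W mean e1 e2 + W X div_sff1 e2 + W X e1 div_sff2
  + W X h11 h12 *+ 2 + W X h12 h22 *+ 2 - sff_norm * W X e1 e2.
Proof.
rewrite /frame_laplacian E1_gauss E2_gauss (derD dE1) (derD dE2).
rewrite !(der_minor3 _ _ _ _ _ _ dE1) !(der_minor3 _ _ _ _ _ _ dE2).
rewrite (frame1 fr) (frame2 fr) D1e1 D1e2 D2e1 D2e2.
rewrite (D1_nabla h11) (D1_nabla h12) (D2_nabla h12) (D2_nabla h22).
rewrite (dotC _ h12 h11) (dotC _ h22 h12).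
rewrite /mean /div_sff1 /div_sff2 /sff_norm !mulr2n !minor3E.
rewrite /minor3; ring.
Qed.

End Laplacian.

(** For a, b, c chosen among X, e1, e2 and normal vectors only the terms of a
    single type survive, which separates them. *)
Lemma contract_laplacian_gauss a b c l :
  (forall i j k, frame_laplacian (minor3 i j k X e1 e2)
     = - l * minor3 i j k X e1 e2) ->
  - gram3 s a b c mean e1 e2 + gram3 s a b c X div_sff1 e2
  + gram3 s a b c X e1 div_sff2
  + gram3 s a b c X h11 h12 *+ 2 + gram3 s a b c X h12 h22 *+ 2
  + (l - sff_norm) * gram3 s a b c X e1 e2 = 0.
Proof.
move=> H; rewrite -!contract3_minor -[- contract3 _ _ _ _ _]mulN1r !mulr2n.
rewrite -!contract3Z -!contract3D.
apply: contract3_0 => i j k; have := H i j k; rewrite laplacian_gauss.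
by move=> /eqP; rewrite -subr_eq0 => /eqP Hi; rewrite -[RHS]Hi; ring.
Qed.

Lemma div_sff1_normal : normal div_sff1.
Proof.
rewrite /div_sff1 mulr2n; apply: normalD; last first.
  by apply/normalZ/normalD; [exact: normal_h11|exact/normalN/normal_h22].
apply: normalD; last by apply/normalN/normalD; apply: normalZ normal_h12.
by apply: normalD; [exact: nabla1_normal normal_h11
                   |exact: nabla2_normal normal_h12].
Qed.

Lemma div_sff2_normal : normal div_sff2.
Proof.
rewrite /div_sff2 mulr2n; apply: normalD; last first.
  by apply/normalZ/normalD; [exact: normal_h11|exact/normalN/normal_h22].
apply: normalD; last by apply/normalD; apply: normalZ normal_h12.
by apply: normalD; [exact: nabla1_normal normal_h12
                   |exact: nabla2_normal normal_h22].
Qed.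

(** The tangent space and X span a nondegenerate space, so that every vector differs
    from a normal one by a vector of that space. *)
Lemma normal_nondeg z : normal z -> (forall y, normal y -> '[z, y] = 0) ->
  z = 0.
Proof.
move=> [zX z1 z2] H; apply: (@dot_nondeg _ _ s) => y.
have ny : normal (y - '[y, X] *: X - '[y, e1] *: e1 - '[y, e2] *: e2).
  by split; rewrite !dotE !frameE; ring.
by have := H _ ny; rewrite !dotE zX z1 z2 !mulr0 !subr0.
Qed.

Section OneType.
Context (l : A).
Hypothesis eigen : forall i j k,
  frame_laplacian (minor3 i j k X e1 e2) = - l * minor3 i j k X e1 e2.

Let normal_mean : normal mean.
Proof. exact: normalD normal_h11 normal_h22. Qed.

Lemma one_type_mean : mean = 0.
Proof.
apply: normal_nondeg normal_mean _ => y [yX y1 y2].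
have := contract_laplacian_gauss y e1 e2 eigen.
have [hX ha hb] := normal_mean.
have [aX aa ab] := div_sff1_normal; have [bX ba bb] := div_sff2_normal.
have [cX ca cb] := normal_h11; have [dX da db] := normal_h12.
have [fX fa fb] := normal_h22.
rewrite (dotC _ y X) in yX; rewrite (dotC _ y) in y1; rewrite (dotC _ y) in y2.
rewrite /gram3 !frameE ha hb aa ab ba bb ca cb da db fa fb y1 y2 yX => H.
by rewrite -[LHS]opprK -[RHS]oppr0 -[in RHS]H; congr (- _); ring.
Qed.

Lemma one_type_norm : l = sff_norm.
Proof.
have := contract_laplacian_gauss X e1 e2 eigen.
have [hX ha hb] := normal_mean.
have [aX aa ab] := div_sff1_normal; have [bX ba bb] := div_sff2_normal.
have [cX ca cb] := normal_h11; have [dX da db] := normal_h12.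
have [fX fa fb] := normal_h22.
rewrite /gram3 !frameE hX ha hb aX aa ab bX ba bb cX ca cb dX da db fX fa fb.
by move=> H; apply: subr0_eq; rewrite -[RHS]H; ring.
Qed.

Lemma one_type_h22 : h22 = - h11.
Proof. by apply/eqP; rewrite -addr_eq0 addrC; apply/eqP/one_type_mean. Qed.

Lemma one_type_wedge y z : '[h11, y] * '[h12, z] = '[h11, z] * '[h12, y].
Proof.
have key y' z' : normal y' -> normal z' ->
    '[h11, y'] * '[h12, z'] - '[h11, z'] * '[h12, y'] = 0.
  move=> [yX y1 y2] [zX z1 z2].
  have := contract_laplacian_gauss X y' z' eigen.
  have [cX ca cb] := normal_h11; have [dX da db] := normal_h12.
  have [aX aa ab] := div_sff1_normal; have [bX ba bb] := div_sff2_normal.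
  rewrite one_type_mean one_type_h22; rewrite (dotC _ y' X) in yX.
  rewrite (dotC _ y') in y1; rewrite (dotC _ y') in y2.
  rewrite (dotC _ z' X) in zX; rewrite (dotC _ z') in z1.
  rewrite (dotC _ z') in z2.
  rewrite /gram3 !(dotNl, dot0l) !frameE yX y1 y2 zX z1 z2 cX dX aX bX => H.
  by do 2!apply: (half_inj fr); rewrite -[RHS]H; ring.
have proj x : exists2 x', normal x' & forall h, normal h -> '[h, x] = '[h, x'].
  exists (x - '[x, X] *: X - '[x, e1] *: e1 - '[x, e2] *: e2).
    by split; rewrite !dotE !frameE; ring.
  by move=> h [hX ha hb]; rewrite !dotE hX ha hb !mulr0 !subr0.
have [y' ny yE] := proj y; have [z' nz zE] := proj z.
rewrite !(yE _ normal_h11) !(yE _ normal_h12) !(zE _ normal_h11).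
by rewrite !(zE _ normal_h12); apply: subr0_eq; apply: key.
Qed.

End OneType.

(** ** Minimal surfaces with a parallel second fundamental form *)

(** Consequences of equations that need multipliers are proved by exhibiting
    them: what remains is an identity for [ring]. *)
Lemma eq_comb3 (x1 y1 x2 y2 x3 y3 c1 c2 c3 f g : A) :
  x1 = y1 -> x2 = y2 -> x3 = y3 ->
  f - g = c1 * (x1 - y1) + c2 * (x2 - y2) + c3 * (x3 - y3) -> f = g.
Proof.
by move=> -> -> ->; rewrite !subrr !mulr0 !addr0 => /eqP; rewrite subr_eq0 => /eqP.
Qed.

Section Parallel.
Notation p := h11.
Notation r := h12.
Definition sff_half_norm : A := '[p, p] + '[r, r].
Notation kappa := sff_half_norm.

Hypothesis h22E : h22 = - h11.
Hypothesis wedge : forall y z, '[p, y] * '[r, z] = '[p, z] * '[r, y].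
Hypothesis E1kappa : E1 kappa = 0.
Hypothesis E2kappa : E2 kappa = 0.
(* kappa is nowhere zero; in a ring of functions this means regular. *)
Hypothesis kappa_reg : forall f, kappa * f = 0 -> f = 0.

Lemma dot_D1_normal y z : normal y -> '[D1 z, y] = '[nabla1 z, y].
Proof. by move=> [yX y1 y2]; rewrite nabla1E !dotE !(dotC _ _ y) y1 y2; ring. Qed.

Lemma dot_D2_normal y z : normal y -> '[D2 z, y] = '[nabla2 z, y].
Proof. by move=> [yX y1 y2]; rewrite nabla2E !dotE !(dotC _ _ y) y1 y2; ring. Qed.

(** P and Q are the components of the covariant derivative of the second
    fundamental form; as the surface is minimal, the Codazzi equations leave no
    others. The derivatives of the proportionality of p and r and of the constancy
    of kappa are linear equations for them, by which a power of kappa annihilates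
    their products with normal vectors. *)
Let P := nabla1 p - w1 *: r *+ 2.
Let Q := nabla1 r + w1 *: p *+ 2.

Let nabla2_p : nabla2 p = Q + w2 *: r *+ 2.
Proof.
rewrite codazzi1 h22E /Q opprK scalerDr mulr2n addrAC !mulr2n.
by rewrite -!addrA.
Qed.

Let nabla1_h22 : nabla1 h22 = - nabla1 p.
Proof.
rewrite h22E !nabla1E der_rowN ?dotNl; last exact: dE1.
by rewrite !scaleNr -!opprD.
Qed.

Let nabla2_r : nabla2 r = - P - w2 *: p *+ 2.
Proof.
apply/eqP; rewrite -subr_eq0; apply/eqP; have := codazzi2.
rewrite nabla1_h22 h22E opprK => /eqP; rewrite -subr_eq0 => /eqP H.
rewrite -[RHS]oppr0 -[in RHS]H /P; apply/rowP => i; rewrite !mulr2n !mxE; ring.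
Qed.

Let wedge1 y z : normal y -> normal z ->
  '[P, y] * '[r, z] + '[p, y] * '[Q, z]
  = '[P, z] * '[r, y] + '[p, z] * '[Q, y].
Proof.
move=> ny nz; have := congr1 E1 (wedge y z).
rewrite !(derM dE1) !(der_dot _ _ _ dE1) !(dot_D1_normal _ ny).
rewrite !(dot_D1_normal _ nz).
rewrite /P /Q !mulr2n !dotE => H.
apply: (eq_comb3 H (wedge (D1 y) z) (wedge y (D1 z)) (c1 := 1) (c2 := -1)
  (c3 := -1)); ring.
Qed.

Let wedge2 y z : normal y -> normal z ->
  '[Q, y] * '[r, z] - '[p, y] * '[P, z]
  = '[Q, z] * '[r, y] - '[p, z] * '[P, y].
Proof.
move=> ny nz; have := congr1 E2 (wedge y z).
rewrite !(derM dE2) !(der_dot _ _ _ dE2) !(dot_D2_normal _ ny).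
rewrite !(dot_D2_normal _ nz) nabla2_p nabla2_r /P /Q !mulr2n.
rewrite !dotE => H.
apply: (eq_comb3 H (wedge (D2 y) z) (wedge y (D2 z)) (c1 := 1) (c2 := -1)
  (c3 := -1)); ring.
Qed.

Let kappa1 : '[P, p] + '[Q, r] = 0.
Proof.
apply: (half_inj fr); rewrite -[RHS]E1kappa /kappa (derD dE1).
rewrite !(der_dot _ _ _ dE1) (dotC _ p (D1 p)) (dotC _ r (D1 r)).
rewrite (dot_D1_normal _ normal_h11) (dot_D1_normal _ normal_h12).
rewrite /P /Q !mulr2n !dotE (dotC _ r p); ring.
Qed.

Let kappa2 : '[Q, p] - '[P, r] = 0.
Proof.
apply: (half_inj fr); rewrite -[RHS]E2kappa /kappa (derD dE2).
rewrite !(der_dot _ _ _ dE2) (dotC _ p (D2 p)) (dotC _ r (D2 r)).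
rewrite (dot_D2_normal _ normal_h11) (dot_D2_normal _ normal_h12).
rewrite nabla2_p nabla2_r /P /Q !mulr2n !dotE (dotC _ r p); ring.
Qed.

Let Q_comb y : normal y ->
  kappa * '[Q, y] = ('[p, y] * '[Q, p] + '[r, y] * '[Q, r]) *+ 2.
Proof.
move=> ny; have [np nr] := (normal_h11, normal_h12).
have := wedge1 ny np; have := wedge2 ny nr.
have -> : '[P, r] = '[Q, p] by apply/eqP; rewrite eq_sym -subr_eq0 kappa2.
have -> : '[P, p] = - '[Q, r] by apply/eqP; rewrite -addr_eq0 kappa1.
rewrite /kappa (dotC _ r p) => B C.
apply: (eq_comb3 B C (erefl 0) (c1 := 1) (c2 := -1) (c3 := 0)); ring.
Qed.

Let Qp : '[Q, p] = 0.
Proof.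
apply: kappa_reg; have := Q_comb normal_h11; have := wedge r Q.
rewrite /kappa !(dotC _ _ Q) (dotC _ r p) => H1 H.
apply: (eq_comb3 H H1 (erefl 0) (c1 := -1) (c2 := -2) (c3 := 0)); ring.
Qed.

Let Qr : '[Q, r] = 0.
Proof.
apply: kappa_reg; have := Q_comb normal_h12; have := wedge p Q.
rewrite /kappa !(dotC _ _ Q) Qp (dotC _ r p) => H1 H.
apply: (eq_comb3 H H1 (erefl 0) (c1 := -1) (c2 := 2) (c3 := 0)); ring.
Qed.

Let Qy y : normal y -> '[Q, y] = 0.
Proof.
by move=> ny; apply: kappa_reg; rewrite Q_comb // Qp Qr !mulr0 addr0 mul0rn.
Qed.

Let Py y : normal y -> '[P, y] = 0.
Proof.
move=> ny; have [np nr] := (normal_h11, normal_h12).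
have := wedge1 ny nr; have := wedge2 ny np.
have Pr : '[P, r] = 0 by rewrite -[LHS]opprK -[- '[P, r]](add0r) -Qp kappa2 oppr0.
have Pp : '[P, p] = 0 by rewrite -[LHS]addr0 -Qr kappa1.
rewrite Pr Pp !Qy // (dotC _ r p) !mulr0 !mul0r => B C; apply: kappa_reg.
apply: (eq_comb3 C B (erefl 0) (c1 := 1) (c2 := 1) (c3 := 0)).
by rewrite /kappa; ring.
Qed.

Let normalQ : normal Q.
Proof.
rewrite /Q mulr2n; apply: normalD; first exact: nabla1_normal normal_h12.
by apply: normalD; apply: normalZ normal_h11.
Qed.

Let normalP : normal P.
Proof.
rewrite /P mulr2n.
apply: normalD; first exact: nabla1_normal normal_h11.
by apply/normalN/normalD; apply: normalZ normal_h12.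
Qed.

Let Q0 : Q = 0. Proof. exact: normal_nondeg normalQ Qy. Qed.
Let P0 : P = 0. Proof. exact: normal_nondeg normalP Py. Qed.

Lemma nabla1_h11_parallel : nabla1 p = w1 *: r *+ 2.
Proof. by apply/eqP; rewrite -subr_eq0 -/P P0. Qed.
Lemma nabla1_h12_parallel : nabla1 r = - (w1 *: p *+ 2).
Proof. by apply/eqP; rewrite -addr_eq0 -/Q Q0. Qed.
Lemma nabla2_h11_parallel : nabla2 p = w2 *: r *+ 2.
Proof. by rewrite nabla2_p Q0 add0r. Qed.
Lemma nabla2_h12_parallel : nabla2 r = - (w2 *: p *+ 2).
Proof. by rewrite nabla2_r P0 oppr0 add0r. Qed.

Notation alpha := '[p, p].
Notation beta := '[p, r].
Notation gamma := '[r, r].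

Let E1alpha : E1 alpha = 4 * w1 * beta.
Proof.
rewrite (der_dot _ _ _ dE1) (dotC _ p (D1 p)) (dot_D1_normal _ normal_h11).
rewrite nabla1_h11_parallel mulr2n !dotE (dotC _ r p); ring.
Qed.
Let E2alpha : E2 alpha = 4 * w2 * beta.
Proof.
rewrite (der_dot _ _ _ dE2) (dotC _ p (D2 p)) (dot_D2_normal _ normal_h11).
rewrite nabla2_h11_parallel mulr2n !dotE (dotC _ r p); ring.
Qed.
Let E1beta : E1 beta = 2 * w1 * (gamma - alpha).
Proof.
rewrite (der_dot _ _ _ dE1) (dotC _ p (D1 r)) (dot_D1_normal _ normal_h11).
rewrite (dot_D1_normal _ normal_h12) nabla1_h11_parallel nabla1_h12_parallel.
rewrite !mulr2n !dotE; ring.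
Qed.
Let E2beta : E2 beta = 2 * w2 * (gamma - alpha).
Proof.
rewrite (der_dot _ _ _ dE2) (dotC _ p (D2 r)) (dot_D2_normal _ normal_h11).
rewrite (dot_D2_normal _ normal_h12) nabla2_h11_parallel nabla2_h12_parallel.
rewrite !mulr2n !dotE; ring.
Qed.
Let E1gamma : E1 gamma = - (4 * w1 * beta).
Proof.
rewrite (der_dot _ _ _ dE1) (dotC _ r (D1 r)) (dot_D1_normal _ normal_h12).
rewrite nabla1_h12_parallel mulr2n !dotE; ring.
Qed.
Let E2gamma : E2 gamma = - (4 * w2 * beta).
Proof.
rewrite (der_dot _ _ _ dE2) (dotC _ r (D2 r)) (dot_D2_normal _ normal_h12).
rewrite nabla2_h12_parallel mulr2n !dotE; ring.
Qed.

(* Up to sign, the Gauss curvature. *)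
Let K := E1 w2 - E2 w1 + w1 ^+ 2 + w2 ^+ 2.

Let K_beta : K * beta = 0.
Proof.
do 2!apply: (half_inj fr); have := bracketE fr alpha.
rewrite bracket1 bracket2 E1alpha E2alpha -[4]/(4%:R).
rewrite !(derM dE1) !(derM dE2) E1beta E2beta !(der_nat dE1) !(der_nat dE2).
move=> H; apply: (eq_comb3 H (erefl 0) (erefl 0) (c1 := 1) (c2 := 0)
  (c3 := 0)); rewrite /K; ring.
Qed.

Let K_diff : K * (gamma - alpha) = 0.
Proof.
apply: (half_inj fr); have := bracketE fr beta.
rewrite bracket1 bracket2 E1beta E2beta.
rewrite !(derM dE1) !(derM dE2) (derB dE1) (derB dE2) !(der_nat dE1).
rewrite !(der_nat dE2) E1gamma E2gamma E1alpha E2alpha.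
move=> H; apply: (eq_comb3 H (erefl 0) (erefl 0) (c1 := 1) (c2 := 0)
  (c3 := 0)); rewrite /K; ring.
Qed.

(** The curvature annihilates the parallel, nowhere vanishing second
    fundamental form, and so vanishes. *)
Lemma parallel_flat : K = 0.
Proof.
do 2!apply: kappa_reg; have := wedge p r; rewrite (dotC _ r p) => H.
apply: (eq_comb3 K_beta K_diff H (c1 := 4 * beta) (c2 := gamma - alpha)
  (c3 := 4 * K)); rewrite /kappa; ring.
Qed.

(** For a minimal surface the Gauss equation reads K = kappa - 1. *)
Lemma sff_half_norm1 : kappa = 1.
Proof.
have := gauss_equation; rewrite -/K parallel_flat h22E dotNr => H.
by apply: subr0_eq; rewrite [RHS]H /kappa; ring.
Qed.

(** ** First integrals of a parallel minimal surface *)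

(** With kappa = 1 and p, r proportional, p and r contribute the square of the unit
    normal xi in their direction: this is the projection on the space spanned by X,
    e1, e2 and xi, which the derivatives preserve because h is parallel. *)
Definition span_form (i j : 'I_n) : A :=
  X 0 i * X 0 j + e1 0 i * e1 0 j + e2 0 i * e2 0 j + p 0 i * p 0 j
  + r 0 i * r 0 j.

(** If xi is a unit normal with p = a xi and r = b xi then these are the
    multiples by a and b of one and the same symmetric form, that exchanges X
    with xi and acts on the tangent plane as minus the shape operator. *)
Definition exchange1 (i j : 'I_n) : A :=
  X 0 i * p 0 j + p 0 i * X 0 j
  - alpha * (e1 0 i * e1 0 j - e2 0 i * e2 0 j)
  - beta * (e1 0 i * e2 0 j + e2 0 i * e1 0 j).
Definition exchange2 (i j : 'I_n) : A :=
  X 0 i * r 0 j + r 0 i * X 0 j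
  - beta * (e1 0 i * e1 0 j - e2 0 i * e2 0 j)
  - gamma * (e1 0 i * e2 0 j + e2 0 i * e1 0 j).

(** The tensor square of that form, which no longer depends on the sign of
    xi. *)
Definition exchange_square (i j k l : 'I_n) : A :=
  exchange1 i j * exchange1 k l + exchange2 i j * exchange2 k l.

Let wedge_row y : '[p, y] *: r = '[r, y] *: p.
Proof.
apply/subr0_eq/(@dot_nondeg _ _ s) => z.
by rewrite dotBl !dotZl wedge mulrC subrr.
Qed.

Lemma wedge_row_h11 : alpha *: r = beta *: p.
Proof. by rewrite wedge_row (dotC _ r). Qed.

Lemma wedge_row_h12 : beta *: r = gamma *: p.
Proof. exact: wedge_row. Qed.

Let G3 i : alpha * r 0 i = beta * p 0 i.
Proof. by have /rowP/(_ i) := wedge_row p; rewrite !mxE (dotC _ r). Qed.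

Let G4 i : beta * r 0 i = gamma * p 0 i.
Proof. by have /rowP/(_ i) := wedge_row r; rewrite !mxE. Qed.

Let G1 i : p 0 i = alpha * p 0 i + beta * r 0 i.
Proof. by rewrite G4 -mulrDl -/kappa sff_half_norm1 mul1r. Qed.

Let G2 i : r 0 i = beta * p 0 i + gamma * r 0 i.
Proof. by rewrite -G3 -mulrDl -/kappa sff_half_norm1 mul1r. Qed.

Let coord1 (z : 'rV[A]_n) i : E1 (z 0 i) = D1 z 0 i. Proof. by rewrite mxE. Qed.
Let coord2 (z : 'rV[A]_n) i : E2 (z 0 i) = D2 z 0 i. Proof. by rewrite mxE. Qed.

Let D1p : D1 p = w1 *: r *+ 2 - alpha *: e1 - beta *: e2.
Proof. by rewrite D1_nabla nabla1_h11_parallel. Qed.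
Let D1r : D1 r = - (w1 *: p *+ 2) - beta *: e1 - gamma *: e2.
Proof. by rewrite D1_nabla nabla1_h12_parallel (dotC _ r p). Qed.
Let D2p : D2 p = w2 *: r *+ 2 - beta *: e1 + alpha *: e2.
Proof. by rewrite D2_nabla nabla2_h11_parallel h22E dotNr scaleNr opprK. Qed.
Let D2r : D2 r = - (w2 *: p *+ 2) - gamma *: e1 + beta *: e2.
Proof.
by rewrite D2_nabla nabla2_h12_parallel h22E dotNr scaleNr opprK (dotC _ r p).
Qed.
Let D2e2' : D2 e2 = - p - w2 *: e1 - X.
Proof. by rewrite D2e2 h22E. Qed.

Let der1E := (derD dE1, derN dE1, derM dE1, coord1, D1p, D1r, D1e1, D1e2,
  frame1 fr, E1alpha, E1beta, E1gamma).
Let der2E := (derD dE2, derN dE2, derM dE2, coord2, D2p, D2r, D2e1, D2e2',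
  frame2 fr, E2alpha, E2beta, E2gamma).

Lemma eq_comb4 (x1 y1 x2 y2 x3 y3 x4 y4 c1 c2 c3 c4 f g : A) :
  x1 = y1 -> x2 = y2 -> x3 = y3 -> x4 = y4 ->
  f - g = c1 * (x1 - y1) + c2 * (x2 - y2) + c3 * (x3 - y3) + c4 * (x4 - y4) ->
  f = g.
Proof.
move=> -> -> -> ->; rewrite !subrr !mulr0 !addr0 => /eqP.
by rewrite subr_eq0 => /eqP.
Qed.

Lemma E1_span_form i j : E1 (span_form i j) = 0.
Proof.
rewrite /span_form !der1E !mulr2n !mxE.
apply: (eq_comb4 (G1 i) (G1 j) (G2 i) (G2 j) (c1 := e1 0 j) (c2 := e1 0 i)
  (c3 := e2 0 j) (c4 := e2 0 i)); ring.
Qed.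

Lemma E2_span_form i j : E2 (span_form i j) = 0.
Proof.
rewrite /span_form !der2E !mulr2n !mxE.
apply: (eq_comb4 (G1 i) (G1 j) (G2 i) (G2 j) (c1 := - e2 0 j)
  (c2 := - e2 0 i) (c3 := e1 0 j) (c4 := e1 0 i)); ring.
Qed.

Let E1_exchange1 i j : E1 (exchange1 i j) = 2 * w1 * exchange2 i j.
Proof.
rewrite /exchange1 /exchange2 !der1E !mulr2n !mxE.
apply: (eq_comb4 (G1 i) (G1 j) (G3 i) (G3 j) (c1 := e1 0 j) (c2 := e1 0 i)
  (c3 := e2 0 j) (c4 := e2 0 i)); ring.
Qed.

Let E1_exchange2 i j : E1 (exchange2 i j) = - (2 * w1 * exchange1 i j).
Proof.
rewrite /exchange1 /exchange2 !der1E !mulr2n !mxE.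
apply: (eq_comb4 (G2 i) (G2 j) (G4 i) (G4 j) (c1 := e1 0 j) (c2 := e1 0 i)
  (c3 := e2 0 j) (c4 := e2 0 i)); ring.
Qed.

Let E2_exchange1 i j : E2 (exchange1 i j) = 2 * w2 * exchange2 i j.
Proof.
rewrite /exchange1 /exchange2 !der2E !mulr2n !mxE.
apply: (eq_comb4 (G3 i) (G3 j) (G1 i) (G1 j) (c1 := - e1 0 j)
  (c2 := - e1 0 i) (c3 := e2 0 j) (c4 := e2 0 i)); ring.
Qed.

Let E2_exchange2 i j : E2 (exchange2 i j) = - (2 * w2 * exchange1 i j).
Proof.
rewrite /exchange1 /exchange2 !der2E !mulr2n !mxE.
apply: (eq_comb4 (G4 i) (G4 j) (G2 i) (G2 j) (c1 := - e1 0 j)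
  (c2 := - e1 0 i) (c3 := e2 0 j) (c4 := e2 0 i)); ring.
Qed.

Lemma E1_exchange_square i j k l : E1 (exchange_square i j k l) = 0.
Proof.
rewrite /exchange_square (derD dE1) !(derM dE1) !E1_exchange1 !E1_exchange2.
by ring.
Qed.

Lemma E2_exchange_square i j k l : E2 (exchange_square i j k l) = 0.
Proof.
rewrite /exchange_square (derD dE2) !(derM dE2) !E2_exchange1 !E2_exchange2.
by ring.
Qed.

End Parallel.

(** By the Codazzi equations the divergence is the gradient of the mean curvature
    vector. *)
Lemma minimal_div_sff : h22 = - h11 -> div_sff1 = 0 /\ div_sff2 = 0.
Proof.
move=> h22E; have := codazzi1; have := codazzi2; rewrite /div_sff1 /div_sff2.
have N1 : nabla1 h22 = - nabla1 h11.
  by rewrite h22E !nabla1E (der_rowN dE1) !dotNl !scaleNr -!opprD.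
have N2 : nabla2 h22 = - nabla2 h11.
  by rewrite h22E !nabla2E (der_rowN dE2) !dotNl !scaleNr -!opprD.
move=> H2 H1; split; apply/rowP => i.
  have /rowP/(_ i) := H2; rewrite N1 !mulr2n !mxE => H.
  by apply: (eq_comb3 H (erefl 0) (erefl 0) (c1 := -1) (c2 := 0) (c3 := 0));
    ring.
have /rowP/(_ i) := H1; rewrite N2 !mulr2n !mxE => H.
by apply: (eq_comb3 H (erefl 0) (erefl 0) (c1 := -1) (c2 := 0) (c3 := 0));
  ring.
Qed.

Lemma minimal_laplacian i j k : h22 = - h11 ->
  minor3 i j k X h11 h12 = 0 ->
  frame_laplacian (minor3 i j k X e1 e2)
  = - (sff_half_norm *+ 2) * minor3 i j k X e1 e2.
Proof.
move=> h22E W0; rewrite laplacian_gauss /mean /sff_norm h22E addrN.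
have [-> ->] := minimal_div_sff h22E.
have W' : minor3 i j k X h12 (- h11) = 0.
  by rewrite minor3N3 minor3_swap23 opprK.
have Z1 y z : minor3 i j k 0 y z = 0 by rewrite /minor3 !mxE; ring.
have Z2 y z : minor3 i j k y 0 z = 0 by rewrite /minor3 !mxE; ring.
have Z3 y z : minor3 i j k y z 0 = 0 by rewrite /minor3 !mxE; ring.
rewrite W0 W' Z1 Z2 Z3 /sff_half_norm dotNl dotNr; ring.
Qed.

(** ** Surfaces in a Clifford torus *)

Section CliffordTorus.
Variable L : 'I_4 -> 'rV[A]_n.
Hypothesis orthoL : forall i j, '[L i, L j] = (i == j)%:R.
Hypothesis constL : forall i, D1 (L i) = 0 /\ D2 (L i) = 0.

Definition torus_sign (i : 'I_4) : A := if (i < 2)%N then 1 else -1.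

(** The linear map with matrix diag(1, 1, -1, -1) in the basis L; along the
    torus it sends the position vector to the normal in the 3-sphere. *)
Definition reflect (z : 'rV[A]_n) : 'rV[A]_n :=
  locked (\sum_i (torus_sign i * '[z, L i]) *: L i).

Definition in_span (z : 'rV[A]_n) := z = \sum_i '[z, L i] *: L i.

Hypothesis spanX : in_span X.
(* The torus is cut out of the unit sphere by this quadratic equation. *)
Hypothesis torusX : '[X, reflect X] = 0.

Lemma dot_reflectl y z : '[reflect y, z]
  = \sum_i torus_sign i * '[y, L i] * '[z, L i].
Proof.
rewrite /reflect -lock dot_suml; apply: eq_bigr => i _.
by rewrite dotZl (dotC _ z).
Qed.

Lemma dot_reflectC y z : '[reflect y, z] = '[y, reflect z].
Proof.
by rewrite (dotC _ y) !dot_reflectl; apply: eq_bigr => i _; rewrite mulrAC.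
Qed.

Lemma torus_sign2 i : torus_sign i * torus_sign i = 1.
Proof. by rewrite /torus_sign; case: ifP; rewrite ?mulrNN mulr1. Qed.

Lemma dot_reflect_basis z i : '[reflect z, L i] = torus_sign i * '[z, L i].
Proof.
rewrite dot_reflectl (bigD1 i) //= orthoL eqxx mulr1 big1 ?addr0 // => j ji.
by rewrite orthoL eq_sym (negPf ji) mulr0.
Qed.

Lemma span_reflect z : in_span (reflect z).
Proof.
rewrite /in_span {1}/reflect -lock; apply: eq_bigr => i _.
by rewrite dot_reflect_basis.
Qed.

Lemma reflectK z : in_span z -> reflect (reflect z) = z.
Proof.
move=> zE; rewrite {1}/reflect -lock [RHS]zE; apply: eq_bigr => i _.
by rewrite dot_reflect_basis mulrA torus_sign2 mul1r.
Qed.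

Lemma span_D (E : A -> A) z : derivation E -> (forall i, map_mx E (L i) = 0) ->
  in_span z -> in_span (map_mx E z).
Proof.
move=> dE cL zE; have dotE' i : '[map_mx E z, L i] = E '[z, L i].
  by rewrite (der_dot _ _ _ dE) cL dot0r addr0.
have E0 : map_mx E z = map_mx E (\sum_i '[z, L i] *: L i) by rewrite -zE.
rewrite /in_span E0; under [RHS]eq_bigr => i _ do rewrite -E0 dotE'.
elim/big_rec2: _ => [|i y1 y2 _ <-]; first by rewrite (der_row0 dE).
by rewrite (der_rowD dE) (der_rowZ dE) cL scaler0 addr0.
Qed.

Lemma reflect_D (E : A -> A) z : derivation E ->
  (forall i, map_mx E (L i) = 0) ->
  map_mx E (reflect z) = reflect (map_mx E z).
Proof.
move=> dE cL; rewrite /reflect -!lock.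
elim/big_rec2: _ => [|i y1 y2 _ <-]; first by rewrite (der_row0 dE).
rewrite (der_rowD dE) (der_rowZ dE) cL scaler0 addr0; congr (_ *: _ + _).
rewrite (derM dE) (der_dot _ _ _ dE) cL dot0r addr0 /torus_sign.
by case: ifP; rewrite ?(derN dE) (der1 dE) ?oppr0 mul0r add0r.
Qed.

Lemma in_spanD y z : in_span y -> in_span z -> in_span (y + z).
Proof.
rewrite /in_span => yE zE; rewrite {1}yE {1}zE -big_split; apply: eq_bigr => i _.
by rewrite dotDl scalerDl.
Qed.

Lemma in_spanZ a z : in_span z -> in_span (a *: z).
Proof.
rewrite /in_span => zE; rewrite {1}zE scaler_sumr; apply: eq_bigr => i _.
by rewrite dotZl scalerA.
Qed.

Lemma in_spanN z : in_span z -> in_span (- z).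
Proof. by rewrite -scaleN1r; apply: in_spanZ. Qed.

Let cL1 i : D1 (L i) = 0. Proof. by case: (constL i). Qed.
Let cL2 i : D2 (L i) = 0. Proof. by case: (constL i). Qed.

Let span1 : in_span e1. Proof. by rewrite -(frame1 fr); apply: span_D. Qed.
Let span2 : in_span e2. Proof. by rewrite -(frame2 fr); apply: span_D. Qed.

Notation eta := (reflect X).

Let eta1 : '[e1, eta] = 0.
Proof.
apply: (half_inj fr); have := congr1 E1 torusX.
rewrite (der0 dE1) (der_dot _ _ _ dE1) (reflect_D _ dE1) // (frame1 fr).
by rewrite -(dot_reflectC X e1) (dotC _ eta e1).
Qed.

Let eta2 : '[e2, eta] = 0.
Proof.
apply: (half_inj fr); have := congr1 E2 torusX.
rewrite (der0 dE2) (der_dot _ _ _ dE2) (reflect_D _ dE2) // (frame2 fr).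
by rewrite -(dot_reflectC X e2) (dotC _ eta e2).
Qed.

Let etaeta : '[eta, eta] = 1.
Proof. by rewrite dot_reflectC (reflectK spanX) (sphereX fr). Qed.

Let b (a : 'I_4) : 'rV[A]_n := tnth [tuple X; e1; e2; eta] a.

Let orthob i j : '[b i, b j] = (i == j)%:R.
Proof.
rewrite /b !(tnth_nth 0).
case: i j => [[|[|[|[|i]]]] Hi] [[|[|[|[|j]]]] Hj] //=;
  rewrite ?frameE ?torusX ?eta1 ?eta2 ?etaeta //.
- by rewrite dotC torusX.
- by rewrite dotC eta1.
- by rewrite dotC eta2.
Qed.

Let spanb a : in_span (b a).
Proof.
rewrite /b !(tnth_nth 0); case: a => [[|[|[|[|a]]]] Ha] //=.
exact: span_reflect.
Qed.

Let sum4 (V : nmodType) (F : 'rV[A]_n -> V) :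
  \sum_a F (b a) = F X + F e1 + F e2 + F eta.
Proof. by rewrite !big_ord_recl big_ord0 /b !(tnth_nth 0) /= addr0 !addrA. Qed.

Let expand z : in_span z ->
  z = '[z, X] *: X + '[z, e1] *: e1 + '[z, e2] *: e2 + '[z, eta] *: eta.
Proof.
move=> zs; rewrite {1}(orthonormal_expansion orthob spanb zs).
by rewrite -(sum4 (fun y => '[z, y] *: y)).
Qed.

Let normal_eta z : in_span z -> normal z -> z = '[z, eta] *: eta.
Proof.
by move=> zs [zX z1 z2]; rewrite {1}(expand zs) zX z1 z2 !scale0r !add0r.
Qed.

(* The entries of minus the shape operator, which is the tangential part of
   [reflect]: eta is the image of X under a fixed linear map, so that its
   derivatives are the images of e1 and e2. *)
Let m11 := '[e1, reflect e1].
Let m12 := '[e2, reflect e1].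
Let m22 := '[e2, reflect e2].

Let h11eta : h11 = - m11 *: eta.
Proof.
have s11 : in_span h11.
  rewrite /sff11 -lock; apply: in_spanD spanX.
  by apply/in_spanD/in_spanN/in_spanZ; first exact: span_D.
rewrite {1}(normal_eta s11 normal_h11); congr (_ *: _).
have := congr1 E1 eta1; rewrite (der0 dE1) (der_dot _ _ _ dE1).
rewrite (reflect_D _ dE1) // (frame1 fr) D1e1 !dotBl dotDl dotZl eta2 torusX.
rewrite mulr0 add0r subr0 -/m11 => H.
by apply/eqP; rewrite -addr_eq0 H.
Qed.

Let h12eta : h12 = - m12 *: eta.
Proof.
have s12 : in_span h12.
  rewrite /sff12 -lock; apply: in_spanD; last exact: in_spanZ.
  exact: span_D.
rewrite {1}(normal_eta s12 normal_h12); congr (_ *: _).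
have := congr1 E1 eta2; rewrite (der0 dE1) (der_dot _ _ _ dE1).
rewrite (reflect_D _ dE1) // (frame1 fr) D1e2 dotBl dotZl eta1.
rewrite mulr0 subr0 -/m12 => H.
by apply/eqP; rewrite -addr_eq0 H.
Qed.

Let h22eta : h22 = - m22 *: eta.
Proof.
have s22 : in_span h22.
  rewrite /sff22 -lock; apply: in_spanD spanX.
  by apply: in_spanD; [exact: span_D|exact: in_spanZ].
rewrite {1}(normal_eta s22 normal_h22); congr (_ *: _).
have := congr1 E2 eta2; rewrite (der0 dE2) (der_dot _ _ _ dE2).
rewrite (reflect_D _ dE2) // (frame2 fr) D2e2 !dotBl dotZl eta1 torusX.
rewrite mulr0 !subr0 -/m22 => H.
by apply/eqP; rewrite -addr_eq0 H.
Qed.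

(* [reflect] has trace zero and exchanges X and eta, which contribute nothing to
   the trace in the basis b. *)
Let trace0 : m11 + m22 = 0.
Proof.
transitivity (\sum_a '[b a, reflect (b a)]).
  rewrite (sum4 (fun y => '[y, reflect y])) torusX (reflectK spanX).
  by rewrite (dotC _ eta X) torusX add0r addr0.
under eq_bigr => a _ do rewrite -dot_reflectC dot_reflectl.
rewrite exchange_big /=; transitivity (\sum_i torus_sign i).
  apply: eq_bigr => i _; under eq_bigr => a _ do rewrite -mulrA.
  by rewrite -big_distrr /= (orthonormal_columns orthob spanb) eqxx mulr1.
by rewrite !big_ord_recl big_ord0 /torus_sign /=; ring.
Qed.

Let norm1 : m11 ^+ 2 + m12 ^+ 2 = 1.
Proof.
have e1s := span_reflect e1.
have : '[reflect e1, reflect e1] = 1.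
  by rewrite dot_reflectC (reflectK span1) (frame11 fr).
rewrite {1}(expand e1s) !dotDl !dotZl !(dot_reflectC e1) (reflectK spanX).
rewrite eta1 dot_e1X -(dot_reflectC e1 e2) (dotC _ _ e2) -/m11 -/m12 => <-.
by ring.
Qed.

(** The torus is minimal, and its normals all lie on the line of eta. *)
Lemma clifford_torus_laplacian i j k :
  frame_laplacian (minor3 i j k X e1 e2) = - 2 * minor3 i j k X e1 e2.
Proof.
rewrite minimal_laplacian.
- congr (- _ * _); rewrite /sff_half_norm h11eta h12eta !dotE etaeta.
  by transitivity ((m11 ^+ 2 + m12 ^+ 2) *+ 2); [ring|rewrite norm1].
- rewrite h11eta h22eta -scaleNr opprK; congr (_ *: _).
  by apply/eqP; rewrite eq_sym -addr_eq0 trace0.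
- by rewrite h11eta h12eta minor3Z2 minor3Z3 minor3_23 !mulr0.
Qed.

(** A fixed vector orthogonal to the surface is orthogonal to the derivatives of
    X, hence to X, e1, e2, eta, which span the same module as L. *)
Lemma clifford_torus_full y k : D1 y = 0 -> D2 y = 0 -> '[X, y] = 0 ->
  '[L k, y] = 0.
Proof.
move=> y1 y2 Xy.
have e1y : '[e1, y] = 0.
  have := congr1 E1 Xy; rewrite (der0 dE1) (der_dot _ _ _ dE1) y1 dot0r addr0.
  by rewrite (frame1 fr).
have e2y : '[e2, y] = 0.
  have := congr1 E2 Xy; rewrite (der0 dE2) (der_dot _ _ _ dE2) y2 dot0r addr0.
  by rewrite (frame2 fr).
have h11y : '[h11, y] = 0.
  have := congr1 E1 e1y; rewrite (der0 dE1) (der_dot _ _ _ dE1) y1 dot0r addr0.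
  by rewrite D1e1 dotBl dotDl dotZl e2y Xy mulr0 add0r subr0.
have h12y : '[h12, y] = 0.
  have := congr1 E1 e2y; rewrite (der0 dE1) (der_dot _ _ _ dE1) y1 dot0r addr0.
  by rewrite D1e2 dotBl dotZl e1y mulr0 subr0.
have etay : '[eta, y] = 0.
  move: h11y h12y; rewrite h11eta h12eta !dotZl => H1 H2.
  apply: (eq_comb3 norm1 H1 H2 (c1 := - '[eta, y]) (c2 := - m11)
    (c3 := - m12)); ring.
have Lk : in_span (L k).
  rewrite /in_span (bigD1 k) //= orthoL eqxx scale1r big1 ?addr0 // => j jk.
  by rewrite orthoL eq_sym (negPf jk) scale0r.
by rewrite (expand Lk) !dotDl !dotZl Xy e1y e2y etay !mulr0 !addr0.
Qed.

Lemma clifford_torus_expansion z : in_span z ->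
  z = '[z, X] *: X + '[z, e1] *: e1 + '[z, e2] *: e2 + '[z, eta] *: eta.
Proof. exact: expand. Qed.

Let sum44 (F : 'rV[A]_n -> 'rV[A]_n -> A) : \sum_a \sum_c F (b a) (b c)
  = F X X + F X e1 + F X e2 + F X eta + (F e1 X + F e1 e1 + F e1 e2 + F e1 eta)
  + (F e2 X + F e2 e1 + F e2 e2 + F e2 eta)
  + (F eta X + F eta e1 + F eta e2 + F eta eta).
Proof.
transitivity (\sum_a (F (b a) X + F (b a) e1 + F (b a) e2 + F (b a) eta)).
  by apply: eq_bigr => a _; rewrite (sum4 (F (b a))).
by rewrite (sum4 (fun y => F y X + F y e1 + F y e2 + F y eta)).
Qed.

(** The two first integrals of the surface are those of the torus: the basis X, e1,
    e2, eta may replace L, the matrix of [reflect] in it being the exchange of X and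
    eta and minus the shape operator. *)
Lemma clifford_span_form i j :
  span_form i j = \sum_k L k 0 i * L k 0 j.
Proof.
transitivity (\sum_k 1 * (L k 0 i * L k 0 j)); last first.
  by apply: eq_bigr => k _; rewrite mul1r.
rewrite (orthonormal_form orthob spanb (fun=> 1)).
rewrite /span_form h11eta h12eta !mxE -[LHS]addr0.
transitivity (\sum_a \sum_c '[b a, b c] * (b a 0 i * b c 0 j)).
  rewrite (sum44 (fun y z => '[y, z] * (y 0 i * z 0 j))) !frameE torusX eta1.
  rewrite eta2 etaeta !(dotC _ eta) torusX eta1 eta2.
  apply: (eq_comb3 norm1 (erefl 0) (erefl 0) (c1 := eta 0 i * eta 0 j)
    (c2 := 0) (c3 := 0)); ring.
apply: eq_bigr => a _; apply: eq_bigr => c _; congr (_ * _).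
rewrite {1}(spanb a) dot_suml; apply: eq_bigr => k _.
by rewrite dotZl mul1r (dotC _ (L k)).
Qed.

Let sign_form (i j : 'I_n) := \sum_k torus_sign k * (L k 0 i * L k 0 j).

Let sign_formE i j : sign_form i j = X 0 i * eta 0 j + eta 0 i * X 0 j
  + m11 * (e1 0 i * e1 0 j - e2 0 i * e2 0 j)
  + m12 * (e1 0 i * e2 0 j + e2 0 i * e1 0 j).
Proof.
rewrite /sign_form (orthonormal_form orthob spanb).
transitivity (\sum_a \sum_c '[b a, reflect (b c)] * (b a 0 i * b c 0 j)).
  apply: eq_bigr => a _; apply: eq_bigr => c _; congr (_ * _).
  by rewrite -dot_reflectC dot_reflectl.
rewrite (sum44 (fun y z => '[y, reflect z] * (y 0 i * z 0 j))).
rewrite (reflectK spanX) torusX eta1 eta2 etaeta !frameE.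
rewrite !(dotC _ eta (reflect _)) !dot_reflectC !(reflectK spanX) !frameE.
rewrite -(dot_reflectC X e1) -(dot_reflectC X e2) !(dotC _ eta).
rewrite eta1 eta2 torusX -(dot_reflectC e1 e2) (dotC _ _ e2).
rewrite -/m11 -/m12 -/m22.
apply: (eq_comb3 trace0 (erefl 0) (erefl 0) (c1 := e2 0 i * e2 0 j)
    (c2 := 0) (c3 := 0)); ring.
Qed.

Lemma clifford_exchange_square i j k l :
  exchange_square i j k l = sign_form i j * sign_form k l.
Proof.
rewrite !sign_formE /exchange_square /exchange1 /exchange2 h11eta h12eta.
rewrite !dotE etaeta !mxE.
set S := fun i j => X 0 i * eta 0 j + eta 0 i * X 0 j
  + m11 * (e1 0 i * e1 0 j - e2 0 i * e2 0 j)
  + m12 * (e1 0 i * e2 0 j + e2 0 i * e1 0 j).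
apply: (eq_comb3 norm1 (erefl 0) (erefl 0) (c1 := S i j * S k l)
    (c2 := 0) (c3 := 0)); rewrite /S; ring.
Qed.

End CliffordTorus.

End MovingFrame.

(** * The Gram-Schmidt frame of a coordinate system *)

Section Coordinates.
Context (A : comNzRingType) (n s : nat) (d : 'I_2 -> A -> A).
Context (hf rho1 rho2 : A) (X : 'rV[A]_n).
Notation "''[' u , v ]" := (dot s u v) (format "''[' u ,  v ]").
Local Notation o0 := (ord0 : 'I_2).
Local Notation o1 := (lift ord0 ord0 : 'I_2).
Local Notation Dd i := (@map_mx A A (d i) 1 n).

Definition coord_metric (i j : 'I_2) : A := '[Dd i X, Dd j X].
Notation g := coord_metric.

Hypothesis dd : forall i, derivation (d i).
Hypothesis dC : forall i j f, d i (d j f) = d j (d i f).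
Hypothesis hf1 : hf + hf = 1.
Hypothesis X1 : '[X, X] = 1.
Hypothesis rho1E : rho1 * rho1 * g o0 o0 = 1.
Hypothesis rho2E : rho2 * rho2 * (g o0 o0 * g o1 o1 - g o0 o1 * g o0 o1) = 1.

Definition gs21 : A := - (rho1 * rho2 * g o0 o1).
Definition gs22 : A := rho1 * rho2 * g o0 o0.
Notation q := gs21.
Notation r := gs22.

Definition gsE1 (f : A) : A := rho1 * d o0 f.
Definition gsE2 (f : A) : A := q * d o0 f + r * d o1 f.
Definition gse1 : 'rV[A]_n := rho1 *: Dd o0 X.
Definition gse2 : 'rV[A]_n := q *: Dd o0 X + r *: Dd o1 X.
(** The coefficients of the bracket of the frame: the coordinate derivations
    commute, so that only derivatives of the coefficients of the frame are left. *)
Definition gsu : A := (gsE1 q - gsE2 rho1) * (g o0 o0 * rho1)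
  + gsE1 r * (rho1 * g o0 o1).
Definition gsv : A :=
  gsE1 r * (rho1 * rho2 * (g o0 o0 * g o1 o1 - g o0 o1 * g o0 o1)).

Let half0 (f : A) : f + f = 0 -> f = 0.
Proof. by move=> H; rewrite -[f]mul1r -hf1 mulrDl -mulrDr H mulr0. Qed.

Let g10 : g o1 o0 = g o0 o1. Proof. exact: dotC. Qed.

Let dE1 : derivation gsE1.
Proof. by split=> f h; rewrite /gsE1 ?(derD (dd _)) ?(derM (dd _)); ring. Qed.

Let dE2 : derivation gsE2.
Proof. by split=> f h; rewrite /gsE2 !(derD (dd _), derM (dd _)); ring. Qed.

Lemma coord_d0 f : d o0 f = g o0 o0 * rho1 * gsE1 f.
Proof.
by rewrite /gsE1 -[LHS]mul1r -rho1E; ring.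
Qed.

Lemma coord_d1 f : d o1 f = rho1 * g o0 o1 * gsE1 f
  + rho1 * rho2 * (g o0 o0 * g o1 o1 - g o0 o1 * g o0 o1) * gsE2 f.
Proof.
transitivity (rho1 * rho1 * g o0 o1 * d o0 f
  + rho2 * rho2 * (g o0 o0 * g o1 o1 - g o0 o1 * g o0 o1)
  * (rho1 * rho1 * g o0 o0 * d o1 f - rho1 * rho1 * g o0 o1 * d o0 f)).
  by rewrite rho2E rho1E; ring.
by rewrite /gsE1 /gsE2 /q /r; ring.
Qed.

Lemma gram_schmidt_frame : moving_frame s gsE1 gsE2 gsu gsv X gse1 gse2.
Proof.
split=> //.
- move=> f; transitivity ((gsE1 q - gsE2 rho1) * d o0 f + gsE1 r * d o1 f).
    rewrite /gsE1 /gsE2 !(derD (dd _), derM (dd _)) (dC o1 o0).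
    by ring.
  by rewrite (coord_d0 f) (coord_d1 f) /gsu /gsv; ring.
- by apply/rowP => i; rewrite !mxE.
- by apply/rowP => i; rewrite !mxE.
- by rewrite /gse1 !dotE mulrA -/(g o0 o0) rho1E.
- rewrite /gse2 !dotE -!/(g _ _) g10.
  transitivity (rho2 * rho2 * (g o0 o0 * g o1 o1 - g o0 o1 * g o0 o1)
    * (rho1 * rho1 * g o0 o0)); last by rewrite rho2E rho1E mulr1.
  by rewrite /q /r; ring.
- by rewrite /gse1 /gse2 !dotE -!/(g _ _) /q /r; ring.
Qed.

Definition gs_mx (a i : 'I_2) : A :=
  if a == o0 then (if i == o0 then rho1 else 0)
  else (if i == o0 then q else r).

Definition coord_inv_metric (i j : 'I_2) : A :=
  gs_mx o0 i * gs_mx o0 j + gs_mx o1 i * gs_mx o1 j.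
Notation gi := coord_inv_metric.

Definition coord_christoffel (k i j : 'I_2) : A :=
  hf * \sum_(l < 2) gi k l * (d i (g j l) + d j (g i l) - d l (g i j)).

(** The ambient connection is flat, and so the Christoffel symbols of the first kind
    are products of second and first derivatives of X. *)
Lemma koszul i j l : hf * (d i (g j l) + d j (g i l) - d l (g i j))
  = '[Dd i (Dd j X), Dd l X].
Proof.
have DC a b : Dd a (Dd b X) = Dd b (Dd a X).
  by apply/rowP => k; rewrite !mxE dC.
rewrite /g !(der_dot _ _ _ (dd _)) (DC l i) (DC l j) (DC j i).
rewrite (dotC _ (Dd j X) (Dd i (Dd l X))).
rewrite -[RHS]mul1r -hf1; ring.
Qed.

Lemma coord_christoffelE k i j : coord_christoffel k i j
  = gs_mx o0 k * '[Dd i (Dd j X), gse1] + gs_mx o1 k * '[Dd i (Dd j X), gse2].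
Proof.
rewrite /coord_christoffel big_distrr /=.
under eq_bigr => l _ do rewrite mulrCA koszul.
rewrite !big_ord_recl big_ord0 /gi /gse1 /gse2 !dotE /gs_mx /=; ring.
Qed.

Lemma coord_inv_metricP i k : \sum_j gi i j * g j k = (i == k)%:R.
Proof.
rewrite !big_ord_recl big_ord0 /gi /gs_mx.
case: (unliftP ord0 i) => [i' ->|->]; case: (unliftP ord0 k) => [k' ->|->];
  rewrite ?(ord1 i') ?(ord1 k') /= ?g10 /q /r.
- apply: (eq_comb3 rho1E rho2E (erefl 0) (c1 := 1)
    (c2 := rho1 * rho1 * g o0 o0) (c3 := 0)); ring.
- by ring.
- apply: (eq_comb3 rho2E (erefl 0) (erefl 0) (c1 := - rho1 * rho1 * g o0 o1)
    (c2 := 0) (c3 := 0)); ring.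
- apply: (eq_comb3 rho1E (erefl 0) (erefl 0) (c1 := 1) (c2 := 0) (c3 := 0)).
  ring.
Qed.

(** Both sides are the trace of the Hessian with respect to the metric. They agree
    up to the orthonormality of the frame, which enters through the expansion of
    d i F in the frame and the constancy of the norms of e1 and e2. *)
Lemma coord_laplacianE F :
  \sum_i \sum_j gi i j *
    (d j (d i F) - \sum_(k < 2) coord_christoffel k j i * d k F)
  = frame_laplacian s gsE1 gsE2 gse1 gse2 F.
Proof.
have fr := gram_schmidt_frame.
have q1 := dot_D1e1_e1 fr; have q2 := dot_D2e2_e1 fr.
have q4 := dot_D2e2_e2 fr; have q3 : conn1 s gsE1 gse1 gse2 = '[map_mx gsE1 gse1, gse2] by [].
have F0 : d o0 F = '[Dd o0 X, gse1] * gsE1 F + '[Dd o0 X, gse2] * gsE2 F.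
  rewrite {1}coord_d0 /gse1 /gse2 !dotE -!/(g _ _) /q /r; ring.
have F1 : d o1 F = '[Dd o1 X, gse1] * gsE1 F + '[Dd o1 X, gse2] * gsE2 F.
  rewrite {1}coord_d1 /gse1 /gse2 !dotE -!/(g _ _) g10 /q /r; ring.
have D1e1E : map_mx gsE1 gse1 = (rho1 * rho1) *: Dd o0 (Dd o0 X) + gsE1 rho1 *: Dd o0 X.
  by apply/rowP => i; rewrite /gse1 /gsE1 !mxE (derM (dd _)); ring.
have D2e2E : map_mx gsE2 gse2 = (q * q) *: Dd o0 (Dd o0 X)
    + (2 * q * r) *: Dd o0 (Dd o1 X) + (r * r) *: Dd o1 (Dd o1 X)
    + gsE2 q *: Dd o0 X + gsE2 r *: Dd o1 X.
  apply/rowP => i; rewrite /gse2 /gsE2 !mxE !(derD (dd _), derM (dd _)).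
  by rewrite (dC o1 o0); ring.
have E1E : gsE1 (gsE1 F) = rho1 * rho1 * d o0 (d o0 F) + gsE1 rho1 * d o0 F.
  by rewrite /gsE1 (derM (dd _)); ring.
have E2E : gsE2 (gsE2 F) = q * q * d o0 (d o0 F) + 2 * q * r * d o0 (d o1 F)
    + r * r * d o1 (d o1 F) + gsE2 q * d o0 F + gsE2 r * d o1 F.
  by rewrite /gsE2 !(derD (dd _), derM (dd _)) (dC o1 o0); ring.
rewrite /frame_laplacian E1E E2E.
have -> : conn2 s gsE2 gse1 gse2 = - '[map_mx gsE2 gse2, gse1].
  by rewrite q2 opprK.
move: q1 q4; rewrite q3 D1e1E D2e2E.
rewrite !big_ord_recl !big_ord0 !coord_christoffelE /gi /gs_mx /=.
rewrite (dC o1 o0).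
have -> : Dd o1 (Dd o0 X) = Dd o0 (Dd o1 X).
  by apply/rowP => i; rewrite !mxE dC.
rewrite !dotDl !dotZl => q1 q4.
apply: (eq_comb4 F0 F1 q1 q4 (c1 := - gsE1 rho1 - gsE2 q) (c2 := - gsE2 r)
  (c3 := - gsE1 F) (c4 := - gsE2 F)).
rewrite /gsE1 /gsE2; ring.
Qed.

End Coordinates.

(** * Smooth functions on a plane region *)

Section SmoothFunctions.
Context (R : realType) (V : normedModType R).
Implicit Types (U : set V).

Lemma near_eq_differentiable (W : normedModType R) (f g : V -> W) (a : V) :
  {near a, f =1 g} -> differentiable f a -> differentiable g a.
Proof.
move=> fg /diff_locallyP[dc df]; apply/diff_locallyP.
have fga : f a = g a by exact: nbhs_singleton fg.
have dg : g \o shift a = cst (g a) + 'd f a +o_ 0 id.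
  apply/eqaddoP => e e0; move/eqaddoP: df => /(_ e e0).
  have fg0 : \forall h \near 0, f (h + a) = g (h + a).
    by move: fg => /nbhs0P; apply: filterS => h; rewrite addrC.
  by apply: filterS2 fg0 => h /= fgh; rewrite !fctE /= fgh fga.
by have dE := diff_unique dc dg; rewrite dE.
Qed.

Lemma open_eq_near (W : Type) U (f g : V -> W) a : open U -> U a ->
  (forall b, U b -> f b = g b) -> {near a, f =1 g}.
Proof. by move=> oU Ua fg; apply: filterS (open_nbhs_nbhs (conj oU Ua)). Qed.

Lemma eq_Ck (W : normedModType R) k U (f g : V -> W) : open U ->
  (forall a, U a -> f a = g a) -> Ck k U f -> Ck k U g.
Proof.
move=> oU; elim: k f g => [|k IH] f g fg /=.
  move=> cf a Ua; have := cf a Ua; rewrite /prop_for /continuous_at fg //.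
  apply: cvg_trans; apply: near_eq_cvg.
  by apply: open_eq_near oU Ua _ => b /fg.
move=> [df cf]; split.
  move=> a Ua; apply: near_eq_differentiable (df a Ua).
  exact: open_eq_near oU Ua fg.
move=> v; apply: IH (cf v) => a Ua.
by apply: near_eq_derive; apply: open_eq_near oU Ua fg.
Qed.

Lemma Ck_pred (W : normedModType R) k U (f : V -> W) :
  Ck k.+1 U f -> Ck k U f.
Proof.
elim: k f => [|k IH] f [df cf].
  by move=> a Ua; apply: differentiable_continuous; apply: df.
by split=> // v; apply: IH; apply: cf.
Qed.

Lemma Ck_cst (W : normedModType R) k U (c : W) : Ck k U (cst c : V -> W).
Proof.
elim: k c => [|k IH] c /=; first by move=> a _; exact: cst_continuous.
split=> [a _|v]; first exact: differentiable_cst.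
by rewrite (_ : 'D_v _ = cst 0) //; apply/funext => a; rewrite derive_cst.
Qed.

Lemma CkD (W : normedModType R) k U (f g : V -> W) : open U ->
  Ck k U f -> Ck k U g -> Ck k U (f + g).
Proof.
move=> oU; elim: k f g => [|k IH] f g /=.
  by move=> cf cg a Ua; apply: cvgD; [exact: cf|exact: cg].
move=> [df cf] [dg cg]; split=> [a Ua|v].
  by apply: differentiableD; [exact: df|exact: dg].
apply: eq_Ck (IH _ _ (cf v) (cg v)) => // a Ua.
by rewrite deriveD //; apply: diff_derivable; [exact: df|exact: dg].
Qed.

Lemma CkN (W : normedModType R) k U (f : V -> W) : open U ->
  Ck k U f -> Ck k U (- f).
Proof.
move=> oU; elim: k f => [|k IH] f /=.
  by move=> cf a Ua; apply: cvgN; exact: cf.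
move=> [df cf]; split=> [a Ua|v].
  by apply: differentiableN; exact: df.
apply: eq_Ck (IH _ (cf v)) => // a Ua.
by rewrite deriveN //; apply: diff_derivable; exact: df.
Qed.

Lemma CkM k U (f g : V -> R) : open U ->
  Ck k U f -> Ck k U g -> Ck k U (f * g).
Proof.
move=> oU; elim: k f g => [|k IH] f g.
  by move=> cf cg a Ua; apply: cvgM; [exact: cf|exact: cg].
move=> Cf Cg; have [Cf' Cg'] := (Ck_pred Cf, Ck_pred Cg).
move: Cf Cg => [df cf] [dg cg]; split=> [a Ua|v].
  by apply: differentiableM; [exact: df|exact: dg].
apply: (@eq_Ck _ _ _ (f * 'D_v g + g * 'D_v f)) => // [a Ua|].
  by rewrite deriveM //; apply: diff_derivable; [exact: df|exact: dg].
by apply: CkD => //; apply: IH => //; [exact: cg|exact: cf].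
Qed.

Lemma derive_invsqrt (f rho : V -> R) a v :
  derivable rho a v -> derivable f a v ->
  {near a, rho \* rho \* f =1 cst 1} ->
  'D_v rho a = - 2^-1 * (rho a * rho a * rho a * 'D_v f a).
Proof.
move=> drho dfa near1; have H1 := nbhs_singleton near1; rewrite /= in H1.
have drr := derivableM drho drho.
have := near_eq_derive v near1; rewrite derive_cst.
rewrite (deriveM drr dfa) (deriveM drho drho) => H.
apply: (eq_comb3 H H1 (erefl 0) (c1 := 2^-1 * rho a)
  (c2 := - 'D_v rho a) (c3 := 0)).
by rewrite !fctE /GRing.scale /=; field; rewrite ?pnatr_eq0.
Qed.

(** The chain rule makes rho = 1 / sqrt f satisfy 2 D rho = - rho^3 D f, which
    bootstraps its regularity from that of f. *)
Lemma Ck_invsqrt k U (f : V -> R) : open U -> (forall a, U a -> 0 < f a) ->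
  Ck k U f -> Ck k U (fun a => (Num.sqrt (f a))^-1).
Proof.
move=> oU f0.
have dsqrt a : U a -> differentiable f a ->
    differentiable (fun a => (Num.sqrt (f a))^-1) a.
  move=> Ua dfa; apply: (@differentiable_comp _ _ _ _ f (fun x => (Num.sqrt x)^-1)).
    by [].
  apply/derivable1_diffP; apply: (@derivableV _ _ (@Num.sqrt R)).
    by rewrite sqrtr_eq0 -ltNge f0.
  by have [] := is_derive1_sqrt (f0 _ Ua).
elim: k => [|k IH].
  move=> cf a Ua; apply: cvgV; first by rewrite sqrtr_eq0 -ltNge f0.
  exact: (@continuous_comp _ _ _ f Num.sqrt a (cf a Ua)
    (@sqrt_continuous R (f a))).
move=> Cf; have Crho := IH (Ck_pred Cf); move: Cf => [df cf].
split=> [a Ua|v]; first by apply: dsqrt => //; exact: df.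
set rho := (fun a => _) in Crho *.
apply: (@eq_Ck _ _ _ ((cst (- 2^-1) : V -> R) * (rho * rho * rho * 'D_v f))) => //.
  move=> a Ua; apply/esym/derive_invsqrt.
  - by apply/diff_derivable/dsqrt => //; exact: df.
  - by apply/diff_derivable/df.
  - apply: (open_eq_near oU Ua) => b Ub.
    rewrite /= /rho -invfM -expr2 sqr_sqrtr ?ltW ?f0 //.
    by rewrite mulVf // gt_eqF // f0.
move: Crho (cf v) => {}Crho cfv.
have CC : Ck k U (rho * rho * rho * 'D_v f).
  by apply: (CkM oU) => //; apply: (CkM oU) => //; apply: (CkM oU).
exact: (CkM oU (Ck_cst k U (- 2^-1 : R)) CC).
Qed.

Lemma smoothM U (f g : V -> R) : open U -> smooth U f -> smooth U g ->
  smooth U (f * g).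
Proof. by move=> oU sf sg k; apply: CkM. Qed.

Lemma smoothD U (f g : V -> R) : open U -> smooth U f -> smooth U g ->
  smooth U (f + g).
Proof. by move=> oU sf sg k; apply: CkD. Qed.

Lemma smoothN U (f : V -> R) : open U -> smooth U f -> smooth U (- f).
Proof. by move=> oU sf k; apply: CkN. Qed.

Lemma smooth_cst U (c : R) : smooth U (cst c : V -> R).
Proof. by move=> k; apply: Ck_cst. Qed.

Lemma smooth_derive (W : normedModType R) U (f : V -> W) v :
  smooth U f -> smooth U ('D_v f).
Proof. by move=> sf k; have [_ dsf] := sf k.+1; exact: dsf. Qed.

Lemma smooth_differentiable (W : normedModType R) U (f : V -> W) a :
  smooth U f -> U a -> differentiable f a.
Proof. by move=> sf Ua; have [+ _] := sf 1%N; apply. Qed.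

Lemma eq_smooth (W : normedModType R) U (f g : V -> W) : open U ->
  (forall a, U a -> f a = g a) -> smooth U f -> smooth U g.
Proof. by move=> oU fg sf k; apply: eq_Ck (sf k). Qed.

Lemma smooth_continuous (W : normedModType R) U (f : V -> W) a :
  smooth U f -> U a -> {for a, continuous f}.
Proof. by move=> sf; apply: (sf 0%N). Qed.

Lemma smooth_coord m n U (f : V -> 'M[R]_(m, n)) i j : open U ->
  smooth U f -> smooth U (fun a => f a i j).
Proof.
move=> oU sf k; elim: k f sf => [|k IH] f sf /=.
  move=> a Ua; have := smooth_continuous sf Ua.
  move=> cf; apply: (@continuous_comp _ _ _ f (fun M : 'M[R]_(m, n) => M i j) a cf).
  exact: coord_continuous.
have df a : U a -> differentiable f a := smooth_differentiable sf.
split=> [a Ua|v].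
  apply: (@differentiable_comp _ _ _ _ f (fun M : 'M[R]_(m, n) => M i j)).
    exact: df.
  exact: differentiable_coord.
apply: eq_Ck (IH _ (smooth_derive v sf)) => // a Ua.
by rewrite derive_mx ?mxE //; exact/diff_derivable/df.
Qed.

End SmoothFunctions.

Section Schwarz.
Context (R : realType) (V : normedModType R).
Implicit Types (U : set V) (f : V -> R) (a u v : V).

Lemma is_derive_line f a v (t : R) : differentiable f (a + t *: v) ->
  is_derive t (1 : R) (fun t => f (a + t *: v)) ('D_v f (a + t *: v)).
Proof.
move=> df; pose line (t : R) := a + t *: v.
have dscale : differentiable (fun t : R => t *: v) t.
  exact: (@differentiableZl _ _ _ id v t).
have dl : is_diff t line ( *:%R^~ v).
  split; first by apply: differentiableD.
  rewrite diffD //; apply/funext => z /=; rewrite diff_cst add0r.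
  by rewrite (@diffZl _ _ _ id v t) // diff_val.
have dfl : differentiable (f \o line) t by exact: differentiable_comp.
split; first exact: diff_derivable.
rewrite [LHS]deriveE // diff_comp //= diff_val scale1r.
by rewrite -deriveE.
Qed.

Lemma MVT_line U f a v (h : R) : 0 < h ->
  (forall b, U b -> differentiable f b) ->
  (forall t, 0 <= t <= h -> U (a + t *: v)) ->
  exists2 t, 0 <= t <= h & f (a + h *: v) - f a = 'D_v f (a + t *: v) * h.
Proof.
move=> h0 df Uh; have isd t : 0 <= t <= h ->
    is_derive t (1 : R) (fun t => f (a + t *: v)) ('D_v f (a + t *: v)).
  by move=> th; apply/is_derive_line/df/Uh.
have [t| |t] := @MVT R (fun t => f (a + t *: v)) (fun t => 'D_v f (a + t *: v)) 0 h h0.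
- by rewrite in_itv /= => /andP[/ltW t0 /ltW th]; apply: isd; rewrite t0.
- apply: derivable_within_continuous => t; rewrite in_itv /= => th.
  by have [] := isd t th.
rewrite in_itv /= scale0r addr0 subr0 => /andP[/ltW t0 /ltW th] H.
by exists t; rewrite ?t0.
Qed.

Lemma derive_translate f a v w : 'D_v (fun b => f (b + w)) a = 'D_v f (a + w).
Proof.
rewrite /derive; set F := fun k : R => _; set G := fun k : R => _.
by have -> : F = G by apply/funext => k; rewrite /F /G /= addrA.
Qed.

(** The mean value theorem in the direction u, applied to the difference of f in the
    direction v, and then in the direction v. Exchanging u and v does not change the
    second difference, whence the equality of the mixed derivatives. *)
Lemma mixed_difference U f a u v (h : R) : open U -> 0 < h -> smooth U f ->
  (forall t s, 0 <= t <= h -> 0 <= s <= h -> U (a + t *: u + s *: v)) ->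
  exists t s, [/\ 0 <= t <= h, 0 <= s <= h &
    f (a + h *: u + h *: v) - f (a + h *: u) - (f (a + h *: v) - f a)
    = 'D_v ('D_u f) (a + t *: u + s *: v) * h * h].
Proof.
move=> oU h0 sf Uts; have h1 : 0 <= h <= h by rewrite lexx ltW.
have h00 : 0 <= (0 : R) <= h by rewrite lexx ltW.
pose U' := U `&` [set b | U (b + h *: v)].
pose F b := f (b + h *: v) - f b.
have dsh b : differentiable (fun b : V => b + h *: v) b by [].
have dF b : U' b -> differentiable F b.
  move=> [Ub Ubh]; apply: differentiableB; last exact: smooth_differentiable sf Ub.
  by apply: (@differentiable_comp _ _ _ _ (fun b => b + h *: v) f) => //;
    exact: smooth_differentiable sf Ubh.
have [t th] : exists2 t, 0 <= t <= h &
    F (a + h *: u) - F a = 'D_u F (a + t *: u) * h.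
  apply: (@MVT_line U') => // t th; split => /=; last exact: Uts.
  by have := Uts t 0 th h00; rewrite scale0r addr0.
have Ut : U (a + t *: u) by have := Uts t 0 th h00; rewrite scale0r addr0.
have Uth : U (a + t *: u + h *: v) by exact: Uts.
have DF : 'D_u F (a + t *: u)
    = 'D_u f (a + t *: u + h *: v) - 'D_u f (a + t *: u).
  have dfs : differentiable (fun b => f (b + h *: v)) (a + t *: u).
    by apply: (@differentiable_comp _ _ _ _ (fun b => b + h *: v) f) => //;
      exact: smooth_differentiable sf Uth.
  rewrite deriveB; [|exact: diff_derivable
    |exact/diff_derivable/(smooth_differentiable sf)].
  by congr (_ - _); exact: derive_translate.
rewrite DF.
have [s sh ->] : exists2 s, 0 <= s <= h &
    'D_u f (a + t *: u + h *: v) - 'D_u f (a + t *: u)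
    = 'D_v ('D_u f) (a + t *: u + s *: v) * h.
  apply: (@MVT_line U) => // [b Ub|s sh]; last exact: Uts.
  exact: smooth_differentiable (smooth_derive u sf) Ub.
by rewrite /F => H; exists t, s; split.
Qed.

Lemma near_close f a (e : R) : {for a, continuous f} -> 0 < e ->
  \forall b \near a, `|f a - f b| < e.
Proof. by move=> /cvgrPdist_lt cf e0; exact: cf. Qed.

(** The common values, taken at possibly distinct points close to a, tend to P a as
    well as to Q a. *)
Lemma eq_close_values U (P Q : V -> R) a u v : open U -> U a ->
  {for a, continuous P} -> {for a, continuous Q} ->
  (forall h : R, 0 < h ->
    (forall t s, 0 <= t <= h -> 0 <= s <= h -> U (a + t *: u + s *: v)) ->
    exists t s t' s', [/\ 0 <= t <= h, 0 <= s <= h, 0 <= t' <= h, 0 <= s' <= h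
      & P (a + t *: u + s *: v) = Q (a + t' *: u + s' *: v)]) ->
  P a = Q a.
Proof.
move=> oU Ua c1 c2 PQ; apply/eqP; rewrite -subr_eq0 -normr_le0.
apply/ler_addgt0Pr => e e0; rewrite add0r.
have e20 : 0 < e / 2 by rewrite divr_gt0.
have near3 : nbhs a (U `&` ([set b | `|P a - P b| < e / 2]
    `&` [set b | `|Q a - Q b| < e / 2])).
  apply: filterI; first exact: open_nbhs_nbhs.
  apply: filterI; first exact: (near_close c1 e20).
  exact: (near_close c2 e20).
move/nbhs_ballP: near3 => [d /= d0 dP].
pose N := `|u| + `|v| + 1; have N0 : 0 < N by rewrite ltr_wpDl // addr_ge0.
pose h := d / (N * 2); have h0 : 0 < h by rewrite divr_gt0 // mulr_gt0.
have inb t s : 0 <= t <= h -> 0 <= s <= h -> ball a d (a + t *: u + s *: v).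
  move=> /andP[t0 th] /andP[s0 sh]; rewrite -ball_normE /ball_ /= -addrA opprD.
  rewrite addrA subrr add0r normrN (le_lt_trans (ler_normD _ _)) // !normrZ.
  rewrite !ger0_norm //; apply: (@le_lt_trans _ _ (h * (`|u| + `|v|))).
    by rewrite mulrDr lerD // ler_wpM2r.
  have -> : d = h * (N * 2) by rewrite /h divfK // gt_eqF // mulr_gt0.
  rewrite ltr_pM2l // /N; have := normr_ge0 u; have := normr_ge0 v; lra.
have [t s th sh|t [s [t' [s' [th sh th' sh' E]]]]] := PQ h h0.
  by have [] := dP _ (inb _ _ th sh).
have [_ [B1 _]] := dP _ (inb _ _ th sh).
have [_ [_ B2]] := dP _ (inb _ _ th' sh').
rewrite -(subrKA (P (a + t *: u + s *: v))) {2}E.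
apply: (le_trans (ler_normD _ _)); rewrite (splitr e) lerD ?ltW //.
by rewrite distrC.
Qed.

Lemma cancel_square (x y h X Y : R) : h != 0 -> X = x * h * h ->
  Y = y * h * h -> X = Y -> x = y.
Proof. by move=> h0 -> -> /(mulIf h0)/(mulIf h0). Qed.

Lemma schwarz U f a u v : open U -> U a -> smooth U f ->
  'D_v ('D_u f) a = 'D_u ('D_v f) a.
Proof.
move=> oU Ua sf; apply: (@eq_close_values U ('D_v ('D_u f)) ('D_u ('D_v f)) a u v) => //.
- exact: smooth_continuous (smooth_derive v (smooth_derive u sf)) Ua.
- exact: smooth_continuous (smooth_derive u (smooth_derive v sf)) Ua.
move=> h h0 Uts; have [t [s [th sh H1]]] := mixed_difference oU h0 sf Uts.
have Uts' t' s' : 0 <= t' <= h -> 0 <= s' <= h -> U (a + t' *: v + s' *: u).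
  by move=> th' sh'; rewrite addrAC; apply: Uts.
have [t' [s' [th' sh' H2]]] := mixed_difference oU h0 sf Uts'.
exists t, s, s', t'; apply: And5 th sh sh' th' _.
have {}H2 := etrans H2 (congr1 (fun b => 'D_u ('D_v f) b * h * h)
  (addrAC a (t' *: v) (s' *: u))).
apply: (cancel_square (lt0r_neq0 h0) H1 H2).
by rewrite [in LHS]opprD addrACA -opprD (addrAC a (h *: u)).
Qed.

(** Along every segment from a the function has zero derivative. *)
Lemma derive0_cst U f a : open U -> U a -> smooth U f ->
  (forall v b, U b -> 'D_v f b = 0) -> \forall b \near a, f b = f a.
Proof.
move=> oU Ua sf f0; have /nbhs_ballP[d /= d0 dU] := open_nbhs_nbhs (conj oU Ua).
apply/nbhs_ballP; exists d => //= b ab; pose v := b - a.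
have inb t : 0 <= t <= 1 -> ball a d (a + t *: v).
  move=> /andP[t0 t1]; rewrite -ball_normE /ball_ /= opprD addrA subrr add0r.
  rewrite normrN normrZ ger0_norm //.
  move: ab; rewrite -ball_normE /ball_ /= distrC; apply: le_lt_trans.
  by rewrite ler_piMl.
have [t t1 H] : exists2 t, 0 <= t <= 1 &
    f (a + 1 *: v) - f a = 'D_v f (a + t *: v) * 1.
  apply: (@MVT_line (ball a d)) => // c /dU Uc.
  exact: smooth_differentiable sf Uc.
move: H; rewrite mulr1 scale1r /v (addrC a) subrK => H.
by apply/eqP; rewrite -subr_eq0 H f0 //; apply/dU/inb.
Qed.

End Schwarz.

(** * The differential ring of smooth functions on a region *)

Record region (R : realType) := Region {
  region_set :> set 'rV[R]_2;
  region_open : open region_set;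
  region_ne : region_set !=set0
}.

Arguments region_open {R} r.
Arguments region_ne {R} r.

Definition region_mem (R : realType) (U : region R) : 'rV[R]_2 -> Prop :=
  region_set U.
Coercion region_mem : region >-> Funclass.

(** Extending the functions by 0 outside the region makes equality of elements
    the equality of functions on the region, so that no quotient is needed. *)
Record sfun (R : realType) (U : region R) := SFun {
  sfun_val :> 'rV[R]_2 -> R;
  sfun_smooth : smooth U sfun_val;
  sfun_out : forall a, ~ U a -> sfun_val a = 0
}.

Arguments sfun_out {R U} s.
Arguments sfun_smooth {R U} s.

Section SFun.
Context (R : realType) (U : region R).
Implicit Types (f g : sfun U).

Lemma sfun_eq f g : (forall a, U a -> f a = g a) -> f = g.
Proof.
move=> fg; have : sfun_val f = sfun_val g.
  apply/funext => a; have [/fg //|Ua] := pselect (U a).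
  by rewrite !sfun_out.
case: f g {fg} => f sf f0 [g sg g0] /= E; subst g.
by congr SFun; apply: Prop_irrelevance.
Qed.

HB.instance Definition _ := gen_eqMixin (sfun U).
HB.instance Definition _ := gen_choiceMixin (sfun U).

Definition cutoff (f : 'rV[R]_2 -> R) : 'rV[R]_2 -> R :=
  fun a => if `[< U a >] then f a else 0.

Lemma cutoffE (f : 'rV[R]_2 -> R) a : U a -> cutoff f a = f a.
Proof. by rewrite /cutoff => Ua; case: asboolP. Qed.

Lemma cutoff_out (f : 'rV[R]_2 -> R) a : ~ U a -> cutoff f a = 0.
Proof. by rewrite /cutoff => Ua; case: asboolP. Qed.

Lemma cutoff_smooth (f : 'rV[R]_2 -> R) : smooth U f -> smooth U (cutoff f).
Proof.
move=> sf; apply: (eq_smooth (region_open U) _ sf) => a Ua.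
by rewrite cutoffE.
Qed.

Definition to_sfun (f : 'rV[R]_2 -> R) (sf : smooth U f) : sfun U :=
  SFun (cutoff_smooth sf) (@cutoff_out f).

Lemma to_sfunE (f : 'rV[R]_2 -> R) (sf : smooth U f) a : U a -> to_sfun sf a = f a.
Proof. exact: cutoffE. Qed.

Let oU := region_open U.

Definition sf_cst (c : R) : sfun U := to_sfun (@smooth_cst R _ U c).
Definition sf_add f g := to_sfun (smoothD oU (sfun_smooth f) (sfun_smooth g)).
Definition sf_opp f := to_sfun (smoothN oU (sfun_smooth f)).
Definition sf_mul f g := to_sfun (smoothM oU (sfun_smooth f) (sfun_smooth g)).

Let addE f g a : U a -> sf_add f g a = f a + g a.
Proof. exact: cutoffE. Qed.
Let oppE f a : U a -> sf_opp f a = - f a.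
Proof. exact: cutoffE. Qed.
Let mulE f g a : U a -> sf_mul f g a = f a * g a.
Proof. exact: cutoffE. Qed.
Let cstE c a : U a -> sf_cst c a = c.
Proof. exact: cutoffE. Qed.

Let addA : associative sf_add.
Proof. by move=> f g h; apply: sfun_eq => a Ua; rewrite !addE // addrA. Qed.
Let addC : commutative sf_add.
Proof. by move=> f g; apply: sfun_eq => a Ua; rewrite !addE // addrC. Qed.
Let add0 : left_id (sf_cst 0) sf_add.
Proof. by move=> f; apply: sfun_eq => a Ua; rewrite !addE // cstE // add0r. Qed.
Let addN : left_inverse (sf_cst 0) sf_opp sf_add.
Proof.
by move=> f; apply: sfun_eq => a Ua; rewrite addE // oppE // cstE // addNr.
Qed.
HB.instance Definition _ := GRing.isZmodule.Build (sfun U) addA addC add0 addN.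

Let mulA : associative sf_mul.
Proof. by move=> f g h; apply: sfun_eq => a Ua; rewrite !mulE // mulrA. Qed.
Let mulC : commutative sf_mul.
Proof. by move=> f g; apply: sfun_eq => a Ua; rewrite !mulE // mulrC. Qed.
Let mul1 : left_id (sf_cst 1) sf_mul.
Proof. by move=> f; apply: sfun_eq => a Ua; rewrite !mulE // cstE // mul1r. Qed.
Let mulD : left_distributive sf_mul sf_add.
Proof.
move=> f g h; apply: sfun_eq => a Ua.
by rewrite !(mulE, addE) // mulrDl.
Qed.
Let one0 : sf_cst 1 != 0.
Proof.
have [a Ua] := region_ne U; apply/eqP => /(congr1 (fun f : sfun U => f a)).
by rewrite [RHS](cstE 0 Ua) cstE // => /eqP; rewrite oner_eq0.
Qed.
HB.instance Definition _ := GRing.Zmodule_isComNzRing.Build (sfun U)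
  mulA mulC mul1 mulD one0.

Lemma sf_addE f g a : U a -> (f + g) a = f a + g a. Proof. exact: addE. Qed.
Lemma sf_oppE f a : U a -> (- f) a = - f a. Proof. exact: oppE. Qed.
Lemma sf_mulE f g a : U a -> (f * g) a = f a * g a. Proof. exact: mulE. Qed.
Lemma sf_cstE c a : U a -> sf_cst c a = c. Proof. exact: cstE. Qed.
Lemma sf_1E a : U a -> (1 : sfun U) a = 1. Proof. exact: cstE. Qed.
Lemma sf_0E a : (0 : sfun U) a = 0.
Proof.
by have [Ua|Ua] := pselect (U a); [exact: cstE|exact: sfun_out].
Qed.

Lemma sf_sumE I (r : seq I) (P : pred I) (F : I -> sfun U) a : U a ->
  (\sum_(i <- r | P i) F i) a = \sum_(i <- r | P i) F i a.
Proof.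
move=> Ua; elim/big_rec2: _ => [|i y1 y2 _ <-]; first exact: sf_0E.
by rewrite sf_addE.
Qed.

Definition sf_der (v : 'rV[R]_2) f : sfun U :=
  to_sfun (smooth_derive v (sfun_smooth f)).

Lemma sf_derE v f a : U a -> sf_der v f a = 'D_v f a.
Proof. exact: cutoffE. Qed.

Lemma near_sfun (f : sfun U) (g : 'rV[R]_2 -> R) a : U a ->
  (forall b, U b -> f b = g b) -> {near a, sfun_val f =1 g}.
Proof. by move=> Ua fg; apply: open_eq_near oU Ua fg. Qed.

Lemma sf_derE' v f (g : 'rV[R]_2 -> R) a : U a ->
  (forall b, U b -> f b = g b) -> sf_der v f a = 'D_v g a.
Proof.
by move=> Ua fg; rewrite sf_derE //; apply/near_eq_derive/near_sfun.
Qed.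

Lemma sfun_derivable v f a : U a -> derivable f a v.
Proof.
by move=> Ua; apply/diff_derivable/(smooth_differentiable (sfun_smooth f)).
Qed.

Lemma sf_derivation v : derivation (sf_der v).
Proof.
split=> f g; apply: sfun_eq => a Ua.
  rewrite sf_addE // !sf_derE //.
  rewrite (near_eq_derive v (near_sfun Ua (fun b Ub => sf_addE f g Ub))).
  by rewrite [LHS]deriveD //; exact: sfun_derivable.
rewrite sf_addE // !sf_mulE // !sf_derE //.
rewrite (near_eq_derive v (near_sfun Ua (fun b Ub => sf_mulE f g Ub))).
rewrite [LHS]deriveM; [|exact: sfun_derivable..].
by rewrite addrC mulrC.
Qed.

Lemma sf_der_comm v w f : sf_der v (sf_der w f) = sf_der w (sf_der v f).
Proof.
apply: sfun_eq => a Ua.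
have E x y : sf_der x (sf_der y f) a = 'D_x ('D_y f) a.
  exact: (sf_derE' x Ua (fun b Ub => sf_derE y f Ub)).
exact: (etrans (E v w) (etrans (schwarz w v oU Ua (sfun_smooth f))
  (esym (E w v)))).
Qed.

Lemma sf_der_cst v c : sf_der v (sf_cst c) = 0.
Proof.
apply: sfun_eq => a Ua; rewrite sf_0E (sf_derE' (g := cst c) _ Ua).
  exact: derive_cst.
by move=> b Ub; rewrite sf_cstE.
Qed.

Lemma sf_locally_cst f a : U a ->
  sf_der (delta_mx 0 0) f = 0 -> sf_der (delta_mx 0 1) f = 0 ->
  \forall b \near a, f b = f a.
Proof.
move=> Ua f0 f1; apply: (derive0_cst oU Ua (sfun_smooth f)) => v b Ub.
have df := smooth_differentiable (sfun_smooth f) Ub.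
have E i : 'd f b (delta_mx 0 i) = 0.
  rewrite -deriveE // -sf_derE //.
  by case: (unliftP 0 i) => [j ->|->]; rewrite ?f0 ?sf_0E // (ord1 j)
    (_ : lift 0 0 = 1) ?f1 ?sf_0E //; apply/val_inj.
rewrite deriveE // (row_sum_delta v) linear_sum big1 // => i _.
by rewrite linearZ /= E scaler0.
Qed.

Definition sf_invsqrt f (f0 : forall a, U a -> 0 < f a) : sfun U :=
  to_sfun (fun k => Ck_invsqrt oU f0 (sfun_smooth f k)).

Lemma sf_invsqrtE f (f0 : forall a, U a -> 0 < f a) a : U a ->
  sf_invsqrt f0 a = (Num.sqrt (f a))^-1.
Proof. exact: cutoffE. Qed.

Lemma sf_invsqrtP f (f0 : forall a, U a -> 0 < f a) :
  sf_invsqrt f0 * sf_invsqrt f0 * f = 1.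
Proof.
apply: sfun_eq => a Ua; rewrite !sf_mulE // sf_1E // !sf_invsqrtE //.
rewrite -invfM -expr2 sqr_sqrtr ?ltW ?f0 //.
by rewrite mulVf // gt_eqF // f0.
Qed.

End SFun.

(** * Parametrized pieces of a spacelike surface *)

Record patch (R : realType) (n s : nat) := Patch {
  patch_region :> region R;
  patch_fun : 'rV[R]_2 -> 'rV[R]_n;
  patch_smooth : smooth patch_region patch_fun;
  patch_sphere : forall a, patch_region a ->
    inner s (patch_fun a) (patch_fun a) = 1;
  patch_spacelike : forall a v, patch_region a -> v != 0 ->
    0 < inner s ('D_v patch_fun a) ('D_v patch_fun a)
}.
Arguments patch_smooth {R n s} p.
Arguments patch_sphere {R n s} p {a}.
Arguments patch_spacelike {R n s} p {a v}.

(** The combination z = g01 x - g00 y is orthogonal to x, and its square norm is g00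
    times the Gram determinant. *)
Lemma gram_pos (R : realType) (n s : nat) (x y : 'rV[R]_n) (g00 g01 g11 : R) :
  g00 = inner s x x -> g01 = inner s x y -> g11 = inner s y y -> 0 < g00 ->
  0 < inner s (g01 *: x + (- g00) *: y) (g01 *: x + (- g00) *: y) ->
  0 < g00 * g11 - g01 * g01.
Proof.
move=> G00 G01 G11 g0; rewrite -[inner s _ _]/(dot s _ _) !dotE (dotC _ y x).
rewrite -![dot s _ _]/(inner s _ _) -G00 -G01 -G11 => H.
by rewrite -(pmulr_rgt0 _ g0); apply: (lt_le_trans H); rewrite le_eqVlt;
  apply/orP; left; apply/eqP; ring.
Qed.

Section Patch.
Context (R : realType) (n s : nat) (P : patch R n s).
Notation U := (patch_region P).
Notation F := (patch_fun P).
Notation A := (sfun U).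
Let oU := region_open U.
Local Notation o0 := (ord0 : 'I_2).
Local Notation o1 := (lift ord0 ord0 : 'I_2).

Definition at_pt (a : 'rV[R]_2) (u : 'rV[A]_n) : 'rV[R]_n :=
  \row_i sfun_val (u 0 i) a.

Implicit Types (a : 'rV[R]_2) (u v : 'rV[A]_n).

Lemma at_ptE a u i : at_pt a u 0 i = u 0 i a.
Proof. by rewrite mxE. Qed.

Lemma at_ptD a u v : U a -> at_pt a (u + v) = at_pt a u + at_pt a v.
Proof. by move=> Ua; apply/rowP => i; rewrite !mxE sf_addE. Qed.

Lemma at_ptZ a (f : A) u : U a -> at_pt a (f *: u) = f a *: at_pt a u.
Proof. by move=> Ua; apply/rowP => i; rewrite !mxE sf_mulE. Qed.

Lemma sf_signE a k : U a -> ((-1) ^+ k : A) a = (-1) ^+ k.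
Proof.
move=> Ua; elim: k => [|k IH]; first exact: sf_1E.
by rewrite !exprS sf_mulE // IH sf_oppE // sf_1E.
Qed.

Lemma dot_at_pt a u v : U a -> dot s u v a = inner s (at_pt a u) (at_pt a v).
Proof.
move=> Ua; rewrite /dot sf_sumE //; apply: eq_bigr => i _.
by rewrite !sf_mulE // sf_signE // !mxE.
Qed.

Definition patchX : 'rV[A]_n :=
  \row_i to_sfun (smooth_coord 0 i oU (patch_smooth P)).

Lemma at_patchX a : U a -> at_pt a patchX = F a.
Proof. by move=> Ua; apply/rowP => i; rewrite !mxE to_sfunE. Qed.

Definition patch_d (i : 'I_2) : A -> A := sf_der (delta_mx 0 i).

Lemma at_patch_der a (v : 'rV[R]_2) : U a -> at_pt a (map_mx (sf_der v) patchX) = 'D_v F a.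
Proof.
move=> Ua; have dF := smooth_differentiable (patch_smooth P) Ua.
rewrite derive_mx; last exact: diff_derivable.
apply/rowP => i; rewrite !mxE; apply: sf_derE' => // b Ub.
exact: to_sfunE.
Qed.

Notation g := (coord_metric s patch_d patchX).

Lemma patch_metricE a i j : U a ->
  g i j a = inner s ('D_(delta_mx 0 i) F a) ('D_(delta_mx 0 j) F a).
Proof. by move=> Ua; rewrite /coord_metric dot_at_pt // !at_patch_der. Qed.

Lemma patch_D_comb a (k l : R) : U a -> 'D_(k *: delta_mx 0 o0 + l *: delta_mx 0 o1) F a
  = k *: 'D_(delta_mx 0 o0) F a + l *: 'D_(delta_mx 0 o1) F a.
Proof.
move=> Ua; have dF := smooth_differentiable (patch_smooth P) Ua.
by rewrite !deriveE // linearD !linearZ.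
Qed.

Lemma patch_g00 a : U a -> 0 < g o0 o0 a.
Proof.
move=> Ua; rewrite patch_metricE //; apply: patch_spacelike => //.
by apply/eqP => /rowP/(_ o0); rewrite !mxE eqxx; apply/eqP; rewrite oner_eq0.
Qed.

Lemma patch_det a : U a -> 0 < (g o0 o0 * g o1 o1 - g o0 o1 * g o0 o1) a.
Proof.
move=> Ua; have g0 := patch_g00 Ua.
have v0 : g o0 o1 a *: delta_mx 0 o0 + (- g o0 o0 a) *: delta_mx 0 o1
    != 0 :> 'rV[R]_2.
  apply/eqP => /rowP/(_ o1); rewrite !mxE /= mulr0 add0r mulr1 => /eqP.
  by rewrite oppr_eq0 (gt_eqF g0).
have := patch_spacelike P Ua v0; rewrite patch_D_comb //.
move/(gram_pos (patch_metricE o0 o0 Ua) (patch_metricE o0 o1 Ua)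
  (patch_metricE o1 o1 Ua) g0); move: (g o0 o0) (g o0 o1) (g o1 o1) => x y z.
by rewrite sf_addE // sf_oppE // !sf_mulE.
Qed.

Definition patch_rho1 : A := sf_invsqrt patch_g00.
Definition patch_rho2 : A := sf_invsqrt patch_det.

Notation E1 := (gsE1 patch_d patch_rho1).
Notation E2 := (gsE2 s patch_d patch_rho1 patch_rho2 patchX).
Definition patch_e1 : 'rV[A]_n := gse1 patch_d patch_rho1 patchX.
Definition patch_e2 : 'rV[A]_n := gse2 s patch_d patch_rho1 patch_rho2 patchX.

Definition patch_half : A := sf_cst U 2^-1.

Lemma patch_halfE : patch_half + patch_half = 1.
Proof.
apply: sfun_eq => a Ua; rewrite sf_addE // sf_1E // !sf_cstE //.
by rewrite [RHS]splitr !mul1r.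
Qed.

Lemma patch_d_derivation i : derivation (patch_d i).
Proof. exact: sf_derivation. Qed.

Lemma patch_d_comm i j f : patch_d i (patch_d j f) = patch_d j (patch_d i f).
Proof. exact: sf_der_comm. Qed.

Lemma patchXX : dot s patchX patchX = 1.
Proof.
apply: sfun_eq => a Ua; rewrite dot_at_pt // at_patchX // sf_1E //.
exact: patch_sphere.
Qed.

Lemma patch_frame : moving_frame s E1 E2
  (gsu s patch_d patch_rho1 patch_rho2 patchX)
  (gsv s patch_d patch_rho1 patch_rho2 patchX) patchX patch_e1 patch_e2.
Proof.
apply: (gram_schmidt_frame patch_d_derivation patch_d_comm patch_halfE patchXX).
  exact: sf_invsqrtP.
exact: sf_invsqrtP.
Qed.

End Patch.

(** * Clifford tori and their quadratic forms *)

Section Torus.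
Context (R : realType) (n s : nat).
Notation "''[' u , v ]" := (dot s u v) (format "''[' u ,  v ]").
Implicit Types (u v w : 'rV[R]_n) (L : 'I_4 -> 'rV[R]_n)
  (B C D : 'I_n -> 'I_n -> R).

Definition orthonormal4 L := forall i j, '[L i, L j] = (i == j)%:R.

(** In the coordinates y with respect to L, the equations are
    y0^2 + y1^2 + y2^2 + y3^2 = 1 and y0^2 + y1^2 = y2^2 + y3^2. *)
Definition torus_set L : set 'rV[R]_n :=
  [set v | [/\ v = \sum_k '[v, L k] *: L k, '[v, v] = 1 &
    \sum_k torus_sign R k * '[v, L k] ^+ 2 = 0]].

Definition span_mx L (i j : 'I_n) : R := \sum_k L k 0 i * L k 0 j.
Definition sign_mx L (i j : 'I_n) : R :=
  \sum_k torus_sign R k * (L k 0 i * L k 0 j).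

Let lower v (i : 'I_n) : R := (-1) ^+ (n - s <= i)%N * v 0 i.

Definition quad_form B v : R := \sum_i \sum_j B i j * (lower v i * lower v j).

(** An identity between tensor squares passes to the values of the forms. *)
Lemma quad_form_square B C D v :
  (forall i j k l, B i j * B k l = C i j * C k l + D i j * D k l) ->
  quad_form B v ^+ 2 = quad_form C v ^+ 2 + quad_form D v ^+ 2.
Proof.
have qE E : quad_form E v ^+ 2 = \sum_i \sum_j \sum_k \sum_l E i j * E k l
    * (lower v i * lower v j * (lower v k * lower v l)).
  rewrite expr2 {1}/quad_form big_distrl; apply: eq_bigr => i _ /=.
  rewrite big_distrl; apply: eq_bigr => j _ /=.
  rewrite /quad_form big_distrr; apply: eq_bigr => k _ /=.
  by rewrite big_distrr; apply: eq_bigr => l _ /=; ring.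
move=> BCD; rewrite !qE -big_split; apply: eq_bigr => i _ /=.
rewrite -big_split; apply: eq_bigr => j _ /=.
rewrite -big_split; apply: eq_bigr => k _ /=.
by rewrite -big_split; apply: eq_bigr => l _ /=; rewrite BCD mulrDl.
Qed.

Lemma dot_lower u v : '[u, v] = \sum_i u 0 i * lower v i.
Proof. by apply: eq_bigr => i _; rewrite /lower; ring. Qed.

Lemma quad_form_mul u w v :
  quad_form (fun i j => u 0 i * w 0 j) v = '[u, v] * '[w, v].
Proof.
rewrite /quad_form !dot_lower big_distrl; apply: eq_bigr => i _ /=.
by rewrite big_distrr; apply: eq_bigr => j _ /=; ring.
Qed.

Lemma quad_formD B C v :
  quad_form (fun i j => B i j + C i j) v = quad_form B v + quad_form C v.
Proof.
rewrite /quad_form -big_split; apply: eq_bigr => i _ /=.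
by rewrite -big_split; apply: eq_bigr => j _ /=; rewrite mulrDl.
Qed.

Lemma quad_formZ z B v : quad_form (fun i j => z * B i j) v = z * quad_form B v.
Proof.
rewrite /quad_form big_distrr; apply: eq_bigr => i _ /=.
by rewrite big_distrr; apply: eq_bigr => j _ /=; rewrite -mulrA.
Qed.

Lemma quad_form_sign_mx L v :
  quad_form (sign_mx L) v = \sum_k torus_sign R k * '[v, L k] ^+ 2.
Proof.
transitivity (\sum_k quad_form (fun i j => torus_sign R k *
    (L k 0 i * L k 0 j)) v).
  rewrite /quad_form [RHS]exchange_big; apply: eq_bigr => i _ /=.
  rewrite [RHS]exchange_big; apply: eq_bigr => j _ /=.
  by rewrite /sign_mx big_distrl.
apply: eq_bigr => k _; rewrite quad_formZ quad_form_mul expr2.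
by rewrite (dotC _ v).
Qed.

Lemma span_mx_sum L v i :
  (\sum_k '[v, L k] *: L k) 0 i = \sum_j span_mx L i j * lower v j.
Proof.
rewrite summxE; under eq_bigr => k _ do rewrite mxE (dotC _ v) dot_lower big_distrl.
rewrite exchange_big; apply: eq_bigr => j _ /=; rewrite /span_mx big_distrl.
by apply: eq_bigr => k _ /=; ring.
Qed.

(** The signed form enters the torus only through its square: its overall sign
    is not determined by the torus. *)
Lemma torus_set_forms L L' : (forall i j, span_mx L i j = span_mx L' i j) ->
  (forall i j k l, sign_mx L i j * sign_mx L k l
    = sign_mx L' i j * sign_mx L' k l) ->
  torus_set L = torus_set L'.
Proof.
move=> Lspan Lsign; apply/seteqP; split => v [vspan v1 v0]; split => //.
- apply/rowP => i; rewrite {1}vspan !span_mx_sum.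
  by apply: eq_bigr => j _; rewrite Lspan.
- apply/eqP; rewrite -sqrf_eq0 -quad_form_sign_mx.
  rewrite (@quad_form_square _ (sign_mx L) (fun _ _ => 0)).
    rewrite quad_form_sign_mx v0 expr0n add0r /quad_form.
    by rewrite big1 ?expr0n // => i _; rewrite big1 // => j _; rewrite mul0r.
  by move=> i j k l; rewrite Lsign mulr0 addr0.
- apply/rowP => i; rewrite {1}vspan !span_mx_sum.
  by apply: eq_bigr => j _; rewrite Lspan.
- apply/eqP; rewrite -sqrf_eq0 -quad_form_sign_mx.
  rewrite (@quad_form_square _ (sign_mx L') (fun _ _ => 0)).
    rewrite quad_form_sign_mx v0 expr0n add0r /quad_form.
    by rewrite big1 ?expr0n // => i _; rewrite big1 // => j _; rewrite mul0r.
  by move=> i j k l; rewrite Lsign mulr0 addr0.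
Qed.

(** The axis of the reflection of the plane with matrix ((- a, - b), (- b, a)) lies at
    half the angle of (- a, - b). *)
Lemma half_angle (a b : R) : a ^+ 2 + b ^+ 2 = 1 ->
  exists c d : R, [/\ c ^+ 2 + d ^+ 2 = 1, c ^+ 2 - d ^+ 2 = - a
    & 2 * c * d = - b].
Proof.
move=> ab1; have a1 : 0 <= (1 - a) / 2.
  have a21 : a ^+ 2 <= 1 by rewrite -ab1 lerDl sqr_ge0.
  have a1 : a <= 1 by nra.
  by rewrite divr_ge0 // subr_ge0.
pose c := Num.sqrt ((1 - a) / 2); have c2 : c ^+ 2 = (1 - a) / 2 by exact: sqr_sqrtr.
have [c0|c0] := eqVneq c 0.
  exists 0, 1; have : (1 - a) / 2 = 0 by rewrite -c2 c0 expr0n.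
  move=> a2; have a_1 : a = 1 by lra.
  have b0 : b ^+ 2 = 0 by move: ab1; rewrite a_1; lra.
  by have /eqP := b0; rewrite sqrf_eq0 => /eqP ->; rewrite a_1; split; ring.
exists c, (- b / (2 * c)).
have d2 : (- b / (2 * c)) ^+ 2 = (1 + a) / 2.
  rewrite expr_div_n sqrrN exprMn c2.
  have a0 : 1 - a != 0 by move: c0; apply: contraNneq => a0; rewrite /c a0 mul0r sqrtr0.
  have -> : b ^+ 2 = (1 - a) * (1 + a) by lra.
  by field.
by split; [rewrite c2 d2; field|rewrite c2 d2; field|field; rewrite c0].
Qed.

(** Proportional vectors of total square norm 1 are the multiples of one unit vector,
    found by normalizing the first one, or the second if the first is zero. *)
Lemma common_factor (al be ga : R) (p r : 'rV[R]_n) :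
  '[p, p] = al -> '[p, r] = be -> '[r, r] = ga -> al + ga = 1 ->
  al *: r = be *: p -> be *: r = ga *: p ->
  exists a b eta, [/\ a ^+ 2 + b ^+ 2 = 1, p = a *: eta, r = b *: eta &
    exists c d, eta = c *: p + d *: r /\ '[eta, eta] = 1].
Proof.
move=> pp pr rr alga H1 H2.
have abg : be ^+ 2 = al * ga.
  have := congr1 (fun z => '[z, r]) H1; rewrite /= !dotZl pr rr expr2.
  by move=> ->.
have al0 : 0 <= al by nra.
have [al_0|al_n0] := eqVneq al 0.
  have be0 : be = 0 by apply/eqP; rewrite -sqrf_eq0 abg al_0 mul0r.
  have ga1 : ga = 1 by rewrite -alga al_0 add0r.
  exists 0, 1, r; split; [by ring| |by rewrite scale1r|].
    by move: H2; rewrite be0 ga1 scale1r !scale0r.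
  by exists 0, 1; rewrite scale0r add0r scale1r rr ga1.
have a2 := sqr_sqrtr al0; set a := Num.sqrt al in a2.
have a0 : a != 0 by rewrite -sqrf_eq0 a2.
exists a, (be / a), (a^-1 *: p); split.
- rewrite expr_div_n a2 abg; apply: etrans alga; congr (_ + _).
  by rewrite mulrC mulKf.
- by rewrite scalerA mulfV // scale1r.
- rewrite scalerA -mulrA -invfM -expr2 a2 mulrC -scalerA -H1 scalerA.
  by rewrite mulVf // scale1r.
- exists a^-1, 0; rewrite scale0r addr0; split=> //.
  by rewrite dotZl dotZr pp mulrA -invfM -expr2 a2 mulVf.
Qed.

End Torus.

Section AdaptedBasis.
Context (R : realType) (n s : nat) (X e1 e2 p r : 'rV[R]_n) (al be ga : R).
Notation "''[' u , v ]" := (dot s u v) (format "''[' u ,  v ]").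
Hypotheses (XX : '[X, X] = 1) (e11 : '[e1, e1] = 1) (e22 : '[e2, e2] = 1).
Hypotheses (Xe1 : '[X, e1] = 0) (Xe2 : '[X, e2] = 0) (e12 : '[e1, e2] = 0).
Hypotheses (np : normal s X e1 e2 p) (nr : normal s X e1 e2 r).
Hypotheses (pp : '[p, p] = al) (pr : '[p, r] = be) (rr : '[r, r] = ga).
Hypotheses (alga : al + ga = 1).
Hypotheses (w1 : al *: r = be *: p) (w2 : be *: r = ga *: p).

(** The form to be diagonalized exchanges X with the unit normal eta and is a
    reflection of the tangent plane; its axis is found by halving an angle. *)
Lemma adapted_basis : exists L : 'I_4 -> 'rV[R]_n, [/\ orthonormal4 s L,
  forall i j, span_mx L i j = X 0 i * X 0 j + e1 0 i * e1 0 j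
    + e2 0 i * e2 0 j + p 0 i * p 0 j + r 0 i * r 0 j &
  forall i j k l, sign_mx L i j * sign_mx L k l
  = (X 0 i * p 0 j + p 0 i * X 0 j - al * (e1 0 i * e1 0 j - e2 0 i * e2 0 j)
      - be * (e1 0 i * e2 0 j + e2 0 i * e1 0 j))
    * (X 0 k * p 0 l + p 0 k * X 0 l - al * (e1 0 k * e1 0 l - e2 0 k * e2 0 l)
      - be * (e1 0 k * e2 0 l + e2 0 k * e1 0 l))
  + (X 0 i * r 0 j + r 0 i * X 0 j - be * (e1 0 i * e1 0 j - e2 0 i * e2 0 j)
      - ga * (e1 0 i * e2 0 j + e2 0 i * e1 0 j))
    * (X 0 k * r 0 l + r 0 k * X 0 l - be * (e1 0 k * e1 0 l - e2 0 k * e2 0 l)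
      - ga * (e1 0 k * e2 0 l + e2 0 k * e1 0 l))].
Proof.
have [a [b [eta [ab1 pE rE [c' [d' [etaE eta1]]]]]]] :=
  common_factor pp pr rr alga w1 w2.
have [c [d [cd1 cda cdb]]] := half_angle ab1.
have [etaX etae1 etae2] : normal s X e1 e2 eta.
  by rewrite etaE; apply: normalD; apply: normalZ.
pose h : R := (Num.sqrt 2)^-1.
have h2 : h ^+ 2 = 2^-1 by rewrite exprVn sqr_sqrtr.
have {}h2 : h * h = 2^-1 by rewrite -expr2.
pose L (k : 'I_4) : 'rV[R]_n := tnth [tuple h *: (X + eta); c *: e1 + d *: e2;
  h *: (X - eta); c *: e2 - d *: e1] k.
have alE : al = a * a by rewrite -pp pE !dotE eta1 mulr1.
have beE : be = a * b by rewrite -pr pE rE !dotE eta1 mulr1.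
have gaE : ga = b * b by rewrite -rr rE !dotE eta1 mulr1.
have [Xeta e1eta e2eta] : [/\ '[X, eta] = 0, '[e1, eta] = 0 & '[e2, eta] = 0].
  by rewrite !(dotC _ _ eta).
have [e1X e2X e21] : [/\ '[e1, X] = 0, '[e2, X] = 0 & '[e2, e1] = 0].
  by rewrite (dotC _ e1 X) (dotC _ e2 X) (dotC _ e2 e1).
exists L; split.
- move=> i j; rewrite /L !(tnth_nth 0).
  case: i j => [[|[|[|[|i]]]] Hi] [[|[|[|[|j]]]] Hj] //=; rewrite !dotE ?XX ?e11
    ?e22 ?Xe1 ?Xe2 ?e12 ?etaX ?etae1 ?etae2 ?Xeta ?e1eta ?e2eta ?e1X ?e2X ?e21
    ?eta1; try ring.
  + apply: (eq_comb3 h2 (erefl 0) (erefl 0) (c1 := 2) (c2 := 0) (c3 := 0)).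
    by field.
  + by apply: (eq_comb3 cd1 (erefl 0) (erefl 0) (c1 := 1) (c2 := 0) (c3 := 0));
      ring.
  + apply: (eq_comb3 h2 (erefl 0) (erefl 0) (c1 := 2) (c2 := 0) (c3 := 0)).
    by field.
  + by apply: (eq_comb3 cd1 (erefl 0) (erefl 0) (c1 := 1) (c2 := 0) (c3 := 0));
      ring.
- move=> i j; rewrite /span_mx !big_ord_recl big_ord0 /L !(tnth_nth 0) /=.
  rewrite pE rE !mxE.
  apply: (eq_comb3 h2 cd1 ab1 (c1 := 2 * (X 0 i * X 0 j + eta 0 i * eta 0 j))
    (c2 := e1 0 i * e1 0 j + e2 0 i * e2 0 j)
    (c3 := - (eta 0 i * eta 0 j))).
  by field.
have signE i j : sign_mx L i j = X 0 i * eta 0 j + eta 0 i * X 0 j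
    - a * (e1 0 i * e1 0 j - e2 0 i * e2 0 j)
    - b * (e1 0 i * e2 0 j + e2 0 i * e1 0 j).
  rewrite /sign_mx !big_ord_recl big_ord0 /L !(tnth_nth 0) /torus_sign /= !mxE.
  apply: (eq_comb3 h2 cda cdb (c1 := 2 * (X 0 i * eta 0 j + eta 0 i * X 0 j))
    (c2 := e1 0 i * e1 0 j - e2 0 i * e2 0 j)
    (c3 := e1 0 i * e2 0 j + e2 0 i * e1 0 j)).
  by field.
move=> i j k l; rewrite !signE alE beE gaE pE rE !mxE.
apply: (eq_comb3 ab1 (erefl 0) (erefl 0) (c1 := - ((X 0 i * eta 0 j
    + eta 0 i * X 0 j - a * (e1 0 i * e1 0 j - e2 0 i * e2 0 j)
    - b * (e1 0 i * e2 0 j + e2 0 i * e1 0 j)) * (X 0 k * eta 0 l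
    + eta 0 k * X 0 l - a * (e1 0 k * e1 0 l - e2 0 k * e2 0 l)
    - b * (e1 0 k * e2 0 l + e2 0 k * e1 0 l)))) (c2 := 0) (c3 := 0)).
by ring.
Qed.

End AdaptedBasis.

Section TorusMembership.
Context (R : realType) (n s : nat) (L : 'I_4 -> 'rV[R]_n).
Context (X e1 e2 p r : 'rV[R]_n) (al be ga : R).
Notation "''[' u , v ]" := (dot s u v) (format "''[' u ,  v ]").

Lemma quad_form_exchange (w : 'rV[R]_n) (x y : R) :
  quad_form s (fun i j => X 0 i * w 0 j + w 0 i * X 0 j
      - x * (e1 0 i * e1 0 j - e2 0 i * e2 0 j)
      - y * (e1 0 i * e2 0 j + e2 0 i * e1 0 j)) X
  = 2 * '[X, X] * '[w, X] - x * ('[e1, X] ^+ 2 - '[e2, X] ^+ 2)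
    - 2 * y * '[e1, X] * '[e2, X].
Proof.
transitivity (quad_form s (fun i j => X 0 i * w 0 j + (w 0 i * X 0 j
      + ((- x) * (e1 0 i * e1 0 j) + (x * (e2 0 i * e2 0 j)
      + ((- y) * (e1 0 i * e2 0 j) + (- y) * (e2 0 i * e1 0 j)))))) X).
  by apply: eq_bigr => i _; apply: eq_bigr => j _; congr (_ * _); ring.
rewrite !quad_formD !quad_formZ !quad_form_mul; ring.
Qed.

Lemma torus_set_mem : '[X, X] = 1 -> '[X, e1] = 0 -> '[X, e2] = 0 ->
  '[p, X] = 0 -> '[r, X] = 0 ->
  (forall i j, span_mx L i j = X 0 i * X 0 j + e1 0 i * e1 0 j
    + e2 0 i * e2 0 j + p 0 i * p 0 j + r 0 i * r 0 j) ->
  (forall i j k l, sign_mx L i j * sign_mx L k l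
  = (X 0 i * p 0 j + p 0 i * X 0 j - al * (e1 0 i * e1 0 j - e2 0 i * e2 0 j)
      - be * (e1 0 i * e2 0 j + e2 0 i * e1 0 j))
    * (X 0 k * p 0 l + p 0 k * X 0 l - al * (e1 0 k * e1 0 l - e2 0 k * e2 0 l)
      - be * (e1 0 k * e2 0 l + e2 0 k * e1 0 l))
  + (X 0 i * r 0 j + r 0 i * X 0 j - be * (e1 0 i * e1 0 j - e2 0 i * e2 0 j)
      - ga * (e1 0 i * e2 0 j + e2 0 i * e1 0 j))
    * (X 0 k * r 0 l + r 0 k * X 0 l - be * (e1 0 k * e1 0 l - e2 0 k * e2 0 l)
      - ga * (e1 0 k * e2 0 l + e2 0 k * e1 0 l))) ->
  torus_set s L X.
Proof.
move=> XX Xe1 Xe2 pX rX spanL signL.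
have [e1X e2X] : '[e1, X] = 0 /\ '[e2, X] = 0 by rewrite !(dotC _ _ X).
split=> //.
  apply/rowP => i; rewrite span_mx_sum.
  under eq_bigr => j _ do rewrite spanL !mulrDl -!mulrA.
  rewrite !big_split /= -!big_distrr /= -!dot_lower XX e1X e2X pX rX.
  by rewrite !mulr0 !addr0 mulr1.
apply/eqP; rewrite -sqrf_eq0 -quad_form_sign_mx.
rewrite (quad_form_square _ _ signL) !quad_form_exchange XX e1X e2X pX rX.
by apply/eqP; ring.
Qed.

End TorusMembership.

(** * Local form of the surfaces with a 1-type Gauss map *)

Section Evaluation.
Context (R : realType) (n s : nat) (P : patch R n s) (a : 'rV[R]_2).
Notation U := (patch_region P).
Notation A := (sfun U).
Notation "''[' u , v ]" := (dot s u v) (format "''[' u ,  v ]").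
Hypothesis Ua : U a.
Variables X e1 e2 p r : 'rV[A]_n.

Lemma patch_dot (y z : 'rV[A]_n) : '[at_pt a y, at_pt a z] = '[y, z] a.
Proof. by rewrite dot_at_pt. Qed.

Lemma patch_dot1 (y z : 'rV[A]_n) : '[y, z] = 1 -> '[at_pt a y, at_pt a z] = 1.
Proof. by move=> H; rewrite patch_dot H sf_1E. Qed.

Lemma patch_dot0 (y z : 'rV[A]_n) : '[y, z] = 0 -> '[at_pt a y, at_pt a z] = 0.
Proof. by move=> H; rewrite patch_dot H sf_0E. Qed.

Lemma patch_expansion4 (z w : 'rV[A]_n) :
  z = '[z, X] *: X + '[z, e1] *: e1 + '[z, e2] *: e2 + '[z, w] *: w ->
  at_pt a z = '[at_pt a z, at_pt a X] *: at_pt a X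
    + '[at_pt a z, at_pt a e1] *: at_pt a e1
    + '[at_pt a z, at_pt a e2] *: at_pt a e2
    + '[at_pt a z, at_pt a w] *: at_pt a w.
Proof. by move=> zE; rewrite !patch_dot {1}zE !at_ptD // !at_ptZ. Qed.

Lemma patch_dot_comb0 (v : 'rV[R]_n) (f g : A) (y z : 'rV[A]_n) :
  '[v, at_pt a y] = 0 -> '[v, at_pt a z] = 0 ->
  '[v, at_pt a (f *: y + g *: z)] = 0.
Proof.
by move=> y0 z0; rewrite at_ptD // !at_ptZ // dotDr !dotZr y0 z0 !mulr0 addr0.
Qed.

(** The first integrals for arbitrary rows in place of the second fundamental form:
    its nested derivatives would be unfolded when values at a are compared. *)
Definition span_form_of (i j : 'I_n) : A :=
  X 0 i * X 0 j + e1 0 i * e1 0 j + e2 0 i * e2 0 j + p 0 i * p 0 j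
  + r 0 i * r 0 j.

Definition exchange_of (w : 'rV[A]_n) (x y : A) (i j : 'I_n) : A :=
  X 0 i * w 0 j + w 0 i * X 0 j - x * (e1 0 i * e1 0 j - e2 0 i * e2 0 j)
  - y * (e1 0 i * e2 0 j + e2 0 i * e1 0 j).

Definition exchange_square_of (i j k l : 'I_n) : A :=
  exchange_of p '[p, p] '[p, r] i j * exchange_of p '[p, p] '[p, r] k l
  + exchange_of r '[p, r] '[r, r] i j * exchange_of r '[p, r] '[r, r] k l.

Let atE := (fun f g : A => sf_addE f g Ua, fun f : A => sf_oppE f Ua,
  fun f g : A => sf_mulE f g Ua).

Lemma span_form_ofE i j : span_form_of i j a =
  at_pt a X 0 i * at_pt a X 0 j + at_pt a e1 0 i * at_pt a e1 0 j
  + at_pt a e2 0 i * at_pt a e2 0 j + at_pt a p 0 i * at_pt a p 0 j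
  + at_pt a r 0 i * at_pt a r 0 j.
Proof. by rewrite /span_form_of !atE !mxE. Qed.

Lemma exchange_ofE w x y i j : exchange_of w x y i j a =
  at_pt a X 0 i * at_pt a w 0 j + at_pt a w 0 i * at_pt a X 0 j
  - x a * (at_pt a e1 0 i * at_pt a e1 0 j - at_pt a e2 0 i * at_pt a e2 0 j)
  - y a * (at_pt a e1 0 i * at_pt a e2 0 j + at_pt a e2 0 i * at_pt a e1 0 j).
Proof. by rewrite /exchange_of !atE !mxE. Qed.

Lemma patch_basis : '[X, X] = 1 -> '[e1, e1] = 1 -> '[e2, e2] = 1 ->
  '[X, e1] = 0 -> '[X, e2] = 0 -> '[e1, e2] = 0 ->
  normal s X e1 e2 p -> normal s X e1 e2 r -> '[p, p] + '[r, r] = 1 ->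
  '[p, p] *: r = '[p, r] *: p -> '[p, r] *: r = '[r, r] *: p ->
  exists L : 'I_4 -> 'rV[R]_n, [/\ orthonormal4 s L,
    forall i j, span_mx L i j = span_form_of i j a &
    forall i j k l, sign_mx L i j * sign_mx L k l = exchange_square_of i j k l a].
Proof.
move=> XX e11 e22 Xe1 Xe2 e12 [pX p1 p2] [rX r1 r2] k1 w1 w2.
have np : normal s (at_pt a X) (at_pt a e1) (at_pt a e2) (at_pt a p).
  by split; exact: patch_dot0.
have nr : normal s (at_pt a X) (at_pt a e1) (at_pt a e2) (at_pt a r).
  by split; exact: patch_dot0.
have {}w1 := congr1 (at_pt a) w1; have {}w2 := congr1 (at_pt a) w2.
have {}k1 := congr1 (fun f : A => f a) k1.
rewrite !at_ptZ // in w1 w2; rewrite sf_addE // sf_1E // in k1.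
have [L [oL spanL signL]] := adapted_basis (patch_dot1 XX) (patch_dot1 e11)
  (patch_dot1 e22) (patch_dot0 Xe1) (patch_dot0 Xe2) (patch_dot0 e12) np nr
  (patch_dot p p) (patch_dot p r) (patch_dot r r) k1 w1 w2.
exists L; split=> // [i j|i j k l]; first by rewrite span_form_ofE.
by rewrite /exchange_square_of (sf_addE _ _ Ua) !(sf_mulE _ _ Ua) !exchange_ofE.
Qed.

Lemma patch_torus_mem (L : 'I_4 -> 'rV[R]_n) :
  '[X, X] = 1 -> '[X, e1] = 0 -> '[X, e2] = 0 ->
  normal s X e1 e2 p -> normal s X e1 e2 r ->
  (forall i j, span_mx L i j = span_form_of i j a) ->
  (forall i j k l, sign_mx L i j * sign_mx L k l = exchange_square_of i j k l a) ->
  torus_set s L (at_pt a X).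
Proof.
move=> XX Xe1 Xe2 [pX _ _] [rX _ _] spanL signL.
apply: (torus_set_mem (patch_dot1 XX) (patch_dot0 Xe1) (patch_dot0 Xe2)
  (patch_dot0 pX) (patch_dot0 rX) (al := '[p, p] a) (be := '[p, r] a)
  (ga := '[r, r] a)) => [i j|i j k l]; first by rewrite spanL span_form_ofE.
by rewrite signL /exchange_square_of (sf_addE _ _ Ua) !(sf_mulE _ _ Ua)
  !exchange_ofE.
Qed.

End Evaluation.

Section PatchClifford.
Context (R : realType) (n s : nat) (P : patch R n s).
Notation U := (patch_region P).
Notation F := (patch_fun P).
Notation A := (sfun U).
Notation X := (patchX P).
Notation e1 := (patch_e1 P).
Notation e2 := (patch_e2 P).
Notation E1 := (gsE1 (@patch_d _ _ _ P) (patch_rho1 P)).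
Notation E2 := (gsE2 s (@patch_d _ _ _ P) (patch_rho1 P) (patch_rho2 P) X).
Notation fr := (patch_frame P).
Notation h11 := (sff11 s E1 X e1 e2).
Notation h12 := (sff12 s E1 e1 e2).
Notation "''[' u , v ]" := (dot s u v) (format "''[' u ,  v ]").
Implicit Types (a b : 'rV[R]_2).

Lemma patch_locally_cst (f : A) a : U a -> E1 f = 0 -> E2 f = 0 ->
  \forall b \near a, f b = f a.
Proof.
move=> Ua f1 f2; apply: sf_locally_cst => //.
  have -> : (0 : 'I_2) = ord0 by exact: val_inj.
  have := coord_d0 (d := @patch_d _ _ _ P) (sf_invsqrtP (patch_g00 (P := P))) f.
  by rewrite f1 mulr0.
have -> : (1 : 'I_2) = lift ord0 ord0 by exact: val_inj.
have := coord_d1 (sf_invsqrtP (patch_g00 (P := P)))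
  (sf_invsqrtP (patch_det (P := P))) f.
by rewrite f1 f2 !mulr0 addr0.
Qed.

Lemma patch_E1_cst c : E1 (sf_cst U c) = 0.
Proof. by rewrite /gsE1 /patch_d sf_der_cst mulr0. Qed.

Lemma patch_E2_cst c : E2 (sf_cst U c) = 0.
Proof. by rewrite /gsE2 /patch_d !sf_der_cst !mulr0 addr0. Qed.

Lemma sf_cst_mul (R' : realType) (V : region R') (c d : R') :
  sf_cst V c * sf_cst V d = sf_cst V (c * d).
Proof. by apply: sfun_eq => a Ua; rewrite sf_mulE // !sf_cstE. Qed.

Lemma near_all (I : finType) (f : I -> 'rV[R]_2 -> Prop) a :
  (forall i, \forall b \near a, f i b) -> \forall b \near a, forall i, f i b.
Proof. exact: (@filter_forall _ _ _ _ (nbhs_filter a)). Qed.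

Section OneType.
Variable l : R.
Hypothesis l0 : l != 0.
Hypothesis eigen : forall i j k, frame_laplacian s E1 E2 e1 e2
  (minor3 i j k X e1 e2) = - sf_cst U l * minor3 i j k X e1 e2.

Let h22E := one_type_h22 fr eigen.
Let wedge := one_type_wedge fr eigen.

Let kappaE : sff_half_norm s E1 X e1 e2 = sf_cst U (l / 2).
Proof.
have := one_type_norm fr eigen; rewrite /sff_norm h22E dotNl dotNr opprK => H.
have <- : patch_half P * sf_cst U l = sf_cst U (l / 2).
  by rewrite /patch_half sf_cst_mul mulrC.
rewrite H /sff_half_norm; move: (sff11 _ _ _ _ _) (sff12 _ _ _ _) => p r.
rewrite -[LHS]mul1r -(patch_halfE P); ring.
Qed.

Let E1kappa : E1 (sff_half_norm s E1 X e1 e2) = 0.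
Proof. by rewrite kappaE patch_E1_cst. Qed.
Let E2kappa : E2 (sff_half_norm s E1 X e1 e2) = 0.
Proof. by rewrite kappaE patch_E2_cst. Qed.
Let kappa_reg f : sff_half_norm s E1 X e1 e2 * f = 0 -> f = 0.
Proof.
rewrite kappaE => H; apply: sfun_eq => a Ua; rewrite sf_0E.
have := congr1 (fun f : A => f a) H; rewrite sf_mulE // sf_cstE // sf_0E => /eqP.
by rewrite mulf_eq0 mulf_eq0 (negPf l0) invr_eq0 pnatr_eq0 /= => /eqP.
Qed.

(** The torus of the basis adapted to the surface at a has the same forms as the
    first integrals at a, hence, as these are locally constant, at all near points;
    and the position vector satisfies the equations of those forms. *)
Lemma patch_one_type a : U a -> exists2 L : 'I_4 -> 'rV[R]_n, orthonormal4 s L &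
  \forall b \near a, torus_set s L (F b).
Proof.
move=> Ua.
have kappa1 := sff_half_norm1 fr h22E wedge E1kappa E2kappa kappa_reg.
have [L [oL spanL signL]] := patch_basis Ua (sphereX fr) (frame11 fr)
  (frame22 fr) (dot_Xe1 fr) (dot_Xe2 fr) (frame12 fr) (normal_h11 fr)
  (normal_h12 fr) kappa1 (wedge_row_h11 wedge) (wedge_row_h12 wedge).
exists L => //.
have near_span : \forall b \near a, forall i j,
    span_form_of X e1 e2 h11 h12 i j b = span_form_of X e1 e2 h11 h12 i j a.
  apply: near_all => i; apply: near_all => j.
  exact: (patch_locally_cst Ua
    (E1_span_form fr h22E wedge E1kappa E2kappa kappa_reg i j)
    (E2_span_form fr h22E wedge E1kappa E2kappa kappa_reg i j)).
have near_sign : \forall b \near a, forall i j k l,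
    exchange_square_of X e1 e2 h11 h12 i j k l b
    = exchange_square_of X e1 e2 h11 h12 i j k l a.
  apply: near_all => i; apply: near_all => j.
  apply: near_all => k; apply: near_all => l'.
  exact: (patch_locally_cst Ua
    (E1_exchange_square fr h22E wedge E1kappa E2kappa kappa_reg i j k l')
    (E2_exchange_square fr h22E wedge E1kappa E2kappa kappa_reg i j k l')).
have near_U : \forall b \near a, U b.
  exact: open_nbhs_nbhs (conj (region_open U) Ua).
apply: filterS3 near_U near_span near_sign => b Ub spanb signb.
rewrite -at_patchX //.
apply: (patch_torus_mem Ub (sphereX fr) (dot_Xe1 fr) (dot_Xe2 fr)
  (normal_h11 fr) (normal_h12 fr)) => [i j|i j k l'].
  by rewrite spanb; apply: spanL.
by rewrite signb; apply: signL.
Qed.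

End OneType.

(** ** Patches in a Clifford torus *)

Section InTorus.
Variable L : 'I_4 -> 'rV[R]_n.
Hypothesis oL : orthonormal4 s L.
Hypothesis inT : forall a, U a -> torus_set s L (F a).

Definition cst_row (y : 'rV[R]_n) : 'rV[A]_n := map_mx (sf_cst U) y.

Lemma at_cst_row a y : U a -> at_pt a (cst_row y) = y.
Proof. by move=> Ua; apply/rowP => i; rewrite !mxE sf_cstE. Qed.

Lemma der_cst_row y :
  map_mx E1 (cst_row y) = 0 /\ map_mx E2 (cst_row y) = 0.
Proof.
by split; apply/rowP => i; rewrite !mxE ?patch_E1_cst ?patch_E2_cst.
Qed.

Lemma dot_cst_row y z : '[cst_row y, cst_row z] = sf_cst U '[y, z].
Proof.
by apply: sfun_eq => a Ua; rewrite -patch_dot // !at_cst_row // sf_cstE.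
Qed.

Let LA k := cst_row (L k).

Let orthoLA i j : '[LA i, LA j] = (i == j)%:R.
Proof.
rewrite dot_cst_row oL; apply: sfun_eq => a Ua; rewrite sf_cstE //.
by case: (i == j); rewrite ?sf_1E ?sf_0E.
Qed.

Let constLA k := der_cst_row (L k).

Lemma at_sum a I (r : seq I) (Q : pred I) (f : I -> 'rV[A]_n) : U a ->
  at_pt a (\sum_(i <- r | Q i) f i) = \sum_(i <- r | Q i) at_pt a (f i).
Proof.
move=> Ua; elim/big_rec2: _ => [|i y1 y2 _ <-]; last by rewrite at_ptD.
by apply/rowP => i; rewrite !mxE sf_0E.
Qed.

Lemma at_pt_inj (y z : 'rV[A]_n) :
  (forall a, U a -> at_pt a y = at_pt a z) -> y = z.
Proof.
move=> yz; apply/rowP => i; apply: sfun_eq => a Ua.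
by rewrite -!at_ptE yz.
Qed.

Let dotXL a k : U a -> '[X, LA k] a = '[F a, L k].
Proof. by move=> Ua; rewrite -patch_dot // at_patchX // at_cst_row. Qed.

Let spanX : in_span s LA X.
Proof.
apply: at_pt_inj => a Ua; rewrite at_patchX // at_sum //.
have [Fa _ _] := inT Ua; rewrite {1}Fa; apply: eq_bigr => k _.
by rewrite at_ptZ // at_cst_row // dotXL.
Qed.

Lemma torus_sign_at a k : U a -> torus_sign A k a = torus_sign R k.
Proof.
move=> Ua; rewrite /torus_sign; case: ifP => _; first exact: sf_1E.
by rewrite sf_oppE // sf_1E.
Qed.

Let torusX : '[X, reflect s LA X] = 0.
Proof.
rewrite dotC dot_reflectl; apply: sfun_eq => a Ua; rewrite sf_0E.
have [_ _ <-] := inT Ua; rewrite sf_sumE //; apply: eq_bigr => k _.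
by rewrite !sf_mulE // torus_sign_at // dotXL // -mulrA.
Qed.

Lemma patch_torus_laplacian i j k :
  frame_laplacian s E1 E2 e1 e2 (minor3 i j k X e1 e2)
  = - 2 * minor3 i j k X e1 e2.
Proof. exact: (clifford_torus_laplacian fr orthoLA constLA spanX torusX). Qed.

Lemma patch_torus_full y : (forall a, U a -> '[F a, y] = 0) ->
  forall k, '[L k, y] = 0.
Proof.
move=> Fy k; have [a Ua] := region_ne U; have [y1 y2] := der_cst_row y.
have Xy : '[X, cst_row y] = 0.
  apply: sfun_eq => b Ub; rewrite -patch_dot // at_patchX // at_cst_row //.
  by rewrite Fy // sf_0E.
have := clifford_torus_full fr orthoLA constLA spanX torusX k y1 y2 Xy.
move=> /(congr1 (fun f : A => f a)).
by rewrite -patch_dot // !at_cst_row // sf_0E.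
Qed.

Lemma at_reflect a : U a ->
  at_pt a (reflect s LA X) = reflect s L (F a).
Proof.
move=> Ua; rewrite /reflect -!lock at_sum //; apply: eq_bigr => k _.
by rewrite at_ptZ // at_cst_row // sf_mulE // torus_sign_at // dotXL.
Qed.

(** X, e1, e2 and the normal in the 3-sphere are an orthonormal basis of the 4-space,
    and the products of z with e1 and e2 vanish. *)
Lemma patch_torus_expansion a z : U a -> z = \sum_k '[z, L k] *: L k ->
  (forall v, '[z, 'D_v F a] = 0) ->
  z = '[z, F a] *: F a + '[z, reflect s L (F a)] *: reflect s L (F a).
Proof.
move=> Ua zs zD; have zA : in_span s LA (cst_row z).
  apply: at_pt_inj => b Ub; rewrite at_cst_row // at_sum // {1}zs.
  apply: eq_bigr => k _; rewrite at_ptZ // at_cst_row //.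
  by rewrite dot_cst_row sf_cstE.
have := patch_expansion4 Ua
  (clifford_torus_expansion fr orthoLA constLA spanX torusX zA).
move: (at_cst_row z Ua) (at_patchX Ua) => zE XE; rewrite zE XE.
have D0 i : '[z, at_pt a (map_mx (patch_d (P := P) i) X)] = 0.
  by rewrite at_patch_der.
have z1 : '[z, at_pt a e1] = 0.
  have -> : e1 = patch_rho1 P *: map_mx (patch_d (P := P) ord0) X
      + 0 *: map_mx (patch_d (P := P) ord0) X by rewrite scale0r addr0.
  exact: (patch_dot_comb0 Ua _ _ (D0 _) (D0 _)).
have z2 : '[z, at_pt a e2] = 0 := patch_dot_comb0 Ua _ _ (D0 _) (D0 _).
rewrite z1 z2.
by rewrite !scale0r !addr0 at_reflect.
Qed.

Lemma patch_torus_span i j : span_form s E1 X e1 e2 i j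
  = sf_cst U (span_mx L i j).
Proof.
rewrite (clifford_span_form fr orthoLA constLA spanX torusX).
apply: sfun_eq => a Ua; rewrite sf_cstE // sf_sumE //.
by apply: eq_bigr => k _; rewrite sf_mulE // !mxE !sf_cstE.
Qed.

Lemma patch_torus_sign i j k l : exchange_square s E1 X e1 e2 i j k l
  = sf_cst U (sign_mx L i j * sign_mx L k l).
Proof.
rewrite (clifford_exchange_square fr orthoLA constLA spanX torusX).
apply: sfun_eq => a Ua; rewrite sf_cstE // sf_mulE // !sf_sumE //.
by congr (_ * _); apply: eq_bigr => h _; rewrite !sf_mulE // !mxE
  torus_sign_at // !sf_cstE.
Qed.

End InTorus.

(** Both forms of the torus are values of the first integrals of the patch. *)
Lemma patch_torus_unique L L' : orthonormal4 s L -> orthonormal4 s L' ->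
  (forall a, U a -> torus_set s L (F a)) ->
  (forall a, U a -> torus_set s L' (F a)) -> torus_set s L = torus_set s L'.
Proof.
move=> oL oL' inT inT'; have [a Ua] := region_ne U.
apply: torus_set_forms => [i j|i j k l].
  have := etrans (esym (patch_torus_span oL inT i j)) (patch_torus_span oL' inT' i j).
  by move=> /(congr1 (fun f : A => f a)); rewrite !sf_cstE.
have := etrans (esym (patch_torus_sign oL inT i j k l))
  (patch_torus_sign oL' inT' i j k l).
by move=> /(congr1 (fun f : A => f a)); rewrite !sf_cstE.
Qed.

End PatchClifford.

(** * Patches of a Clifford torus are open in it *)

Section RowNorm.
Context (R : realType) (n s : nat).
Implicit Types u v : 'rV[R]_n.

Lemma coord_norm u i : `|u 0 i| <= `|u|.
Proof.
rewrite [leRHS]/Num.Def.normr /= mx_normrE.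
exact: (le_bigmax _ (fun ij => `|u ij.1 ij.2|) (0, i)).
Qed.

Lemma dot_norm u v : `|dot s u v| <= n%:R * (`|u| * `|v|).
Proof.
rewrite /dot (le_trans (ler_norm_sum _ _ _)) //.
apply: (@le_trans _ _ (\sum_(i < n) `|u| * `|v|)); last first.
  by rewrite sumr_const card_ord mulr_natl.
apply: ler_sum => i _; rewrite !normrM normrX normrN normr1 expr1n mul1r.
by rewrite ler_pM // coord_norm.
Qed.

Lemma norm_row_le u (c : R) : 0 <= c -> (forall i, `|u 0 i| <= c) -> `|u| <= c.
Proof.
move=> c0 uc; rewrite [leLHS]/Num.Def.normr /= mx_normrE.
by apply: bigmax_le => // -[i j] _ /=; rewrite ord1.
Qed.

Lemma mulmx_norm m (K : 'M[R]_(n, m)) :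
  exists2 C : R, 0 < C & forall u, `|u *m K| <= C * `|u|.
Proof.
pose C : R := 1 + \sum_i \sum_j `|K i j|.
have C0 : 0 < C.
  by rewrite ltr_pwDl // sumr_ge0 // => i _; rewrite sumr_ge0.
exists C => // u; rewrite [leLHS]/Num.Def.normr /= mx_normrE.
apply: bigmax_le; first by rewrite mulr_ge0 // ltW.
move=> [i0 j] _ /=; rewrite ord1 mxE (le_trans (ler_norm_sum _ _ _)) //.
rewrite mulrC mulrDr mulr1 ler_wpDl // mulr_sumr; apply: ler_sum => i _.
rewrite normrM ler_pM // ?coord_norm //.
by rewrite (bigD1 j) //= lerDl sumr_ge0.
Qed.

End RowNorm.

(** The differential has a left inverse and so is bounded below by a multiple of the
    norm of h, while F (a + h) = F a would make it o(h). *)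
Lemma locally_injective_at (R : realType) (m n : nat)
    (F : 'rV[R]_m -> 'rV[R]_n) a :
  differentiable F a -> (forall h, h != 0 -> 'D_h F a != 0) ->
  \forall b \near a, F b = F a -> b = a.
Proof.
move=> dF inj; pose M : 'M[R]_(m, n) := lin1_mx ('d F a).
have ME h : h *m M = 'd F a h by rewrite mul_rV_lin1.
have freeM : row_free M.
  apply: inj_row_free => h; rewrite ME => h0; apply/eqP.
  by apply: contraT => /inj; rewrite deriveE // h0 eqxx.
have [C C0 CP] := mulmx_norm (pinvmx M).
have [_ /eqaddoP/(_ (C * 2)^-1)] := (diff_locallyP _ _).1 dF.
rewrite invr_gt0 mulr_gt0 // => /(_ isT) small.
apply/nbhs0P; apply: filterS small => h /=; rewrite !fctE /= => small Fh.
apply/eqP; rewrite -subr_eq0 addrC addKr -normr_le0.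
have {}small : `|'d F a h| <= (C * 2)^-1 * `|h|.
  by move: small; rewrite (addrC h) Fh opprD addrA subrr add0r normrN.
have hE : h = 'd F a h *m pinvmx M by rewrite -ME -mulmxA mulmxVp // mulmx1.
have : `|h| <= C * ((C * 2)^-1 * `|h|).
  rewrite {1}hE (le_trans (CP _)) //.
  by rewrite ler_pM2l.
have -> : C * ((C * 2)^-1 * `|h|) = `|h| / 2.
  by field; rewrite gt_eqF.
by move=> H; lra.
Qed.

Lemma interior_max_derive (R : realType) (V : normedModType R) (U : set V)
    (f : V -> R) (a v : V) : open U -> U a ->
  (forall b, U b -> differentiable f b) -> (forall b, U b -> f b <= f a) ->
  'D_v f a = 0.
Proof.
move=> oU Ua df fmax.
have /nbhs_ballP[d /= d0 dU] := open_nbhs_nbhs (conj oU Ua).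
pose e := d / (`|v| + 1); have v1 : 0 < `|v| + 1 by rewrite ltr_wpDl.
have e0 : 0 < e by rewrite divr_gt0.
have inU t : t \in `](- e), e[ -> U (a + t *: v).
  rewrite in_itv /= -ltr_norml => te; apply: dU.
  rewrite -ball_normE /ball_ /= opprD addrA subrr add0r normrN normrZ.
  apply: (@le_lt_trans _ _ (`|t| * (`|v| + 1))).
    by rewrite ler_wpM2l // lerDl.
  by rewrite -(divfK (lt0r_neq0 v1) d) ltr_pM2r.
have e00 : 0 \in `](- e), e[ by rewrite in_itv /= oppr_lt0 e0.
have dline t : t \in `](- e), e[ ->
    is_derive t (1 : R) (fun t => f (a + t *: v)) ('D_v f (a + t *: v)).
  by move=> te; apply: is_derive_line; apply/df/inU.
have d1 : is_derive (0 : R) (1 : R) (fun t => f (a + t *: v)) 0.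
  apply: (@derive1_at_max R _ (- e) e 0) => //.
  - by rewrite ge0_cp // ltW.
  - by move=> t te; have [] := dline t te.
  - by move=> t te; rewrite scale0r addr0; apply/fmax/inU.
have d2 := dline 0 e00; rewrite scale0r addr0 in d2.
by rewrite -(@derive_val _ _ _ _ _ _ _ d2) (@derive_val _ _ _ _ _ _ _ d1).
Qed.

Section TorusPatchOpen.
Context (R : realType) (n s : nat) (P : patch R n s).
Notation U := (patch_region P).
Notation F := (patch_fun P).
Notation "''[' u , v ]" := (dot s u v) (format "''[' u ,  v ]").
Variable L : 'I_4 -> 'rV[R]_n.
Hypothesis oL : orthonormal4 s L.
Hypothesis inT : forall a, U a -> torus_set s L (F a).
Implicit Types (a b : 'rV[R]_2) (z : 'rV[R]_n).

Let oU := region_open U.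

Lemma span_dot w : w = \sum_k '[w, L k] *: L k ->
  '[w, w] = \sum_k '[w, L k] ^+ 2.
Proof.
move=> wE; rewrite {1}wE dot_suml; apply: eq_bigr => k _.
by rewrite dotZl (dotC _ (L k)).
Qed.

Lemma span_dot_gt0 w : w = \sum_k '[w, L k] *: L k -> w != 0 -> 0 < '[w, w].
Proof.
move=> wE; apply: contraNT; rewrite -leNgt span_dot // => w0.
have sq0 k : true -> 0 <= '[w, L k] ^+ 2 by rewrite sqr_ge0.
have : \sum_k '[w, L k] ^+ 2 == 0 by rewrite eq_le w0 sumr_ge0.
rewrite psumr_eq0 // => /allP w00.
apply/eqP; rewrite wE big1 // => k _.
have /implyP := w00 k (mem_index_enum k); rewrite sqrf_eq0 => /(_ isT)/eqP ->.
by rewrite scale0r.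
Qed.

Definition pairing z : sfun U := '[patchX P, cst_row P z].

Lemma pairingE z a : U a -> pairing z a = '[F a, z].
Proof. by move=> Ua; rewrite -patch_dot // at_patchX // at_cst_row. Qed.

Lemma pairing_continuous z a : U a -> {for a, continuous (pairing z)}.
Proof. exact: smooth_continuous (sfun_smooth _). Qed.

Lemma pairing_derive z a v : U a -> 'D_v (pairing z) a = '['D_v F a, z].
Proof.
move=> Ua; rewrite -sf_derE // (der_dot _ _ _ (sf_derivation U v)).
have -> : map_mx (sf_der v) (cst_row P z) = 0.
  by apply/rowP => i; rewrite !mxE sf_der_cst.
by rewrite dot0r addr0 -patch_dot // at_patch_der // at_cst_row.
Qed.

(** At a critical point z is orthogonal to the tangent plane, hence z is a combination
    x X + y eta with x > 0. The equation of the torus gives 2 x y = 0, and then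
    x = 1. *)
Lemma torus_critical a z : U a -> torus_set s L z -> 0 < '[F a, z] ->
  (forall v, '['D_v F a, z] = 0) -> F a = z.
Proof.
move=> Ua [zs z1 z0] pos crit; have [Fs F1 F0] := inT Ua.
set y := '[z, reflect s L (F a)].
have zE : z = '[z, F a] *: F a + y *: reflect s L (F a).
  by apply: (patch_torus_expansion oL inT Ua zs) => v; rewrite dotC.
set x := '[z, F a] in zE.
have x0 : 0 < x by rewrite /x dotC.
have z0' : '[z, reflect s L z] = 0.
  rewrite -dot_reflectC dot_reflectl -[RHS]z0.
  by apply: eq_bigr => k _; rewrite -mulrA -expr2.
have : '[z, reflect s L z] = 2 * x * y.
  rewrite {1}zE dotDl !dotZl -dot_reflectC (dotC _ _ z) -/y.
  by rewrite dot_reflectC reflectK // (dotC _ (F a) z) -/x; ring.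
rewrite z0' => /esym/eqP; rewrite mulf_eq0 mulf_eq0 pnatr_eq0 /= (gt_eqF x0) /=.
move=> /eqP y0; have : '[z, z] = x ^+ 2.
  by rewrite {1}zE y0 scale0r addr0 dotZl (dotC _ (F a) z) expr2.
rewrite z1 => /esym/eqP; rewrite sqrf_eq1 => /orP[/eqP x1|/eqP x1].
  by rewrite [RHS]zE y0 x1 scale0r addr0 scale1r.
by move: x0; rewrite x1 ltr0N1.
Qed.

Lemma within_continuous (V : topologicalType) (B : set 'rV[R]_2)
    (f : 'rV[R]_2 -> V) : (forall a, B a -> {for a, continuous f}) ->
  {within B, continuous f}.
Proof.
by move=> cf; apply: continuous_in_subspaceT => a; rewrite inE => /cf.
Qed.

Lemma norm_level_compact a (d : R) (Q : set R) : closed Q ->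
  (forall x, Q x -> x <= d) -> compact [set b : 'rV[R]_2 | Q `|b - a|].
Proof.
move=> cQ Qd; apply: bounded_closed_compact.
  exists (`|a| + d); split; first exact: num_real.
  move=> x dx b /= /Qd bd; rewrite (le_trans _ (ltW dx)) //.
  by rewrite -[b in `|b|](subrK a) addrC (le_trans (ler_normD _ _)) // lerD2l.
rewrite -[X in closed X]/((fun b => `|b - a|) @^-1` Q).
apply: preimage_closed => // b _ /=.
apply: (@continuous_comp _ _ _ (fun b => b - a) Num.Def.normr).
  exact: (@differentiable_continuous _ _ _ b (fun b => b - a)).
exact: (@norm_continuous _ _ (b - a)).
Qed.

(** For z close to F a the function b |-> <F b, z> attains its maximum over a
    small closed ball in the interior, as it does for z = F a; the maximum is a
    critical point, and so it is mapped to z. *)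
Lemma torus_patch_open a : U a -> exists2 r : R, 0 < r &
  forall z, torus_set s L z -> `|z - F a| < r -> exists2 b, U b & F b = z.
Proof.
move=> Ua; have inj : \forall b \near a, F b = F a -> b = a.
  apply: locally_injective_at.
    exact: smooth_differentiable (patch_smooth P) Ua.
  move=> h /(patch_spacelike P Ua); apply: contraTneq => ->.
  by rewrite -[inner _ _ _]/(dot s _ _) dot0l ltxx.
have near2 : nbhs a (U `&` [set b | F b = F a -> b = a]).
  by apply: filterI => //; exact: open_nbhs_nbhs.
move/nbhs_ballP: near2 => [d' /= d'0 dU].
pose d := d' / 2; have d0 : 0 < d by rewrite divr_gt0.
have dd' : d < d' by rewrite /d ltr_pdivrMr // ltr_pMr // ltr1n.
have ballU b : `|b - a| <= d -> U b /\ (F b = F a -> b = a).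
  move=> bd; apply: dU; rewrite -ball_normE /ball_ /= distrC.
  exact: le_lt_trans bd dd'.
pose B := [set b | `|b - a| <= d]; pose Sph := [set b | `|b - a| = d].
have cB : compact B by apply: (@norm_level_compact a d [set x | x <= d]).
have cS : compact Sph.
  apply: (@norm_level_compact a d [set x | x = d]); first exact: closed_eq.
  by move=> x ->.
have Ba : B a by rewrite /B /= subrr normr0 ltW.
have Sne : Sph !=set0.
  exists (a + const_mx d); rewrite /Sph /= addrC addKr.
  apply/eqP; rewrite eq_le; apply/andP; split.
    by apply: norm_row_le => [|i]; [exact: ltW|rewrite mxE gtr0_norm].
  by have := coord_norm (const_mx d : 'rV[R]_2) 0; rewrite mxE gtr0_norm.
have UB b : B b -> U b by move=> /ballU[].
have [c cS0 cmax] : exists2 c, c \in Sph & forall t, t \in Sph ->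
    pairing (F a) t <= pairing (F a) c.
  apply: EVT_max_rV => //; apply: within_continuous => b bd.
  by apply: pairing_continuous; apply: UB; rewrite /B /= bd.
have [k kB kmax] : exists2 k, k \in B & forall t, t \in B -> `|F t| <= `|F k|.
  apply: EVT_max_rV => //; first by exists a.
  apply: within_continuous => b bd.
  apply: (@continuous_comp _ _ _ F Num.Def.normr).
    exact: smooth_continuous (patch_smooth P) (UB _ bd).
  exact: (@norm_continuous _ _ (F b)).
have cd : `|c - a| = d by rewrite inE in cS0.
have Uc : U c by apply: UB; rewrite /B /= cd.
have Fca : F c - F a != 0.
  rewrite subr_eq0; apply/eqP => Fca.
  have [_ /(_ Fca) ca] : U c /\ (F c = F a -> c = a) by apply: ballU; rewrite cd.
  by move: d0; rewrite -cd ca subrr normr0 ltxx.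
pose mu := '[F c, F a].
have mu1 : mu < 1.
  have ws : F c - F a = \sum_k '[F c - F a, L k] *: L k.
    have [Fc _ _] := inT Uc; have [Fa _ _] := inT Ua; rewrite {1}Fc {1}Fa.
    by rewrite -sumrB; apply: eq_bigr => i _; rewrite dotBl scalerBl.
  have := span_dot_gt0 ws Fca; rewrite !dotE.
  have [_ -> _] := inT Uc; have [_ -> _] := inT Ua.
  by rewrite (dotC _ (F a) (F c)) -/mu; lra.
(* On the sphere of radius d the product with F a is at most mu < 1, and it is 1 at
   a. The bound e is small enough for the products with z to keep this order. *)
pose N : R := n%:R * `|F k| + 1.
have N0 : 0 < N by rewrite ltr_wpDl // mulr_ge0.
pose e : R := Num.min ((1 - mu) / 4) 4^-1.
have e0 : 0 < e by rewrite lt_min invr_gt0 ltr0n divr_gt0 // subr_gt0.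
have e1 : e <= (1 - mu) / 4 by rewrite ge_min lexx.
have e2 : e <= 4^-1 by rewrite ge_min lexx orbT.
exists (e / N); first by rewrite divr_gt0.
move=> z zT za.
have close b : B b -> `|'[F b, z] - '[F b, F a]| <= e.
  move=> Bb; rewrite -dotBr (le_trans (dot_norm _ _ _)) //.
  apply: (@le_trans _ _ (N * (e / N))); last first.
    by rewrite mulrC divfK // gt_eqF.
  have nb : n%:R * `|F b| <= N.
    by rewrite /N ler_wpDr // ler_wpM2l // kmax // inE.
  rewrite mulrA; apply: (le_trans (ler_wpM2r (normr_ge0 _) nb)).
  by apply: ler_wpM2l; exact: ltW.
have FaFa : '[F a, F a] = 1 by have [] := inT Ua.
have za0 : 1 - e <= '[F a, z].
  by have := close a Ba; rewrite FaFa ler_distl => /andP[].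
have [b bB bmax] : exists2 b, b \in B & forall t, t \in B ->
    pairing z t <= pairing z b.
  apply: EVT_max_rV => //; first by exists a.
  by apply: within_continuous => b /UB; apply: pairing_continuous.
rewrite inE in bB; have Ub := UB _ bB.
have bz : 1 - e <= '[F b, z].
  apply: (le_trans za0); rewrite -!pairingE //.
  by apply: bmax; rewrite inE.
have bd : `|b - a| < d.
  rewrite lt_neqAle bB andbT; apply/negP => /eqP bS.
  have := cmax b; rewrite inE => /(_ bS); rewrite !pairingE // -/mu => bmu.
  have := close b bB; rewrite ler_distl => /andP[_ H].
  have := e0; lra.
exists b => //; apply: (torus_critical Ub zT); first by have := e0; lra.
move=> v; rewrite -pairing_derive //.
apply: (@interior_max_derive _ _ (ball a d)); first exact: ball_open.
- by rewrite -ball_normE /ball_ /= distrC.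
- move=> t; rewrite -ball_normE /ball_ /= distrC => /ltW /UB Ut.
  exact: smooth_differentiable (sfun_smooth _) Ut.
- move=> t; rewrite -ball_normE /ball_ /= distrC => /ltW Bt.
  by apply: bmax; rewrite inE.
Qed.

End TorusPatchOpen.

(** * Charts as patches *)

Lemma smooth_subset (R : realType) (V W : normedModType R) (U U' : set V)
    (f : V -> W) : U' `<=` U -> smooth U f -> smooth U' f.
Proof.
move=> UU sf k; elim: k f sf => [|k IH] f sf /=.
  by move=> a /UU; apply: smooth_continuous.
split=> [a /UU Ua|v]; first exact: smooth_differentiable sf Ua.
by apply: IH; apply: smooth_derive.
Qed.

Lemma mul_jacobian (R : realType) (m n : nat) (f : 'rV[R]_m -> 'rV[R]_n) a v :
  differentiable f a -> v *m 'J f a = 'D_v f a.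
Proof. by move=> df; rewrite /jacobian mul_rV_lin1 deriveE. Qed.

Lemma jacobian_comp (R : realType) (k m n : nat) (f : 'rV[R]_k -> 'rV[R]_m)
    (h : 'rV[R]_m -> 'rV[R]_n) a : differentiable f a ->
  differentiable h (f a) -> 'J (h \o f) a = 'J f a *m 'J h (f a).
Proof.
move=> df dh; apply/row_matrixP => i; rewrite !rowE mulmxA.
by rewrite /jacobian !mul_rV_lin1 diff_comp.
Qed.

Section Charts.
Context (R : realType) (M : topologicalType).
Implicit Types c d : chart R M.

Definition chart_img c : set 'rV[R]_2 := chart_fun c @` chart_dom c.

Lemma chart_imgP c p : chart_dom c p -> chart_img c (chart_fun c p).
Proof. by exists p. Qed.

Lemma chart_inv_dom c q : chart_img c q -> chart_dom c (chart_inv c q).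
Proof. by move=> [p cp <-]; rewrite chart_funK. Qed.

Lemma chart_invK c q : chart_img c q -> chart_fun c (chart_inv c q) = q.
Proof. by move=> [p cp <-]; rewrite chart_funK. Qed.

Lemma chart_fun_continuous c p : chart_dom c p ->
  {for p, continuous (chart_fun c)}.
Proof.
move=> cp; have := @chart_fun_cont _ _ c.
rewrite (continuous_open_subspace _ (@chart_dom_open _ _ c)) => cf.
by apply: cf; rewrite inE.
Qed.

Lemma chart_inv_continuous c q : chart_img c q ->
  {for q, continuous (chart_inv c)}.
Proof.
move=> cq; have := @chart_inv_cont _ _ c.
rewrite (continuous_open_subspace _ (@chart_img_open _ _ c)) => cf.
by apply: cf; rewrite inE.
Qed.

Lemma chart_dom_nbhs c p : chart_dom c p -> nbhs p (chart_dom c).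
Proof. by move=> cp; apply: open_nbhs_nbhs; split=> //; exact: chart_dom_open. Qed.

Lemma near_chart c p (Q : set M) : chart_dom c p ->
  (\forall q \near chart_fun c p, Q (chart_inv c q)) -> \forall p' \near p, Q p'.
Proof.
move=> cp nearQ; have near1 := @chart_fun_continuous c p cp _ nearQ.
apply: filterS2 (chart_dom_nbhs cp) near1 => p' cp' /=.
by rewrite chart_funK.
Qed.

Lemma near_chart_inv c p (Q : set M) : chart_dom c p -> (\forall p' \near p, Q p') ->
  \forall q \near chart_fun c p, Q (chart_inv c q).
Proof.
move=> cp nearQ; apply: (@chart_inv_continuous c _ (chart_imgP cp)).
by rewrite chart_funK.
Qed.

Lemma chart_img_nbhs c p : chart_dom c p -> nbhs (chart_fun c p) (chart_img c).
Proof.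
move=> cp; apply: open_nbhs_nbhs; split; first exact: chart_img_open.
exact: chart_imgP.
Qed.

End Charts.

Section SurfaceCharts.
Context (R : realType) (m s : nat) (M : oriented_surface R).
Context (x : M -> 'rV[R]_m.+1) (hx : spacelike_surface s x).
Implicit Types (c d : chart R M) (p : M).

Lemma surface_smooth c : atlas c -> smooth (chart_img c) (x \o chart_inv c).
Proof. by move=> ca; have [/(_ c ca)[]] := hx. Qed.

Lemma surface_differentiable c q : atlas c -> chart_img c q ->
  differentiable (x \o chart_inv c) q.
Proof. by move=> /surface_smooth; apply: smooth_differentiable. Qed.

Lemma mul_tangent c q v : atlas c -> chart_img c q ->
  v *m tangent_mx x c q = 'D_v (x \o chart_inv c) q.
Proof. by move=> ca cq; rewrite mul_jacobian //; exact: surface_differentiable. Qed.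

Lemma row_tangent c q i : atlas c -> chart_img c q ->
  row i (tangent_mx x c q) = 'D_(delta_mx 0 i) (x \o chart_inv c) q.
Proof. by move=> ca cq; rewrite rowE mul_tangent. Qed.

Lemma metric_quad c q (v : 'rV[R]_2) :
  (v *m metric s x c q *m v^T) 0 0
  = inner s (v *m tangent_mx x c q) (v *m tangent_mx x c q).
Proof.
set J := tangent_mx x c q.
have vJ : v *m J = \sum_i v 0 i *: row i J by exact: mulmx_sum_row.
rewrite vJ -[inner _ _ _]/(dot s _ _) dot_suml mxE.
under [RHS]eq_bigr => i _ do rewrite dotZl dotC dot_suml.
under [LHS]eq_bigr => j _ do rewrite !mxE big_distrl.
rewrite [LHS]exchange_big; apply: eq_bigr => i _ /=; rewrite big_distrr.
apply: eq_bigr => j _ /=; rewrite mxE -[inner _ _ _]/(dot s _ _) dotZl.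
by rewrite (dotC _ (row j J)); ring.
Qed.

Lemma surface_spacelike c q v : atlas c -> chart_img c q -> v != 0 ->
  0 < inner s ('D_v (x \o chart_inv c) q) ('D_v (x \o chart_inv c) q).
Proof.
move=> ca cq v0; rewrite -!mul_tangent // -metric_quad.
have [_ _ pd] := hx; rewrite -{1}(chart_invK cq).
exact: pd (chart_inv_dom cq) _ v0.
Qed.

Lemma surface_sphere c q : atlas c ->
  inner s ((x \o chart_inv c) q) ((x \o chart_inv c) q) = 1.
Proof. by move=> ca; have [_ + _] := hx; apply. Qed.

Definition sub_patch c (ca : atlas c) (V : region R)
    (VU : V `<=` chart_img c) : patch R m.+1 s :=
  @Patch R m.+1 s V (x \o chart_inv c)
    (smooth_subset VU (surface_smooth ca))
    (fun a _ => surface_sphere a ca)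
    (fun a v Va => surface_spacelike ca (VU a Va)).

Definition chart_region c p (cp : chart_dom c p) : region R :=
  Region (@chart_img_open _ _ c) (ex_intro _ _ (chart_imgP cp)).

Definition chart_patch c p (ca : atlas c) (cp : chart_dom c p) :
  patch R m.+1 s := @sub_patch c ca (chart_region cp) (@subset_refl _ _).

End SurfaceCharts.

(** * The Gauss map and its Laplacian in a chart *)

Definition triple_at (n : nat) (t : triple n) (k : 'I_3) : 'I_n := tnth (val t) k.

Lemma wedge3E (R : realType) (n : nat) (u v w : 'rV[R]_n) (t : triple n) :
  wedge3 u v w t = minor3 (triple_at t 0) (triple_at t 1) (triple_at t ord_max)
    u v w.
Proof.
rewrite /wedge3 ffunE (expand_det_row _ ord0) !big_ord_recl big_ord0 /cofactor.
rewrite !(expand_det_row _ ord0) !big_ord_recl !big_ord0 /cofactor !det_mx11.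
rewrite /minor3 /triple_at; case: t => [[[|i [|j [|k [|l ts]]]] sz] srt] //=.
by rewrite !mxE /= /tnth /= /bump /=; ring.
Qed.

Lemma triple_of (n : nat) (i j k : 'I_n) : (i < j < k)%N ->
  exists t : triple n, [/\ triple_at t 0 = i, triple_at t 1 = j
    & triple_at t ord_max = k].
Proof.
move=> /andP[ij jk]; have srt : sorted ltn (map val [tuple i; j; k]).
  by rewrite /= ij jk.
by exists (Sub [tuple i; j; k] srt).
Qed.

(** Sorting the three indices changes G by a sign. *)
Lemma alternating_ext (A : zmodType) (n : nat) (G : 'I_n -> 'I_n -> 'I_n -> A) :
  (forall i j k, G j i k = - G i j k) -> (forall i j k, G i k j = - G i j k) ->
  (forall i k, G i i k = 0) -> (forall i j k : 'I_n, (i < j < k)%N -> G i j k = 0) ->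
  forall i j k, G i j k = 0.
Proof.
move=> s12 s23 G0 Glt.
have le_case (i j k : 'I_n) : (i <= j <= k)%N -> G i j k = 0.
  rewrite [(i <= j)%N]leq_eqVlt [(j <= k)%N]leq_eqVlt.
  case: (eqVneq (val i) (val j)) => [/val_inj -> _|_] /=; first exact: G0.
  case: (eqVneq (val j) (val k)) => [/val_inj -> _|_] /=.
    by rewrite -[LHS]opprK -s12 -[G _ _ _]opprK -s23 s12 G0 !oppr0.
  exact: Glt.
have swap12 i j k : G i j k = - G j i k by exact: s12.
have swap23 i j k : G i j k = - G i k j by exact: s23.
have neg0 y : y = 0 -> - y = 0 :> A by move=> ->; rewrite oppr0.
move=> i j k.
case: (leqP i j) => ij; case: (leqP j k) => jk; case: (leqP i k) => ik.
- by apply: le_case; rewrite ij jk.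
- by apply: le_case; rewrite ij jk.
- by rewrite swap23; apply/neg0/le_case; rewrite ik ltnW.
- by rewrite swap23 swap12 opprK; apply/le_case; rewrite ij ltnW.
- by rewrite swap12; apply/neg0/le_case; rewrite ik ltnW.
- by rewrite swap12 swap23 opprK; apply/le_case; rewrite jk ltnW.
- rewrite swap12 swap23 swap12; do 3!apply/neg0; apply/le_case.
  by rewrite (ltnW jk) (ltnW ij).
- rewrite swap12 swap23 swap12; do 3!apply/neg0; apply/le_case.
  by rewrite (ltnW jk) (ltnW ij).
Qed.

Lemma near_eq_jacobian (R : realType) (k n : nat) (f h : 'rV[R]_k -> 'rV[R]_n)
    q : differentiable f q -> differentiable h q -> {near q, f =1 h} ->
  'J f q = 'J h q.
Proof.
have rowJ g i : differentiable g q ->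
    row i ('J g q) = 'D_(delta_mx 0 i) g q :> 'rV[R]_n.
  by move=> dg; rewrite rowE mul_jacobian.
move=> df dh fh; apply/row_matrixP => i.
exact: (etrans (rowJ f i df) (etrans (near_eq_derive _ fh)
  (esym (rowJ h i dh)))).
Qed.

Section GaussMap.
Context (R : realType) (m s : nat) (M : oriented_surface R).
Context (x : M -> 'rV[R]_m.+1) (hx : spacelike_surface s x).
Implicit Types (c d : chart R M) (p : M).

(** A change of orthonormal basis with positive determinant is a rotation, and its
    determinant is 1. *)
Lemma rotation_wedge3 (n : nat) (y e1 e2 f1 f2 : 'rV[R]_n) (B : 'M[R]_2) t :
  inner s e1 e1 = 1 -> inner s e2 e2 = 1 -> inner s e1 e2 = 0 ->
  inner s f1 f1 = 1 -> inner s f2 f2 = 1 -> inner s f1 f2 = 0 ->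
  0 < \det B -> col_mx e1 e2 = B *m col_mx f1 f2 ->
  wedge3 y e1 e2 t = wedge3 y f1 f2 t.
Proof.
rewrite -![inner s _ _]/(dot s _ _).
move=> e11 e22 e12 f11 f22 f12 B0 ef.
have l0 : lshift 1 (0 : 'I_1) = 0 :> 'I_(1 + 1) by exact: val_inj.
have r1 : rshift 1 (0 : 'I_1) = 1 :> 'I_(1 + 1) by exact: val_inj.
have colE i j : (B *m col_mx f1 f2) i j = B i 0 * f1 0 j + B i 1 * f2 0 j.
  rewrite [LHS]mxE (@big_split_ord _ _ _ 1 1) !big_ord1. 
  transitivity (B i (lshift 1 (0 : 'I_1)) * f1 0 j
    + B i (rshift 1 (0 : 'I_1)) * f2 0 j).
    by congr (_ * _ + _ * _); [exact: col_mxEu|exact: col_mxEd].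
  by rewrite l0 r1.
have e1E : e1 = B 0 0 *: f1 + B 0 1 *: f2.
  apply/rowP => j; rewrite !mxE -colE -ef -l0; apply/esym; exact: col_mxEu.
have e2E : e2 = B 1 0 *: f1 + B 1 1 *: f2.
  apply/rowP => j; rewrite !mxE -colE -ef -r1; apply/esym; exact: col_mxEd.
have detB : \det B = B 0 0 * B 1 1 - B 0 1 * B 1 0.
  rewrite (expand_det_row _ 0) !big_ord_recl big_ord0 /cofactor !det_mx11 !mxE.
  rewrite (_ : lift ord0 ord0 = 1 :> 'I_2); last exact: val_inj.
  rewrite (_ : lift 1 0 = 0 :> 'I_2); last exact: val_inj.
  by rewrite /= !expr0 expr1; ring.
move: e11 e22 e12; rewrite e1E e2E !dotE (dotC _ f2 f1) f11 f22 f12.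
set a := B 0 0; set b := B 0 1; set c := B 1 0; set d := B 1 1.
move=> H1 H2 H3; have det2 : (a * d - b * c) ^+ 2 = 1.
  apply: (eq_comb3 H1 H2 H3 (c1 := 1) (c2 := a * a + b * b)
    (c3 := - (a * c + b * d))); ring.
have det1 : a * d - b * c = 1.
  move: B0; rewrite detB -/a -/b -/c -/d => B0.
  move/eqP: det2; rewrite sqrf_eq1 => /orP[/eqP //|/eqP Bm].
  by move: B0; rewrite Bm ltr0N1.
rewrite !wedge3E !minor3E (minor3_swap23 _ _ _ y f1 f2).
rewrite -[RHS]mul1r -det1; ring.
Qed.

Lemma change_basis_mx (n : nat) (A B T : 'M[R]_2) (E G J K : 'M[R]_(2, n)) :
  B \in unitmx -> E = A *m J -> G = B *m K -> J = T *m K ->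
  E = A *m T *m invmx B *m G.
Proof. by move=> Bu -> -> ->; rewrite !mulmxA mulmxKV. Qed.

Lemma oriented_basis_wedge3 p e1 e2 f1 f2 t :
  oriented_orthonormal_basis s x p e1 e2 ->
  oriented_orthonormal_basis s x p f1 f2 ->
  wedge3 (x p) e1 e2 t = wedge3 (x p) f1 f2 t.
Proof.
move=> [e11 e22 e12 [c [ca cp [A [A0 eA]]]]] [f11 f22 f12 [d [da dp [B [B0 fB]]]]].
pose q := chart_fun c p; pose tr := chart_fun d \o chart_inv c.
have [tsmooth tdet] := atlas_compat ca da.
have Uq : (chart_fun c @` (chart_dom c `&` chart_dom d)) q by exists p.
have invq : chart_inv c q = p by rewrite chart_funK.
have dt : differentiable tr q := smooth_differentiable tsmooth Uq.
have trq : tr q = chart_fun d p by rewrite /tr /= invq.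
have nearq : \forall q' \near q, x (chart_inv c q') = x (chart_inv d (tr q')).
  apply: (@near_chart_inv _ _ c p (fun p' => x p' = x (chart_inv d (chart_fun d p')))) => //.
  by apply: filterS (chart_dom_nbhs dp) => p' dp'; rewrite chart_funK.
have dxd : differentiable (x \o chart_inv d) (tr q).
  by rewrite trq; apply: (surface_differentiable hx da); exact: chart_imgP.
have JE : tangent_mx x c q = 'J tr q *m tangent_mx x d (chart_fun d p).
  have dxc : differentiable (x \o chart_inv c) q.
    by apply: (surface_differentiable hx ca); exact: chart_imgP.
  have J1 := near_eq_jacobian dxc (differentiable_comp dt dxd) nearq.
  exact: (etrans J1 (etrans (jacobian_comp dt dxd)
    (congr1 (fun b => 'J tr q *m 'J (x \o chart_inv d) b) trq))).
have Bunit : B \in unitmx by rewrite unitmxE unitfE gt_eqF.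
apply: (@rotation_wedge3 _ _ _ _ _ _ (A *m 'J tr q *m invmx B)) => //.
  by rewrite !det_mulmx det_inv !mulr_gt0 ?invr_gt0 //; apply: tdet.
exact: (change_basis_mx Bunit eA fB JE).
Qed.

End GaussMap.

Section ChartGauss.
Context (R : realType) (m s : nat) (M : oriented_surface R).
Context (x : M -> 'rV[R]_m.+1) (hx : spacelike_surface s x).
Context (c : chart R M) (ca : atlas c) (p0 : M) (cp0 : chart_dom c p0).
Notation P := (chart_patch hx ca cp0).
Notation F := (x \o chart_inv c).
Notation A := (sfun (patch_region P)).
Notation X := (patchX P).
Notation e1 := (patch_e1 P).
Notation e2 := (patch_e2 P).
Notation dP := (@patch_d _ _ _ P).
Notation rho1 := (patch_rho1 P).
Notation rho2 := (patch_rho2 P).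
Notation E1 := (gsE1 dP rho1).
Notation E2 := (gsE2 s dP rho1 rho2 X).
Notation g := (coord_metric s dP X).
Notation o0 := (ord0 : 'I_2).
Notation o1 := (lift ord0 ord0 : 'I_2).
Implicit Types (q : 'rV[R]_2).

Lemma triangular_mx (n : nat) (r0 r1 : 'rV[R]_n) (J : 'M[R]_(2, n)) (a b d : R) :
  row o0 J = r0 -> row o1 J = r1 -> 0 < a -> 0 < d ->
  exists B : 'M[R]_2, 0 < \det B /\
    col_mx (a *: r0) (b *: r0 + d *: r1) = B *m J.
Proof.
move=> <- <- a0 d0; exists (@block_mx R 1 1 1 1 a%:M 0 b%:M d%:M).
split.
  rewrite (_ : \det _ = a * d) ?mulr_gt0 //.
  by apply: (etrans (@det_lblock _ 1 1 _ _ _)); rewrite !det_scalar1.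
have JE : J = col_mx (row o0 J) (row o1 J) :> 'M[R]_(1 + 1, n).
  rewrite -[LHS](@vsubmxK _ 1 1); congr col_mx; apply/rowP => j; rewrite !mxE;
    by congr (J _ _); exact: val_inj.
apply: (etrans _ (congr1 (fun K : 'M[R]_(1 + 1, n) =>
  @block_mx R 1 1 1 1 a%:M 0 b%:M d%:M *m K) (esym JE))).
by rewrite mul_block_col !mul_scalar_mx mul0mx addr0.
Qed.

Lemma at_patch_e q : chart_img c q ->
  at_pt q e1 = rho1 q *: 'D_(delta_mx 0 o0) F q /\
  at_pt q e2 = gs21 s dP rho1 rho2 X q *: 'D_(delta_mx 0 o0) F q
    + gs22 s dP rho1 rho2 X q *: 'D_(delta_mx 0 o1) F q.
Proof.
move=> Uq; have D i : at_pt q (map_mx (dP i) X) = 'D_(delta_mx 0 i) F q.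
  exact: at_patch_der.
split; first exact: (etrans (at_ptZ _ _ _) (congr1 _ (D o0))).
apply: (etrans (at_ptD _ _ _)) => //.
by congr (_ + _); [exact: (etrans (at_ptZ _ _ _) (congr1 _ (D o0)))
                  |exact: (etrans (at_ptZ _ _ _) (congr1 _ (D o1)))].
Qed.

Lemma invsqrt_gt0 (f : A) (f0 : forall a, patch_region P a -> 0 < f a) q :
  chart_img c q -> 0 < sf_invsqrt f0 q.
Proof. by move=> Uq; rewrite sf_invsqrtE // invr_gt0 sqrtr_gt0 f0. Qed.

Lemma chart_basis q : chart_img c q ->
  oriented_orthonormal_basis s x (chart_inv c q) (at_pt q e1) (at_pt q e2).
Proof.
move=> Uq; have fr := patch_frame P.
split.
- exact: (patch_dot1 (P := P) Uq (frame11 fr)).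
- exact: (patch_dot1 (P := P) Uq (frame22 fr)).
- exact: (patch_dot0 (P := P) Uq (frame12 fr)).
exists c; split=> //; first exact: chart_inv_dom.
rewrite chart_invK //; have [-> ->] := at_patch_e Uq.
have r1 : 0 < rho1 q by exact: invsqrt_gt0.
have r2 : 0 < rho2 q by exact: invsqrt_gt0.
have g0 : 0 < g o0 o0 q by exact: patch_g00.
apply: triangular_mx => //.
- exact: (row_tangent hx _ ca Uq).
- exact: (row_tangent hx _ ca Uq).
by rewrite /gs22 !sf_mulE // !mulr_gt0.
Qed.

Lemma at_minor3 i j k (u v w : 'rV[A]_m.+1) q : chart_img c q ->
  minor3 i j k u v w q = minor3 i j k (at_pt q u) (at_pt q v) (at_pt q w).
Proof.
by move=> Uq; rewrite /minor3 !(sf_addE, sf_oppE, sf_mulE) // !mxE.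
Qed.

Lemma gauss_mapE q t : chart_img c q -> gauss_map s x (chart_inv c q) t
  = minor3 (triple_at t 0) (triple_at t 1) (triple_at t ord_max) X e1 e2 q.
Proof.
move=> Uq; have eb := chart_basis Uq.
have -> : gauss_map s x (chart_inv c q)
    = wedge3 (x (chart_inv c q)) (at_pt q e1) (at_pt q e2).
  apply: xget_unique; first by exists (at_pt q e1), (at_pt q e2).
  move=> w [f1 [f2 [fb ->]]]; apply/ffunP => t'.
  exact: (oriented_basis_wedge3 hx _ fb eb).
rewrite wedge3E at_minor3 //; congr minor3.
by rewrite (at_patchX (P := P)).
Qed.

Lemma chart_metricE q i j : chart_img c q -> metric s x c q i j = g i j q.
Proof.
move=> Uq; rewrite mxE (row_tangent hx i ca Uq) (row_tangent hx j ca Uq).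
exact: (esym (patch_metricE (P := P) i j Uq)).
Qed.

(** A left inverse of a square matrix is its inverse. *)
Lemma chart_inv_metricE q k l : chart_img c q ->
  invmx (metric s x c q) k l = coord_inv_metric s dP rho1 rho2 X k l q.
Proof.
move=> Uq; have UPq : patch_region P q by [].
pose B := \matrix_(i, j) coord_inv_metric s dP rho1 rho2 X i j q.
have BG : B *m metric s x c q = 1%:M.
  apply/matrixP => i j; rewrite !mxE.
  have := coord_inv_metricP (sf_invsqrtP (patch_g00 (P := P)))
    (sf_invsqrtP (patch_det (P := P))) i j.
  move=> /(congr1 (fun f : A => f q)); rewrite (sf_sumE _ _ _ UPq).
  have -> : ((i == j)%:R : A) q = (i == j)%:R.
    by case: (i == j); [exact: sf_1E|exact: sf_0E].
  move=> <-; apply: eq_bigr => h _; rewrite (sf_mulE _ _ UPq) chart_metricE //.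
  by rewrite mxE.
have [_ Gu] := mulmx1_unit BG.
have -> : invmx (metric s x c q) = B.
  by rewrite -[LHS]mul1mx -BG mulmxK.
by rewrite mxE.
Qed.

Lemma chart_christoffelE q k i j : chart_img c q ->
  christoffel s x c k i j q
  = coord_christoffel s dP (patch_half P) rho1 rho2 X k i j q.
Proof.
move=> Uq; have UPq : patch_region P q by [].
have D a b d : partial a (fun r => metric s x c r b d) q
    = dP a (g b d) q.
  apply/esym/(sf_derE' _ UPq) => r Ur.
  exact: (esym (chart_metricE b d Ur)).
rewrite /christoffel /coord_christoffel (sf_mulE _ _ UPq) (sf_sumE _ _ _ UPq).
congr (_ * _); first exact: (esym (sf_cstE _ UPq)).
apply: eq_bigr => l _.
apply: (etrans _ (esym (sf_mulE _ _ UPq))); congr (_ * _).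
  exact: chart_inv_metricE.
apply: (etrans _ (esym (sf_addE _ _ UPq))); congr (_ + _).
  apply: (etrans _ (esym (sf_addE _ _ UPq))); congr (_ + _); exact: D.
apply: (etrans _ (esym (sf_oppE _ UPq))); congr (- _); exact: D.
Qed.

(** The Christoffel symbols and the inverse metric of the chart are the values of the
    corresponding elements of the ring, where the Laplacian has been expressed in
    the Gram-Schmidt frame. *)
Lemma laplacianE (f : M -> R) (G : A) p : chart_dom c p ->
  (forall q, chart_img c q -> f (chart_inv c q) = G q) ->
  laplacian s x c f p = - frame_laplacian s E1 E2 e1 e2 G (chart_fun c p).
Proof.
move=> cp fG; set q := chart_fun c p; have Uq : chart_img c q by exists p.
have UPq : patch_region P q by [].
have D1 i r : chart_img c r -> dP i G r = partial i (f \o chart_inv c) r.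
  move=> Ur; have UPr : patch_region P r by [].
  by apply: (sf_derE' _ UPr) => b Ub; rewrite -fG.
have D2 i j : dP i (dP j G) q = partial i (partial j (f \o chart_inv c)) q.
  by apply: (sf_derE' _ UPq) => b Ub; exact: D1.
have E := coord_laplacianE (@patch_d_derivation _ _ _ P)
  (@patch_d_comm _ _ _ P) (patch_halfE P) (patchXX P)
  (sf_invsqrtP (patch_g00 (P := P))) (sf_invsqrtP (patch_det (P := P))) G.
rewrite /laplacian -/q; congr (- _).
have <- := congr1 (fun f : A => f q) E.
rewrite (sf_sumE _ _ _ UPq); apply: eq_bigr => i _.
rewrite mxE (sf_sumE _ _ _ UPq); apply: eq_bigr => j _.
apply: (etrans _ (esym (sf_mulE _ _ UPq))); congr (_ * _).
  exact: chart_inv_metricE.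
rewrite mxE; apply: (etrans _ (esym (sf_addE _ _ UPq))); congr (_ + _).
  exact: (esym (D2 _ _)).
apply: (etrans _ (esym (sf_oppE _ UPq))); congr (- _).
apply: (etrans _ (esym (sf_sumE _ _ _ UPq))); apply: eq_bigr => k _.
apply: (etrans _ (esym (sf_mulE _ _ UPq))); congr (_ * _).
  exact: chart_christoffelE.
exact: (esym (D1 _ _ Uq)).
Qed.

End ChartGauss.

(** * Clifford tori as images of the standard one *)

Section TorusHom.
Context (R : realType) (n s : nat).
Notation "''[' u , v ]" := (dot s u v) (format "''[' u ,  v ]").
Implicit Types (L : 'I_4 -> 'rV[R]_n) (u : 'rV[R]_4) (v : 'rV[R]_n).

Lemma sum4_inord (V : nmodType) (f : 'I_4 -> V) :
  \sum_k f k = f (inord 0) + f (inord 1) + (f (inord 2) + f (inord 3)).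
Proof.
rewrite !big_ord_recl big_ord0 addr0 !addrA.
by congr (f _ + f _ + f _ + f _); apply: val_inj; rewrite /= inordK.
Qed.

Lemma standard_torusE u : standard_clifford_torus u <->
  \sum_k u 0 k ^+ 2 = 1 /\ \sum_k torus_sign R k * u 0 k ^+ 2 = 0.
Proof.
rewrite !sum4_inord /torus_sign !inordK //= !mul1r !mulN1r.
rewrite /standard_clifford_torus /=.
by split=> -[H1 H2]; split; lra.
Qed.

Lemma inner_std u : inner 0 u u = \sum_k u 0 k ^+ 2.
Proof.
apply: eq_bigr => k _; rewrite subn0 leqNgt ltn_ord /= expr0 mul1r.
by rewrite expr2.
Qed.

Lemma isometry_torus (h : 'Hom('rV[R]_4, 'rV[R]_n)) :
  (forall u v : 'rV[R]_4, inner s (h u) (h v) = inner 0 u v) ->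
  orthonormal4 s (fun k => h (delta_mx 0 k)) /\
  h @` @standard_clifford_torus R = torus_set s (fun k => h (delta_mx 0 k)).
Proof.
move=> hi; set L := fun k => _.
have oL : orthonormal4 s L.
  move=> i j; rewrite -[LHS]/(inner s _ _) hi -[LHS]/(dot 0 _ _) dot_delta.
  by rewrite subn0 leqNgt ltn_ord /= expr0 mul1r mxE eqxx eq_sym.
have hE u : h u = \sum_k u 0 k *: L k.
  rewrite {1}(row_sum_delta u) linear_sum; apply: eq_bigr => k _.
  by rewrite linearZ.
have hL u k : '[h u, L k] = u 0 k.
  rewrite hE dot_suml (bigD1 k) //= dotZl oL eqxx mulr1 big1 ?addr0 // => j jk.
  by rewrite dotZl oL (negPf jk) mulr0.
split=> //; apply/seteqP; split=> [v [u /standard_torusE[u1 u0] <-]|v [vs v1 v0]].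
  split.
  - by rewrite {1}hE; apply: eq_bigr => k _; rewrite hL.
  - by rewrite -[LHS]/(inner s _ _) hi inner_std.
  - by rewrite -[RHS]u0; apply: eq_bigr => k _; rewrite hL.
exists (\row_k '[v, L k]); last by rewrite hE [RHS]vs; apply: eq_bigr => k _; rewrite mxE.
apply/standard_torusE; split.
  by rewrite -[RHS]v1 (span_dot vs); apply: eq_bigr => k _; rewrite mxE.
by rewrite -[RHS]v0; apply: eq_bigr => k _; rewrite mxE.
Qed.

Definition hom_of L : 'Hom('rV[R]_4, 'rV[R]_n) :=
  linfun (mulmxr (\matrix_(k < 4) L k)).

Lemma hom_ofE L u : hom_of L u = \sum_k u 0 k *: L k.
Proof.
rewrite lfunE /= mulmx_sum_row; apply: eq_bigr => k _.
by congr (_ *: _); apply/rowP => j; rewrite !mxE.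
Qed.

Lemma hom_of_isometry L : orthonormal4 s L ->
  forall u v : 'rV[R]_4, inner s (hom_of L u) (hom_of L v) = inner 0 u v.
Proof.
move=> oL u v; rewrite -[LHS]/(dot s _ _) !hom_ofE dot_suml.
apply: eq_bigr => k _; rewrite subn0 leqNgt ltn_ord /= expr0 mul1r dotZl.
congr (_ * _); rewrite dotC dot_suml (bigD1 k) //= dotZl oL eqxx mulr1.
by rewrite big1 ?addr0 // => j jk; rewrite dotZl oL (negPf jk) mulr0.
Qed.

Lemma hom_of_delta L k : hom_of L (delta_mx 0 k) = L k.
Proof.
rewrite hom_ofE (bigD1 k) //= mxE !eqxx scale1r big1 ?addr0 // => j jk.
by rewrite mxE eqxx (negPf jk) scale0r.
Qed.

End TorusHom.

Lemma hom_of_pos_def (R : realType) (m s : nat) (L : 'I_4 -> 'rV[R]_m.+1) :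
  orthonormal4 s L -> pos_def_4space s (limg (hom_of L)).
Proof.
move=> oL; have hi := hom_of_isometry oL.
have h0 u : inner s (hom_of L u) (hom_of L u) = \sum_k u 0 k ^+ 2.
  by rewrite hi inner_std.
have pos (u : 'rV[R]_4) : u != 0 -> 0 < \sum_k u 0 k ^+ 2.
  move=> u0; rewrite lt_neqAle sumr_ge0 ?andbT // => [|k _]; last exact: sqr_ge0.
  apply: contra u0; rewrite eq_sym psumr_eq0 => [/allP H|k _]; last exact: sqr_ge0.
  apply/eqP/rowP => k; rewrite mxE.
  by have := H k (mem_index_enum k); rewrite /= sqrf_eq0 => /eqP.
split.
  have d4 : \dim {:'rV[R]_4} = 4%N by rewrite dimvf /dim /= mul1n.
  rewrite -[RHS]d4; apply: limg_dim_eq; apply/eqP; rewrite capfv; apply/lker0P.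
  move=> u v uv; apply/eqP; rewrite -subr_eq0; apply: contraT => /pos.
  by rewrite -h0 linearB /= uv subrr -[inner _ _ _]/(dot s _ _) dot0l ltxx.
move=> v /memv_imgP[u _ ->] hu; rewrite h0; apply: pos.
by apply: contraNneq hu => ->; rewrite linear0.
Qed.

(** * Global form of the surfaces with a 1-type Gauss map *)

Section FrameAlternating.
Context (A : comNzRingType) (n s : nat) (E1 E2 : A -> A) (X e1 e2 : 'rV[A]_n).
Notation fl := (frame_laplacian s E1 E2 e1 e2).

Lemma minor3_col12 i j k (u v w : 'rV[A]_n) :
  minor3 j i k u v w = - minor3 i j k u v w.
Proof. by rewrite /minor3; ring. Qed.

Lemma minor3_col23 i j k (u v w : 'rV[A]_n) :
  minor3 i k j u v w = - minor3 i j k u v w.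
Proof. by rewrite /minor3; ring. Qed.

Lemma minor3_col_eq i k (u v w : 'rV[A]_n) : minor3 i i k u v w = 0.
Proof. by rewrite /minor3; ring. Qed.

Hypotheses (dE1 : derivation E1) (dE2 : derivation E2).

Lemma frame_laplacianN f : fl (- f) = - fl f.
Proof.
rewrite /frame_laplacian !(derN dE1) !(derN dE2).
move: (E1 (E1 f)) (E2 (E2 f)) (E1 f) (E2 f) => a b c d.
by move: (conn1 _ _ _ _) (conn2 _ _ _ _) => y z; ring.
Qed.

Lemma frame_laplacian0 : fl 0 = 0.
Proof.
by rewrite /frame_laplacian !(der0 dE1) !(der0 dE2) !mulr0 subr0 !addr0.
Qed.

(** Equality of trivectors need only be tested on coordinates with increasing
    indices. *)
Lemma eigen_minor3 (l : A) :
  (forall i j k : 'I_n, (i < j < k)%N ->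
    fl (minor3 i j k X e1 e2) = - l * minor3 i j k X e1 e2) ->
  forall i j k, fl (minor3 i j k X e1 e2) = - l * minor3 i j k X e1 e2.
Proof.
move=> H i j k; apply/eqP; rewrite -subr_eq0; apply/eqP.
move: i j k; apply: alternating_ext => [i j k|i j k|i k|i j k ijk].
- by rewrite minor3_col12 frame_laplacianN mulrN opprB opprK addrC.
- by rewrite minor3_col23 frame_laplacianN mulrN opprB opprK addrC.
- by rewrite minor3_col_eq frame_laplacian0 mulr0 subr0.
- by rewrite H // subrr.
Qed.

End FrameAlternating.

Section GlobalTorus.
Context (R : realType) (m s : nat) (M : oriented_surface R).
Context (x : M -> 'rV[R]_m.+1) (hx : spacelike_surface s x).
Implicit Types (c : chart R M) (p : M) (L : 'I_4 -> 'rV[R]_m.+1).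

Section Eigen.
Context (l : R) (eig : laplace_eigen s x (gauss_map s x) l).

Lemma gauss_eigen_patch c p0 (ca : atlas c) (cp0 : chart_dom c p0)
    (P := chart_patch hx ca cp0) i j k :
  frame_laplacian s (gsE1 (@patch_d _ _ _ P) (patch_rho1 P))
    (gsE2 s (@patch_d _ _ _ P) (patch_rho1 P) (patch_rho2 P) (patchX P))
    (patch_e1 P) (patch_e2 P) (minor3 i j k (patchX P) (patch_e1 P) (patch_e2 P))
  = - sf_cst _ l * minor3 i j k (patchX P) (patch_e1 P) (patch_e2 P).
Proof.
have fr := patch_frame P.
move: i j k; apply: eigen_minor3; [exact: dE1 fr|exact: dE2 fr|].
move=> i j k ijk; have [t [<- <- <-]] := triple_of ijk.
apply: sfun_eq => q Uq.
have Vq : chart_img c q by [].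
have cp := chart_inv_dom Vq.
have := laplacianE (hx := hx) (ca := ca) (cp0 := cp0) cp
  (f := fun p' => gauss_map s x p' t) (fun q' => @gauss_mapE _ _ _ _ _ hx _ ca _ cp0 q' t).
rewrite (eig t ca cp) chart_invK // => H.
rewrite -[LHS]opprK.
apply: (etrans (congr1 -%R (esym H))).
rewrite (gauss_mapE hx ca cp0 t Vq) sf_mulE // sf_oppE // sf_cstE //.
by rewrite mulNr.
Qed.

Hypothesis l0 : l != 0.

Lemma local_torus p : exists2 L, orthonormal4 s L &
  \forall p' \near p, torus_set s L (x p').
Proof.
have [c ca cp] := atlas_cover p.
have Uq := chart_imgP cp.
have [L oL near] := patch_one_type l0 (gauss_eigen_patch ca cp) Uq.
exists L => //; exact: (near_chart cp near).
Qed.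

End Eigen.

(** Both tori contain the image of a common neighbourhood of p in a chart. *)
Lemma unique_torus L L' p : orthonormal4 s L -> orthonormal4 s L' ->
  (\forall p' \near p, torus_set s L (x p')) ->
  (\forall p' \near p, torus_set s L' (x p')) -> torus_set s L = torus_set s L'.
Proof.
move=> oL oL' nL nL'; have [c ca cp] := atlas_cover p.
have nb : nbhs (chart_fun c p) (chart_img c `&`
    [set q | torus_set s L (x (chart_inv c q)) /\
      torus_set s L' (x (chart_inv c q))]).
  apply: filterI; first exact: chart_img_nbhs.
  apply: filterI.
    exact: (near_chart_inv (Q := fun p' => torus_set s L (x p')) cp nL).
  exact: (near_chart_inv (Q := fun p' => torus_set s L' (x p')) cp nL').
move: nb; rewrite nbhsE => -[V [oV Vp] VS].
pose reg := Region oV (ex_intro _ _ Vp).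
have VU : reg `<=` chart_img c by move=> q /VS[].
apply: (patch_torus_unique (P := sub_patch hx ca VU)) => // q Vq.
  by have [_ []] := VS _ Vq.
by have [_ []] := VS _ Vq.
Qed.

(** The point sets on which a fixed torus contains the surface locally are open,
    and disjoint for distinct tori; connectedness leaves only one of them. *)
Lemma global_torus : nonharmonic_1type s x (gauss_map s x) ->
  exists2 L, orthonormal4 s L & forall p, torus_set s L (x p).
Proof.
move=> [l l0 eig]; have [p0 _] := surface_nonempty M.
have [L0 oL0 nL0] := local_torus eig l0 p0; exists L0 => //.
pose B := [set p : M | \forall p' \near p, torus_set s L0 (x p')].
have BT : B = setT.
  apply: surface_connected; first by exists p0.
    exists B; last by rewrite setTI.
    by rewrite openE => p /nbhs_interior.
  exists B; last by rewrite setTI.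
  move=> p clp; have [L oL nL] := local_torus eig l0 p.
  have [p1 [Bp1 np1]] := clp _ (nbhs_interior nL).
  by rewrite /B /= (unique_torus oL0 oL Bp1 np1).
by move=> p; have : B p by [rewrite BT]; exact: nbhs_singleton.
Qed.

End GlobalTorus.

(** * Open parts of Clifford tori *)

(** A linear equation satisfied by the surface is satisfied by the torus; the
    equations of W are the coordinates of the projection along W. *)
Lemma surface_spans_torus (R : realType) (m s : nat) (M : oriented_surface R)
    (x : M -> 'rV[R]_m.+1) (L : 'I_4 -> 'rV[R]_m.+1) (W : {vspace 'rV[R]_m.+1}) :
  spacelike_surface s x -> orthonormal4 s L -> (forall p, torus_set s L (x p)) ->
  (forall p, x p \in W) -> (limg (hom_of L) <= W)%VS.
Proof.
move=> hx oL xT xW; have [p0 _] := surface_nonempty M.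
have [c ca cp] := atlas_cover p0.
pose pr : 'End('rV[R]_m.+1) := (\1 - projv W)%VF.
have prE v : pr v = v - projv W v by rewrite add_lfunE opp_lfunE id_lfunE.
have pr0 v : (pr v == 0) = (v \in W).
  rewrite prE subr_eq0; apply/eqP/idP => [->|vW]; first exact: memv_proj.
  by rewrite projv_id.
pose y i : 'rV[R]_m.+1 :=
  \row_j ((-1) ^+ (m.+1 - s <= j)%N * pr (delta_mx 0 j) 0 i).
have dotE v i : inner s v (y i) = pr v 0 i.
  rewrite [v in RHS]row_sum_delta linear_sum summxE; apply: eq_bigr => j _.
  rewrite linearZ !mxE; case: (_ <= _)%N; rewrite ?expr0 ?expr1; ring.
have LW k : L k \in W.
  rewrite -pr0; apply/eqP/rowP => i; rewrite mxE -dotE.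
  apply: (patch_torus_full (P := chart_patch hx ca cp) oL).
    by move=> q _; exact: xT.
  move=> q _; rewrite -[dot _ _ _]/(inner s _ _) dotE.
  have /eqP -> : pr (x (chart_inv c q)) == 0 by rewrite pr0.
  by rewrite mxE.
apply/subvP => v /memv_imgP[u _ ->]; rewrite hom_ofE.
by apply: memv_suml => k _; apply: memvZ.
Qed.

(** Each point of the surface has a ball whose trace on the torus lies in the surface;
    the union of all balls with that property is the open set. *)
Lemma surface_open_in_torus (R : realType) (m s : nat) (M : oriented_surface R)
    (x : M -> 'rV[R]_m.+1) (L : 'I_4 -> 'rV[R]_m.+1) :
  spacelike_surface s x -> orthonormal4 s L -> (forall p, torus_set s L (x p)) ->
  open_part x (torus_set s L).
Proof.
move=> hx oL xT.
pose ball_in (b : 'rV[R]_m.+1 * R) :=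
  forall z, torus_set s L z -> `|z - b.1| < b.2 -> range x z.
have near_in p : exists2 r : R, 0 < r & ball_in (x p, r).
  have [c ca cp] := atlas_cover p.
  have [r r0 rT] := torus_patch_open (P := chart_patch hx ca cp) oL
    (fun q _ => xT (chart_inv c q)) (chart_imgP cp).
  exists r => // z zT /= zr.
  have zr' : `|z - x (chart_inv c (chart_fun c p))| < r by rewrite chart_funK.
  by have [b _ <-] := rT z zT zr'; exists (chart_inv c b).
exists (\bigcup_(b in ball_in) ball b.1 b.2).
  apply: bigcup_open => b _; exact: ball_open.
apply/seteqP; split=> [_ [p _ <-]|z [zT [b bin zb]]].
  split; first exact: xT.
  have [r r0 rin] := near_in p; exists (x p, r) => //; exact: ballxx.
by apply: bin zT _; move: zb; rewrite -ball_normE /ball_ /= distrC.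
Qed.

Lemma torus_one_type (R : realType) (m s : nat) (M : oriented_surface R)
    (x : M -> 'rV[R]_m.+1) (L : 'I_4 -> 'rV[R]_m.+1) :
  spacelike_surface s x -> orthonormal4 s L -> (forall p, torus_set s L (x p)) ->
  laplace_eigen s x (gauss_map s x) 2.
Proof.
move=> hx oL xT c p t ca cp; have Uq := chart_imgP cp.
rewrite (laplacianE (hx := hx) (ca := ca) (cp0 := cp) cp
  (f := fun p' => gauss_map s x p' t)
  (fun q' => @gauss_mapE _ _ _ _ _ hx _ ca _ cp q' t)).
have inT q : chart_img c q -> torus_set s L ((x \o chart_inv c) q).
  by move=> _; exact: xT.
rewrite (patch_torus_laplacian (P := chart_patch hx ca cp) oL inT).
have := gauss_mapE hx ca cp t Uq; rewrite chart_funK // => ->.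
move: (minor3 _ _ _ _ _ _) => f; have UPq : patch_region (chart_patch hx ca cp) (chart_fun c p) by [].
have -> : - 2 * f = - (f + f) by rewrite mulNr mulr_natl mulr2n.
by rewrite sf_oppE // opprK sf_addE // mulr_natl mulr2n.
Qed.

Theorem theorem3 (R : realType) (m s : nat) (hs : (s <= m)%N)
    (M : oriented_surface R) (x : M -> 'rV[R]_m.+1)
    (hx : spacelike_surface s x) :
  nonharmonic_1type s x (gauss_map s x) <->
  exists (V : {vspace 'rV[R]_m.+1}) (T : set 'rV[R]_m.+1),
    [/\ pos_def_4space s V, clifford_torus_in s V T, open_part x T
      & lies_fully s x V].
Proof.
split=> [one_type|[V [T [_ [h [_ hi hT]] [U _ xU] _]]]].
  have [L oL xT] := global_torus hx one_type.
  exists (limg (hom_of L)), (torus_set s L); split.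
  - exact: hom_of_pos_def.
  - exists (hom_of L); split=> //; first exact: hom_of_isometry.
    have [_ ->] := isometry_torus (hom_of_isometry oL).
    by congr torus_set; apply/funext => k; rewrite hom_of_delta.
  - exact: surface_open_in_torus.
  - split=> [_ [p _ <-]|W xW]; last exact: (surface_spans_torus hx oL xT xW).
    split; last by have [_ + _] := hx; apply.
    have [xp _ _] := xT p; rewrite /= xp.
    by apply: memv_suml => k _; rewrite memvZ // -(hom_of_delta L) memv_img ?memvf.
have [oL hE] := isometry_torus hi.
exists 2; first by rewrite pnatr_eq0.
apply: (torus_one_type hx oL) => p; rewrite -hE -hT.
by have [] : (T `&` U) (x p) by rewrite -xU; exists p.
Qed.
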